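(* The set of positive invertible isometries $T\in\mathcal{I}_1$ whose weak limit semigroup $\mathcal{L}_T$ contains every operator $\sum_{n=0}^{N}a_nT^n$ with $N\ge0$ and $(a_n)_{0\le n\le N}\subseteq[0,1]$ satisfying $\sum_{n=0}^{N}a_n=1$ is dense in $(\mathcal{I}_1,\mathrm{SOT})$ and in $(\mathcal{U}_1,\mathrm{SOT})$.
   Context: $L^1[0,1]$ is the complex $L^1$-space of Lebesgue measure. An operator $T$ on it is positive if $Tf\ge0$ whenever $f\ge0$. $\mathcal{I}_1$ and $\mathcal{U}_1$ denote the sets of positive (linear) isometries and positive invertible (surjective) isometries of $L^1[0,1]$. SOT is the strong operator topology. $\mathcal{L}_T$ is the set of operators $S$ on $L^1[0,1]$ such that $T^{n_k}\to S$ in the weak operator topology (i.e. $\int (T^{n_k}f)g\,dm\to\int (Sf)g\,dm$ for all $f\in L^1[0,1]$, $g\in L^\infty[0,1]$) for some strictly increasing sequence $(n_k)$ in $\mathbb{N}$. *)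

(* Defs.v *)
From HB Require Import structures.
From mathcomp Require Import all_boot all_order all_algebra.
From mathcomp Require Import all_classical all_reals all_analysis.
From mathcomp Require Import measurable_realfun.
From mathcomp Require Import generic_quotient ring_quotient complex.

Set Implicit Arguments.
Unset Strict Implicit.
Unset Printing Implicit Defensive.

Import Order.TTheory GRing.Theory Num.Theory.
Import numFieldNormedType.Exports.
Import ComplexField.Normc.

Local Open Scope classical_set_scope.
Local Open Scope complex_scope.
Local Open Scope quotient_scope.
Local Open Scope ring_scope.

Local Notation Re := complex.Re.
Local Notation Im := complex.Im.

Section complex_parts.
Context {R : rcfType}.
Implicit Types x y z : R[i].

Lemma ReD x y : Re (x + y) = Re x + Re y.
Proof. by case: x; case: y. Qed.

Lemma ImD x y : Im (x + y) = Im x + Im y.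
Proof. by case: x; case: y. Qed.

Lemma ReM x y : Re (x * y) = Re x * Re y - Im x * Im y.
Proof. by case: x; case: y. Qed.

Lemma ImM x y : Im (x * y) = Re x * Im y + Im x * Re y.
Proof. by case: x; case: y. Qed.

Lemma normcE z : (normc z)%:C = `|z|.
Proof. by []. Qed.

Lemma normc_ge0 z : 0 <= normc z.
Proof. by rewrite -ler0c normcE. Qed.

Lemma normc_leD x y : normc (x + y) <= normc x + normc y.
Proof. by rewrite -lecR rmorphD /= !normcE ler_normD. Qed.

Lemma normc_leRI z : normc z <= `|Re z| + `|Im z|.
Proof.
rewrite -(@ler_pXn2r _ 2) ?nnegrE ?normc_ge0 ?addr_ge0//.
case: z => a b /=; rewrite sqr_sqrtr ?addr_ge0 ?sqr_ge0//.
rewrite sqrrD !real_normK ?num_real// -addrA lerD2l lerDr.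
by rewrite mulrn_wge0 ?mulr_ge0.
Qed.

End complex_parts.

(* R[i] carries no measurable structure in the library, so measurability and
   integration of complex-valued functions go through Re and Im. *)
Section cintegrable.
Context d {T : measurableType d} {R : realType}.
Variables (mu : {measure set T -> \bar R}) (D : set T).
Implicit Types f g : T -> R[i].

Definition cmeasurable_fun f : Prop :=
  measurable_fun D (fun x => Re (f x)) /\ measurable_fun D (fun x => Im (f x)).

Definition cintegrable f : Prop :=
  mu.-integrable D (fun x => (Re (f x))%:E) /\
  mu.-integrable D (fun x => (Im (f x))%:E).

Definition cintegral f : R[i] :=
  (\int[mu]_(x in D) Re (f x)) +i* (\int[mu]_(x in D) Im (f x)).

Definition cintegrable_pred : {pred T -> R[i]} :=
  [pred f | `[< cintegrable f >]].

Hypothesis mD : measurable D.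

Lemma cintegrable_submod_closed : submod_closed cintegrable_pred.
Proof.
split=> [|a f g]; first by apply/asboolP; split; exact: integrable0.
move=> /asboolP[fr fi] /asboolP[gr gi]; apply/asboolP; split.
- rewrite [X in _.-integrable _ X](_ : _ =
      (fun x => ((Re a)%:E * (Re (f x))%:E + (- Im a)%:E * (Im (f x))%:E
        + (Re (g x))%:E)%E)); last first.
    by apply/funext => x; rewrite ReD ReM -!EFinM -!EFinD mulNr.
  by apply: integrableD => //; apply: integrableD => //; exact: integrableZl.
- rewrite [X in _.-integrable _ X](_ : _ =
      (fun x => ((Re a)%:E * (Im (f x))%:E + (Im a)%:E * (Re (f x))%:E
        + (Im (g x))%:E)%E)); last first.
    by apply/funext => x; rewrite ImD ImM -!EFinM -!EFinD.
  by apply: integrableD => //; apply: integrableD => //; exact: integrableZl.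
Qed.

Lemma measurable_normc f : cmeasurable_fun f ->
  measurable_fun D (fun x => normc (f x)).
Proof.
move=> [mr mi].
rewrite [X in measurable_fun _ X](_ : _ =
    (fun x => Num.sqrt (Re (f x) ^+ 2 + Im (f x) ^+ 2))); last first.
  by apply/funext => x; case: (f x).
apply: (measurableT_comp (continuous_measurable_fun (@sqrt_continuous R))).
by apply: measurable_funD; exact: measurable_funX.
Qed.

Lemma cintegrable_measurable f : cintegrable f -> cmeasurable_fun f.
Proof.
move=> [/integrableP[/measurable_EFinP mr _] /integrableP[/measurable_EFinP mi _]].
by split.
Qed.

Lemma integrable_normc f : cintegrable f ->
  mu.-integrable D (EFin \o (fun x => normc (f x))).
Proof.
move=> fint; have [fr fi] := fint.
have /(le_integrable mD) := integrableD mD (integrable_abse fr)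
  (integrable_abse fi).
apply.
  by apply/measurable_EFinP; apply: measurable_normc; exact: cintegrable_measurable.
move=> x Dx /=; rewrite lee_fin ger0_norm ?normc_ge0// ger0_norm ?addr_ge0//.
exact: normc_leRI.
Qed.

End cintegrable.

(* The closure properties below need D measurable, hence the proof argument. *)
Definition L1fun_pred d (T : measurableType d) (R : realType)
    (mu : {measure set T -> \bar R}) (D : set T) of measurable D :
    {pred T -> R[i]} :=
  cintegrable_pred mu D.

Section L1fun.
Context d {T : measurableType d} {R : realType}.
Variables (mu : {measure set T -> \bar R}) (D : set T) (mD : measurable D).

HB.instance Definition _ :=
  GRing.isSubmodClosed.Build R[i] (T -> R[i]) (L1fun_pred mu mD)
    (cintegrable_submod_closed mu mD).

Record L1fun := MkL1fun {
  L1fun_val :> T -> R[i];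
  _ : L1fun_val \in L1fun_pred mu mD }.

HB.instance Definition _ := [isSub for L1fun_val].
HB.instance Definition _ := [Choice of L1fun by <:].
HB.instance Definition _ := [SubChoice_isSubLmodule of L1fun by <:].

Lemma L1funP (f : L1fun) : cintegrable mu D f.
Proof. by case: f => f fP; exact/asboolP. Qed.

Definition null_L1fun : {pred L1fun} :=
  [pred f : L1fun | `[< f = (cst 0 : T -> R[i]) %[ae mu in D] >]].

Lemma null_L1fun_zmod_closed : zmod_closed null_L1fun.
Proof.
split=> [|f g]; first by apply/asboolP; exact: aeW.
move=> /asboolP f0 /asboolP g0; apply/asboolP.
apply: filterS2 f0 g0 => x f0 g0 Dx.
by rewrite -[LHS]/(f x - g x) f0// g0// subrr.
Qed.

HB.instance Definition _ :=
  GRing.isZmodClosed.Build L1fun null_L1fun null_L1fun_zmod_closed.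

(* The complex L^1(D, mu): integrable functions modulo equality a.e. on D
   (functions are defined on all of T; their values outside D play no role). *)
Definition L1 : Type := Quotient.quot null_L1fun.

HB.instance Definition _ := GRing.Zmodule.on L1.
HB.instance Definition _ := EqQuotient.on L1.


Definition L1_of (f : L1fun) : L1 := \pi_L1 f.

Lemma L1_ofP (f g : L1fun) : L1_of f = L1_of g <-> f = g %[ae mu in D].
Proof.
split=> [/eqP|fg].
  rewrite piE /= Quotient.equivE => /asboolP; apply: filterS => x /= fg Dx.
  by apply/eqP; rewrite -subr_eq0; apply/eqP; exact: fg.
apply/eqP; rewrite piE /= Quotient.equivE; apply/asboolP.
apply: filterS fg => x fg Dx.
by rewrite -[LHS]/(f x - g x) fg// subrr.
Qed.

Lemma L1_ofK (f : L1) : L1_of (repr f) = f.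
Proof. exact: reprK. Qed.

Lemma L1_ofD : {morph L1_of : f g / f + g}.
Proof. by move=> f g; rewrite /L1_of !piE. Qed.

Lemma repr_L1_of (f : L1fun) : repr (L1_of f) = f %[ae mu in D].
Proof. by apply/L1_ofP; rewrite L1_ofK. Qed.

Definition L1_scale (a : R[i]) (f : L1) : L1 := L1_of (a *: repr f).

Lemma L1_scaleE a f : L1_scale a (L1_of f) = L1_of (a *: f).
Proof.
apply/L1_ofP; apply: filterS (repr_L1_of f) => x fx Dx.
by congr (a * _); exact: fx.
Qed.

Let L1_scaleA a b f : L1_scale a (L1_scale b f) = L1_scale (a * b) f.
Proof. by rewrite -[f]L1_ofK !L1_scaleE scalerA. Qed.

Let L1_scale1 : left_id 1 L1_scale.
Proof. by move=> f; rewrite -[f]L1_ofK L1_scaleE scale1r. Qed.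

Let L1_scaleDr : right_distributive L1_scale +%R.
Proof.
by move=> a f g; rewrite -[f]L1_ofK -[g]L1_ofK -L1_ofD !L1_scaleE scalerDr L1_ofD.
Qed.

Let L1_scaleDl f : {morph L1_scale^~ f : a b / a + b}.
Proof. by move=> a b; rewrite -[f]L1_ofK !L1_scaleE scalerDl L1_ofD. Qed.

HB.instance Definition _ := GRing.Zmodule_isLmodule.Build R[i] L1
  L1_scaleA L1_scale1 L1_scaleDr L1_scaleDl.

Lemma L1_ofZ a f : L1_of (a *: f) = a *: L1_of f.
Proof. by rewrite -L1_scaleE. Qed.

Definition L1_norm (f : L1) : R[i] :=
  (\int[mu]_(x in D) normc (repr f x))%:C.

Lemma L1_normE (f : L1fun) :
  L1_norm (L1_of f) = (\int[mu]_(x in D) normc (f x))%:C.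
Proof.
rewrite /L1_norm /Rintegral; congr (fine _)%:C.
have mn (g : L1fun) : measurable_fun D (fun x => (normc (g x))%:E).
  apply/measurable_EFinP; apply: measurable_normc.
  by apply: cintegrable_measurable; exact: L1funP.
apply: ae_eq_integral => //.
by apply: filterS (repr_L1_of f) => x fx Dx; rewrite fx.
Qed.

Let L1_normD f g : L1_norm (f + g) <= L1_norm f + L1_norm g.
Proof.
rewrite -[f]L1_ofK -[g]L1_ofK -L1_ofD !L1_normE -rmorphD lecR.
have int_norm (h : L1fun) := integrable_normc mD (L1funP h).
rewrite -RintegralD//; apply: le_Rintegral => //.
- by have := integrableD mD (int_norm (repr f)) (int_norm (repr g)).
- by move=> x _; exact: normc_leD.
Qed.

Let L1_normZ a f : L1_norm (a *: f) = `|a| * L1_norm f.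
Proof.
rewrite -[f]L1_ofK -L1_ofZ !L1_normE -normcE -rmorphM.
rewrite -RintegralZl//; last exact: integrable_normc (L1funP _).
by congr (_%:C); apply: eq_Rintegral => x _; rewrite /= -normcM.
Qed.

Let L1_norm_eq0 f : L1_norm f = 0 -> f = 0.
Proof.
rewrite -[f]L1_ofK L1_normE => /complexI f0.
have int_norm := integrable_normc mD (L1funP (repr f)).
have -> : 0 = L1_of 0 by rewrite /L1_of piE.
apply/L1_ofP.
have mf : measurable_fun D (EFin \o (fun x => normc (repr f x))).
  by have /integrableP[] := int_norm.
have intf0 : (\int[mu]_(x in D) `|(normc (repr f x))%:E| = 0)%E.
  under eq_integral do rewrite /= ger0_norm ?normc_ge0//.
  by rewrite -[LHS]fineK ?[fine _]f0//; exact: integrable_fin_num.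
have [/(_ intf0) fae _] := ae_eq_integral_abs mu mD mf.
apply: filterS fae => x fx Dx.
by have [/eq0_normc] := fx Dx.
Qed.

HB.instance Definition _ :=
  Lmodule_isNormed.Build R[i] L1 L1_normD L1_normZ L1_norm_eq0.

Lemma L1_normrE (f : L1fun) :
  `|L1_of f| = (\int[mu]_(x in D) normc (f x))%:C.
Proof. exact: L1_normE. Qed.

End L1fun.

Section operators.
Context d {T : measurableType d} {R : realType}.
Variables (mu : {measure set T -> \bar R}) (D : set T) (mD : measurable D).
Local Notation L1 := (L1 mu mD).
Implicit Types A S : L1 -> L1.

(* In the order of R[i], 0 <= z means that z is real and nonnegative. *)
Definition L1_nonneg (f : L1) : Prop :=
  \forall x \ae mu, D x -> 0 <= repr f x.

Definition positive_operator A : Prop :=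
  forall f, L1_nonneg f -> L1_nonneg (A f).

Definition bounded_operator A : Prop := linear A /\ continuous A.

(* The topology of pointwise convergence {ptws L1 -> L1}, for the norm of L1,
   induces the strong operator topology on sets of operators. *)
Definition positive_isometry : set {ptws L1 -> L1} :=
  [set A | [/\ linear A, positive_operator A & forall f, `|A f| = `|f|]].

Definition positive_invertible_isometry : set {ptws L1 -> L1} :=
  [set A | positive_isometry A /\ set_surj setT setT A].

(* Representatives of elements of L^oo(D, mu); L1_pairing does not depend on
   the choice of the representative. *)
Definition Linfty_fun (g : T -> R[i]) : Prop :=
  cmeasurable_fun D g /\
  exists M : R, \forall x \ae mu, D x -> normc (g x) <= M.

Definition L1_pairing (f : L1) (g : T -> R[i]) : R[i] :=
  cintegral mu D (fun x => repr f x * g x).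

Definition wot_cvg (S_ : nat -> L1 -> L1) S : Prop :=
  forall (f : L1) (g : T -> R[i]), Linfty_fun g ->
    (fun k => L1_pairing (S_ k f) g : R[i]^o) @ \oo -->
      (L1_pairing (S f) g : R[i]^o).

Definition weak_limit_semigroup A : set (L1 -> L1) :=
  [set S | bounded_operator S /\
    exists2 n_ : nat -> nat, {homo n_ : j k / (j < k)%N} &
      wot_cvg (fun k => iter (n_ k) A) S].

End operators.

Section unit_interval.
Variable R : realType.

Definition I01 : set (measurableTypeR R) := `[0%R, 1%R]%classic.

Lemma measurable_I01 : measurable I01.
Proof. exact: measurable_itv. Qed.

Definition L1_01 := L1 (@lebesgue_measure R) measurable_I01.

Definition I_1 : set {ptws L1_01 -> L1_01} :=
  positive_isometry (mD := measurable_I01).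

Definition U_1 : set {ptws L1_01 -> L1_01} :=
  positive_invertible_isometry (mD := measurable_I01).

End unit_interval.
Arguments I_1 R : clear implicits.
Arguments U_1 R : clear implicits.

(* Main.v *)
(* A Baire category argument inside the set of positive isometries.  A weak
   limit [sum a_n T^n] is produced by maps [T] admitting an integer [m] and
   multiplication operators [chi_n] with [T^m = sum chi_n T^n] and [chi_n]
   approximately equidistributed with mean [a_n].  To find such a map close to a
   given isometry [A], first approximate [A] on dyadic intervals by a piecewise
   affine isometry [U].  Then cut every cell into slots, arranged in towers of
   height [m - n] for a proportion [a_n] of the cell, and let [C] climb the towers,
   acting as [U] in the base variable; from the top floor it comes back to the
   bottom one by the power of [U] making it periodic.  On the towers of height
   [m - n] the operators [C^m] and [C^n] agree, and [C] differs from [U] only on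
   the top floors, which are negligible for large [m]. *)
From HB Require Import structures.
Require Import Defs.
From mathcomp Require Import all_boot all_order all_algebra.
From mathcomp Require Import all_classical all_reals all_analysis.
From mathcomp Require Import complex measurable_realfun.
From mathcomp Require Import ring lra zify.

Set Implicit Arguments.
Unset Strict Implicit.
Unset Printing Implicit Defensive.

Import Order.TTheory GRing.Theory Num.Theory.
Import numFieldNormedType.Exports.
Import ComplexField.Normc.
Local Open Scope classical_set_scope.
Local Open Scope complex_scope.
Local Open Scope ring_scope.
Local Notation Re := complex.Re.
Local Notation Im := complex.Im.

(** * Affine changes of variables *)

(** Neither invertibility nor the weak limit property can be read off finitely many vectors up to a
    small error, which is all that one step of a category argument controls. Both are therefore
    replaced by countably many conditions of that kind: approximate preimages of dyadic vectors for
    the former, since an isometry with dense range is onto, and approximate identities for [T^m]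
    with positive rational weights for the latter. The maps so obtained are invertible even when the
    isometry approximated is not, hence one construction inside the positive isometries yields both
    densities. The [chi_n] change from one stage to the next and are equidistributed only on step
    functions of bounded level. Since everything involved is a contraction, estimates on dyadic
    vectors extend to all of L^1, and commutation of the [chi_n] with bounded multiplications then
    brings in the test functions of the weak topology. *)

Section affine.
Variable R : realType.
Local Notation mu := (@lebesgue_measure R).
Local Notation TR := (measurableTypeR R).
Local Open Scope ereal_scope.
Variables (c d : R).
Hypothesis c0 : (0 < c)%R.

Let b (x : TR) : TR := (c * x + d)%R.

Lemma measurable_affine : measurable_fun [set: TR] b.
Proof.
apply: measurable_funD; last exact: measurable_cst.
by apply: measurable_funM; [exact: measurable_cst|exact: measurable_id].
Qed.

Let mb_mixin := isMeasurableFun.Build _ _ _ _ _ measurable_affine.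
Let mb : {mfun TR >-> TR} := HB.pack b mb_mixin.

(** Uniqueness of Lebesgue measure: the scaled pushforward is a measure with the right values on
    half-open intervals. *)
Lemma lebesgue_measure_affine (A : set TR) : measurable A ->
  mu A = c%:E * mu (b @^-1` A).
Proof.
pose k : {nonneg R} := NngNum (ltW c0).
move=> mA; rewrite [RHS](_ : _ = mscale k (pushforward mu mb) A)//.
apply: lebesgue_measure_unique => //= _ [[u v]] _ <-.
rewrite /mscale /= -[pushforward _ _ _]/(mu (b @^-1` `]u, v]%classic)).
rewrite (_ : b @^-1` _ = `](u - d) / c, (v - d) / c]%classic)%R; last first.
  apply/seteqP; split => x /=; rewrite !in_itv/= /b => /andP[h1 h2];
    apply/andP; split; rewrite ?ltr_pdivrMr// ?ler_pdivlMr// in h1 h2 *; lra.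
rewrite !lebesgue_measure_itv/= !lte_fin.
have -> : ((u - d) / c < (v - d) / c)%R = (u < v)%R.
  by rewrite ltr_pM2r ?invr_gt0// ltrD2r.
case: ifPn => _; last by rewrite mule0.
rewrite -!EFinD -EFinM; congr EFin.
have c1 : c != 0%R by rewrite gt_eqF.
by field.
Qed.

Lemma ge0_integral_affine (f : TR -> \bar R) : measurable_fun setT f ->
  (forall x, 0 <= f x) -> \int[mu]_x f x = c%:E * \int[mu]_x f (b x).
Proof.
move=> mf f0.
pose k : {nonneg R} := NngNum (ltW c0).
have := @ge0_integral_pushforward _ _ _ _ R b measurable_affine mu setT f measurableT mf.
rewrite preimage_setT /comp => <-; last by move=> x _.
rewrite -[X in X * _]/(k%:num%:E) -(@ge0_integral_mscale _ _ _ (pushforward mu mb) setT _ k f)//.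
apply: eq_measure_integral => A mA _.
exact: (lebesgue_measure_affine mA).
Qed.

Lemma integrable_affine (f : TR -> R) : mu.-integrable setT (EFin \o f) ->
  mu.-integrable setT (EFin \o (f \o b)).
Proof.
move=> /integrableP[mf fi]; apply/integrableP; split.
  exact: (measurableT_comp mf measurable_affine).
have := @ge0_integral_affine (fun x => `|(EFin \o f) x|).
move=> /(_ _ (fun x => abse_ge0 _)) h; move: fi; rewrite h; last exact: measurableT_comp.
move=> h1; rewrite ltNge; apply/negP; rewrite leye_eq => /eqP h2.
by move: h1; rewrite [X in _ * X](_ : _ = +oo)// gt0_muley// lte_fin.
Qed.

Lemma Rintegral_affine (f : TR -> R) : mu.-integrable setT (EFin \o f) ->
  (\int[mu]_x f x = c * \int[mu]_x f (b x))%R.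
Proof.
move=> fi.
have mf : measurable_fun setT (EFin \o f) by case/integrableP: fi.
pose k : {nonneg R} := NngNum (ltW c0).
rewrite /Rintegral -[X in (X * _)%R]/(fine k%:num%:E) -fineM//; last first.
  by have := integrable_affine fi => /(integrable_fin_num measurableT).
congr fine.
rewrite integralE [in RHS]integralE.
rewrite muleBr//; last first.
  have h := integrable_affine fi.
  apply: fin_num_adde_defl; rewrite fin_numN.
  exact: (integrable_neg_fin_num measurableT h).
congr (_ - _).
  rewrite ge0_integral_affine//; last exact: measurable_funepos.
  by congr (_ * _); apply: eq_integral => x _; rewrite !funeposE.
rewrite ge0_integral_affine//; last exact: measurable_funeneg.
by congr (_ * _); apply: eq_integral => x _; rewrite !funenegE.
Qed.

Lemma negligible_affine (A : set TR) : mu.-negligible A -> mu.-negligible (b @^-1` A).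
Proof.
move=> [B [mB B0 AB]]; exists (b @^-1` B); split => //.
- by rewrite -[X in measurable X]setTI; exact: measurable_affine.
- apply/eqP; have := lebesgue_measure_affine mB; rewrite B0 => /esym/eqP.
  by rewrite mule_eq0 eqe gt_eqF.
- by move=> x; exact: AB.
Qed.

End affine.

(** * The space L^1[0,1] *)

Section complex_facts.
Variable R : realType.
Implicit Types z : R[i].

Lemma ge0_normc_Re z : 0 <= z <-> normc z = Re z.
Proof.
split=> [|h]; first by case: z => a b; rewrite lecE /= => /andP[/eqP -> a0]; rewrite expr0n addr0 sqrtr_sqr ger0_norm.
have r0 : 0 <= Re z by rewrite -h normc_ge0.
rewrite lecE r0 andbT /=.
move: h r0; case: z => a b /= h a0.
have : a ^+ 2 + b ^+ 2 = a ^+ 2 by rewrite -[in RHS]h sqr_sqrtr// addr_ge0// sqr_ge0.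
by move/eqP; rewrite -subr_eq0 addrC addKr sqrf_eq0.
Qed.

Lemma Re_le_normc z : `|Re z| <= normc z.
Proof.
case: z => a b /=; rewrite -sqrtr_sqr ler_wsqrtr// lerDl sqr_ge0//.
Qed.

Lemma Im_le_normc z : `|Im z| <= normc z.
Proof.
case: z => a b /=; rewrite -sqrtr_sqr ler_wsqrtr// lerDr sqr_ge0//.
Qed.

Lemma normc_real (a : R) : normc (a%:C) = `|a|.
Proof. by rewrite /= expr0n addr0 sqrtr_sqr. Qed.

End complex_facts.

Section L1_interval.
Variable R : realType.
Local Notation mu := (@lebesgue_measure R).
Local Notation TR := (measurableTypeR R).
Local Notation I := (@I01 R).
Local Notation mI := (@measurable_I01 R).
Local Notation L := (L1_01 R).
Local Notation cint := (cintegrable mu I).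

Lemma cintD (f g : TR -> R[i]) : cint f -> cint g -> cint (fun x => f x + g x).
Proof.
move=> hf hg; have [_ /(_ 1 f g)] := cintegrable_submod_closed mu mI.
move=> h; have /asboolP := h (asboolT hf) (asboolT hg).
by rewrite scale1r.
Qed.

Lemma cintZ (a : R[i]) (f : TR -> R[i]) : cint f -> cint (fun x => a * f x).
Proof.
move=> hf; have [h0 /(_ a f 0)] := cintegrable_submod_closed mu mI.
move=> h; have /asboolP := h (asboolT hf) h0.
by rewrite addr0.
Qed.

Lemma cint_eq (f g : TR -> R[i]) : (forall x, I x -> f x = g x) -> cint f -> cint g.
Proof.
move=> fg [h1 h2]; split.
  by apply: (@eq_integrable _ _ _ mu I mI _ _ _ h1) => x; rewrite inE => /fg ->.
by apply: (@eq_integrable _ _ _ mu I mI _ _ _ h2) => x; rewrite inE => /fg ->.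
Qed.

(** Totalised by 0 outside the integrable functions, so that operators can be defined by pointwise
    formulas without carrying integrability proofs. *)
Definition toL1 (f : TR -> R[i]) : L :=
  if pselect (cint f) is left H then L1_of (@MkL1fun _ _ _ mu I mI f (asboolT H))
  else 0.

Lemma toL1P (f : TR -> R[i]) : cint f ->
  exists2 F : L1fun mu mI, toL1 f = L1_of F & L1fun_val F = f.
Proof. by rewrite /toL1; case: pselect => // H _; exists (MkL1fun (asboolT H)). Qed.

Lemma repr_toL1 (f : TR -> R[i]) : cint f ->
  {ae mu, forall x, I x -> repr (toL1 f) x = f x}.
Proof. by move=> /toL1P[F -> <-]; exact: repr_L1_of. Qed.

Lemma cint_repr (f : L) : cint (repr f).
Proof. exact: L1funP. Qed.

Lemma eq_toL1 (f g : TR -> R[i]) : cint f -> cint g ->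
  {ae mu, forall x, I x -> f x = g x} -> toL1 f = toL1 g.
Proof.
move=> /toL1P[F -> FE] /toL1P[G -> GE] fg; apply/L1_ofP.
by rewrite FE GE.
Qed.

Lemma toL1_repr (f : L) : toL1 (repr f) = f.
Proof.
have [F -> FE] := toL1P (cint_repr f); rewrite -[RHS]L1_ofK; apply/L1_ofP.
by rewrite FE; apply: aeW.
Qed.

Lemma toL1D (f g : TR -> R[i]) : cint f -> cint g ->
  toL1 (fun x => f x + g x) = toL1 f + toL1 g.
Proof.
move=> fi gi; have [H -> HE] := toL1P (cintD fi gi).
have [F -> FE] := toL1P fi; have [G -> GE] := toL1P gi.
rewrite -L1_ofD; apply/L1_ofP; rewrite HE; apply: aeW => x _.
by rewrite -FE -GE.
Qed.

Lemma toL1Z (a : R[i]) (f : TR -> R[i]) : cint f ->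
  toL1 (fun x => a * f x) = a *: toL1 f.
Proof.
move=> fi; have [H -> HE] := toL1P (cintZ a fi).
have [F -> FE] := toL1P fi.
rewrite -L1_ofZ; apply/L1_ofP; rewrite HE; apply: aeW => x _.
by rewrite -FE.
Qed.

(** The norm of [L] is valued in [R[i]]; a real version gives access to the order and the arithmetic
    tactics of [R]. *)
Definition nrm (f : L) : R := \int[mu]_(x in I) normc (repr f x).

Lemma norm_nrm (f : L) : `|f| = (nrm f)%:C.
Proof. by []. Qed.

Lemma cint_normc (f : TR -> R[i]) : cint f ->
  mu.-integrable I (EFin \o (fun x => normc (f x))).
Proof. by apply: integrable_normc; exact: mI. Qed.

Lemma nrm_toL1 (f : TR -> R[i]) : cint f ->
  nrm (toL1 f) = \int[mu]_(x in I) normc (f x).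
Proof.
move=> /toL1P[F -> <-].
by have /(congr1 (@complex.Re R)) := L1_normE F.
Qed.

Lemma nrm_ge0 (f : L) : 0 <= nrm f.
Proof. by apply: Rintegral_ge0 => x _; exact: normc_ge0. Qed.

Lemma nrm_D (f g : L) : nrm (f + g) <= nrm f + nrm g.
Proof. by rewrite -lecR rmorphD /= -!norm_nrm ler_normD. Qed.

Lemma nrm_Z a (f : L) : nrm (a *: f) = normc a * nrm f.
Proof. by have /(congr1 (@complex.Re R)) := normrZ a f; rewrite -(Defs.normcE a) !norm_nrm -rmorphM /=. Qed.

Lemma nrm_ZR (a : R) (f : L) : nrm (a%:C *: f) = `|a| * nrm f.
Proof. by rewrite nrm_Z normc_real. Qed.

Lemma nrm_N (f : L) : nrm (- f) = nrm f.
Proof. by have /(congr1 (@complex.Re R)) := normrN f. Qed.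

Lemma nrm_0 : nrm 0 = 0.
Proof. by have /(congr1 (@complex.Re R)) := normr0 L. Qed.

Lemma nrm_eq0 (f : L) : nrm f = 0 -> f = 0.
Proof. by move=> h; apply/normr0_eq0; rewrite norm_nrm h. Qed.

Lemma nrm_B (f g : L) : nrm (f - g) = nrm (g - f).
Proof. by rewrite -nrm_N opprB. Qed.

Lemma nrm_sum (S : Type) (s : seq S) (P : pred S) (f : S -> L) :
  nrm (\sum_(i <- s | P i) f i) <= \sum_(i <- s | P i) nrm (f i).
Proof.
elim/big_rec2: _ => [|i y x _ h]; first by rewrite nrm_0.
by apply: (le_trans (nrm_D _ _)); rewrite lerD2l.
Qed.

Lemma nrm_tri (h f g : L) : nrm (f - g) <= nrm (f - h) + nrm (h - g).
Proof. by rewrite -[f - g](subrKA h) nrm_D. Qed.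

Definition Tot (f : L) : R[i] := cintegral mu I (repr f).

Lemma cintegral_ae (f g : TR -> R[i]) : cint f -> cint g ->
  {ae mu, forall x, I x -> f x = g x} -> cintegral mu I f = cintegral mu I g.
Proof.
move=> [/integrableP[f1 _] /integrableP[f2 _]] [/integrableP[g1 _] /integrableP[g2 _]] fg.
rewrite /cintegral /Rintegral; congr (fine _ +i* fine _).
  apply: ae_eq_integral => //; first exact: mI.
  by apply: filterS fg => x fg Ix; rewrite fg.
apply: ae_eq_integral => //; first exact: mI.
by apply: filterS fg => x fg Ix; rewrite fg.
Qed.

Lemma Tot_toL1 (f : TR -> R[i]) : cint f -> Tot (toL1 f) = cintegral mu I f.
Proof.
move=> fi; apply: cintegral_ae => //; first exact: cint_repr.
exact: repr_toL1.
Qed.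

Lemma cintegralD (f g : TR -> R[i]) : cint f -> cint g ->
  cintegral mu I (fun x => f x + g x) = cintegral mu I f + cintegral mu I g.
Proof.
move=> [f1 f2] [g1 g2]; rewrite /cintegral.
under eq_Rintegral do rewrite Defs.ReD.
under [X in _ +i* X]eq_Rintegral do rewrite Defs.ImD.
by rewrite !RintegralD//; exact: mI.
Qed.

Lemma cintegralZ a (f : TR -> R[i]) : cint f ->
  cintegral mu I (fun x => a * f x) = a * cintegral mu I f.
Proof.
move=> [f1 f2]; rewrite /cintegral.
under eq_Rintegral do rewrite Defs.ReM.
under [X in _ +i* X]eq_Rintegral do rewrite Defs.ImM.
have h (b : R) (h : TR -> R) : mu.-integrable I (EFin \o h) ->
    mu.-integrable I (EFin \o (fun x => b * h x)).
  by move=> hi; have := integrableZl mI b hi.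
rewrite RintegralB ?RintegralD ?RintegralZl//; try exact: h; try exact: mI.
case: a => a b /=; apply/eqP; rewrite eq_complex /= eqxx /=.
by rewrite eqxx.
Qed.

Lemma TotD f g : Tot (f + g) = Tot f + Tot g.
Proof.
rewrite -[f in f + _]toL1_repr -[g in _ + g]toL1_repr -toL1D; [|exact: cint_repr..].
rewrite Tot_toL1; last by apply: cintD; exact: cint_repr.
by rewrite cintegralD//; exact: cint_repr.
Qed.

Lemma TotZ a f : Tot (a *: f) = a * Tot f.
Proof.
rewrite -[f in _ *: f]toL1_repr -toL1Z; last exact: cint_repr.
rewrite Tot_toL1; last by apply: cintZ; exact: cint_repr.
by rewrite cintegralZ//; exact: cint_repr.
Qed.

Lemma Tot0 : Tot 0 = 0.
Proof. by rewrite -[0 in LHS](scale0r (0 : L)) TotZ mul0r. Qed.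

Lemma TotB f g : Tot (f - g) = Tot f - Tot g.
Proof. by rewrite -[- g]scaleN1r TotD TotZ mulN1r. Qed.

Lemma Tot_sum (S : Type) (s : seq S) (P : pred S) (f : S -> L) :
  Tot (\sum_(i <- s | P i) f i) = \sum_(i <- s | P i) Tot (f i).
Proof. by elim/big_rec2: _ => [|i y x _ <-]; rewrite ?Tot0// TotD. Qed.

Lemma Re_Tot_le f : `|Re (Tot f)| <= nrm f.
Proof.
have [f1 f2] := cint_repr f.
rewrite /Tot /cintegral /=; apply: (le_trans (le_normr_Rintegral mI f1)).
apply: le_Rintegral => //; [exact: mI|exact: integrable_norm|exact: cint_normc (cint_repr f)|].
by move=> x _; exact: Re_le_normc.
Qed.

Lemma Im_Tot_le f : `|Im (Tot f)| <= nrm f.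
Proof.
have [f1 f2] := cint_repr f.
rewrite /Tot /cintegral /=; apply: (le_trans (le_normr_Rintegral mI f2)).
apply: le_Rintegral => //; [exact: mI|exact: integrable_norm|exact: cint_normc (cint_repr f)|].
by move=> x _; exact: Im_le_normc.
Qed.

(** The factor 2 comes from bounding real and imaginary parts separately; it explains the constants
    3 and 4 in later estimates. *)
Lemma normc_Tot_le f : normc (Tot f) <= 2 * nrm f.
Proof.
apply: (le_trans (normc_leRI _)).
by have := Re_Tot_le f; have := Im_Tot_le f; lra.
Qed.

(* Positivity thus only depends on norms and integrals: it passes to limits of
   isometries, and contractions preserving the integral are positive. *)
Lemma L1_nonnegP (f : L) : L1_nonneg f <-> nrm f = Re (Tot f).
Proof.
have [f1 f2] := cint_repr f; have f3 := cint_normc (cint_repr f).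
rewrite /nrm /Tot /cintegral [RHS]/=.
split=> [h|/eqP].
  rewrite /Rintegral; congr fine; apply: ae_eq_integral; first exact: mI.
  - by case/integrableP: f3.
  - by case/integrableP: f1.
  - by apply: filterS h => x h Ix; rewrite (ge0_normc_Re _).1//; exact: h.
rewrite -subr_eq0 -RintegralB//; last exact: mI.
have i3 : mu.-integrable I (EFin \o (fun x => normc (repr f x) - Re (repr f x))).
  by have := integrableB mI f3 f1.
move=> /eqP i0.
have mf : measurable_fun I (EFin \o (fun x => normc (repr f x) - Re (repr f x))).
  by case/integrableP: i3.
have intf0 : (\int[mu]_(x in I) `|(normc (repr f x) - Re (repr f x))%:E| = 0)%E.
  under eq_integral.
    move=> x _; rewrite /= ger0_norm; last first.
      by rewrite subr_ge0 (le_trans (ler_norm _))// Re_le_normc.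
    over.
  by rewrite -[LHS]fineK ?[fine _]i0//; exact: (integrable_fin_num mI i3).
have [/(_ intf0) fae _] := ae_eq_integral_abs mu mI mf.
apply: filterS fae => x fx Dx.
by apply/ge0_normc_Re; have [/eqP] := fx Dx; rewrite subr_eq0 => /eqP.
Qed.

End L1_interval.

(** * Transport between intervals *)

Section L1_interval_operators.
Variable R : realType.
Local Notation mu := (@lebesgue_measure R).
Local Notation TR := (measurableTypeR R).
Local Notation I := (@I01 R).
Local Notation mI := (@measurable_I01 R).
Local Notation L := (L1_01 R).
Local Notation cint := (cintegrable mu I).
Local Notation Linf := (Linfty_fun mu I).

Lemma cint_dom (f : TR -> R[i]) (h : TR -> R) : cmeasurable_fun I f ->
  mu.-integrable I (EFin \o h) -> {ae mu, forall x, I x -> normc (f x) <= h x} ->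
  cint f.
Proof.
move=> [m1 m2] hi fh.
have key (g : TR -> R) : measurable_fun I g ->
    (forall x, `|g x| <= normc (f x)) -> mu.-integrable I (EFin \o g).
  move=> mg gf; apply/integrableP; split; first exact/measurable_EFinP.
  have /integrableP[_] := hi; apply: le_lt_trans.
  have /measurable_EFinP mh : measurable_fun I (EFin \o h) by case/integrableP: hi.
  apply: ae_ge0_le_integral => //=; first exact: mI.
  - by apply/measurable_EFinP; exact: measurableT_comp.
  - by apply/measurable_EFinP; exact: measurableT_comp.
  - apply: filterS fh => x fh Ix; rewrite lee_fin.
    by apply: (le_trans (gf x)); apply: (le_trans (fh Ix)); exact: ler_norm.
split; first by apply: key => // x; exact: Re_le_normc.
by apply: key => // x; exact: Im_le_normc.
Qed.

Lemma cmeasurableM (f g : TR -> R[i]) : cmeasurable_fun I f -> cmeasurable_fun I g ->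
  cmeasurable_fun I (fun x => f x * g x).
Proof.
move=> [f1 f2] [g1 g2]; split.
  under eq_fun do rewrite Defs.ReM.
  by apply: measurable_funB; exact: measurable_funM.
under eq_fun do rewrite Defs.ImM.
by apply: measurable_funD; exact: measurable_funM.
Qed.

Lemma cintM (g f : TR -> R[i]) : Linf g -> cint f -> cint (fun x => g x * f x).
Proof.
move=> [mg [B gB]] fi.
apply: (@cint_dom _ (fun x => B * normc (f x))).
- by apply: cmeasurableM => //; exact: cintegrable_measurable fi.
- by have := integrableZl mI B (cint_normc fi).
- by apply: filterS gB => x gB Ix; rewrite normcM ler_wpM2r ?normc_ge0//; exact: gB.
Qed.

Definition Mul (g : TR -> R[i]) (f : L) : L := toL1 (fun x => g x * repr f x).

Lemma Mul_toL1 (g f : TR -> R[i]) : Linf g -> cint f ->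
  Mul g (toL1 f) = toL1 (fun x => g x * f x).
Proof.
move=> gi fi; apply: eq_toL1; [|exact: cintM|].
  by apply: cintM => //; exact: cint_repr.
by apply: filterS (repr_toL1 fi) => x fx Ix; rewrite fx.
Qed.

Lemma MulD g f h : Linf g -> Mul g (f + h) = Mul g f + Mul g h.
Proof.
move=> gi; rewrite -[f in LHS]toL1_repr -[h in LHS]toL1_repr -toL1D; [|exact: cint_repr..].
rewrite Mul_toL1//; last by apply: cintD; exact: cint_repr.
rewrite /Mul -toL1D; [|by apply: cintM => //; exact: cint_repr..].
by congr toL1; apply/funext => x; rewrite mulrDr.
Qed.

Lemma MulZ g a f : Linf g -> Mul g (a *: f) = a *: Mul g f.
Proof.
move=> gi; rewrite -[f in LHS]toL1_repr -toL1Z; last exact: cint_repr.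
rewrite Mul_toL1//; last by apply: cintZ; exact: cint_repr.
rewrite /Mul -toL1Z; last by apply: cintM => //; exact: cint_repr.
by congr toL1; apply/funext => x; rewrite mulrCA.
Qed.

Lemma nrm_Mul g : Linf g -> exists2 B, 0 <= B & forall f, nrm (Mul g f) <= B * nrm f.
Proof.
move=> gi; have [_ [B gB]] := gi; exists (Num.max 0 B); first by rewrite le_max lexx.
move=> f; rewrite nrm_toL1; last by apply: cintM => //; exact: cint_repr.
have fi := cint_normc (cint_repr f).
rewrite /nrm -RintegralZl//; last exact: mI.
have i1 : mu.-integrable I (EFin \o (fun x => normc (g x * repr f x))).
  by apply: cint_normc; apply: cintM => //; exact: cint_repr.
have i2 : mu.-integrable I (EFin \o (fun x => Num.max 0 B * normc (repr f x))).
  by have := integrableZl mI (Num.max 0 B) fi.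
rewrite /Rintegral fine_le//; [exact: (integrable_fin_num mI i1)|
  exact: (integrable_fin_num mI i2)|].
apply: ae_ge0_le_integral; first exact: mI.
- by move=> x _; rewrite lee_fin normc_ge0.
- by case/integrableP: i1.
- by move=> x _; rewrite lee_fin mulr_ge0 ?normc_ge0// le_max lexx.
- by case/integrableP: i2.
- apply: filterS gB => x gB Ix; rewrite lee_fin normcM ler_wpM2r ?normc_ge0//.
  by rewrite le_max (gB Ix) orbT.
Qed.

Lemma pairingE f g : Linf g -> L1_pairing f g = Tot (Mul g f).
Proof.
move=> gi; rewrite /Mul Tot_toL1; last by apply: cintM => //; exact: cint_repr.
by rewrite /L1_pairing; congr cintegral; apply/funext => x; rewrite mulrC.
Qed.

(* The pair [(a, l)] stands for the interval [[a, a + l)]. *)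
Definition inI (p : R * R) (x : R) : bool := (p.1 <= x) && (x < p.1 + p.2).

Definition okI (p : R * R) : bool := [&& 0 <= p.1, 0 < p.2 & p.1 + p.2 <= 1].

Lemma inI_I p x : okI p -> inI p x -> I x.
Proof.
by move=> /and3P[h1 h2 h3] /andP[h4 h5]; rewrite /I01 /= in_itv /=; apply/andP; split; lra.
Qed.

(** The factor [p.2 / q.2] is the Jacobian of the affine map, so that integrals are preserved. *)
Definition transport_fun (p q : R * R) (f : TR -> R[i]) (x : TR) : R[i] :=
  if inI q x then (p.2 / q.2)%:C * f (p.1 + (x - q.1) * (p.2 / q.2)) else 0.

Definition transport_real (p q : R * R) (f : TR -> R) (x : TR) : R :=
  if inI q x then (p.2 / q.2) * f (p.1 + (x - q.1) * (p.2 / q.2)) else 0.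

Lemma inI_move p q x : okI p -> okI q ->
  inI p (p.1 + (x - q.1) * (p.2 / q.2)) = inI q x.
Proof.
move=> /and3P[h1 h2 h3] /and3P[k1 k2 k3].
have r0 : 0 < p.2 / q.2 by rewrite divr_gt0.
rewrite /inI lerDl ltrD2l pmulr_lge0// subr_ge0; congr andb.
rewrite mulrA ltr_pdivrMr// [p.2 * _]mulrC ltr_pM2r// ltrBlDl.
by rewrite addrC.
Qed.

(** By the affine change of variables, both integrals equal that of [f] cut off to [p] over the
    whole line. *)
Lemma transport_real_int p q f : okI p -> okI q -> mu.-integrable I (EFin \o f) ->
  mu.-integrable I (EFin \o transport_real p q f) /\
  \int[mu]_(x in I) transport_real p q f x = \int[mu]_(x in I) transport_real p p f x.
Proof.
move=> hp hq fi.
pose P : set TR := [set x | inI p x].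
have PE : P = `[p.1, p.1 + p.2[%classic by apply/seteqP; split => x /=; rewrite in_itv.
have mP : measurable P by rewrite PE; exact: measurable_itv.
have PI : P `<=` I by move=> x; exact: inI_I.
have gi : mu.-integrable setT (EFin \o (f \_ P)).
  rewrite -restrict_EFin; apply/(integrable_mkcond _ mP).
  exact: (@integrableS _ _ _ mu I P _ mI mP PI fi).
have main r : okI r -> mu.-integrable I (EFin \o transport_real p r f) /\
  \int[mu]_(x in I) transport_real p r f x = \int[mu]_x (f \_ P) x.
  move=> hr; have [p0 r0] : 0 < p.2 /\ 0 < r.2 by case/and3P: hp; case/and3P: hr.
  have c0 : 0 < p.2 / r.2 by rewrite divr_gt0.
  pose d := p.1 - r.1 * (p.2 / r.2).
  have E x : transport_real p r f x = p.2 / r.2 * (f \_ P) (p.2 / r.2 * x + d).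
    rewrite (_ : _ + d = p.1 + (x - r.1) * (p.2 / r.2)); last by rewrite /d; ring.
    rewrite /transport_real patchE; case: ifPn => [xr|].
      by rewrite ifT// inE /P /= inI_move.
    rewrite -(@inI_move p)// => /negbTE xr.
    by rewrite (_ : (_ \in P) = false) ?mulr0//; apply/negbTE; rewrite notin_setE /P /= xr.
  have ai := integrable_affine d c0 gi.
  have i1 : mu.-integrable setT (EFin \o transport_real p r f).
    have := integrableZl measurableT (p.2 / r.2) ai.
    by apply: eq_integrable => // x _; rewrite /= E.
  split; first by apply: integrableS i1 => //; exact: mI.
  rewrite (Rintegral_affine d c0 gi) -RintegralZl// Rintegral_mkcond.
  apply: eq_Rintegral => x _; rewrite patchE; case: ifPn => [_|]; first by rewrite E.
  rewrite notin_setE => nI; rewrite -E /transport_real ifF//; apply/negbTE/negP => xr.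
  exact/nI/(inI_I hr xr).
by have [? ->] := main q hq; have [_ ->] := main p hp.
Qed.

Lemma Re_transport_fun p q f x : Re (transport_fun p q f x) = transport_real p q (fun y => Re (f y)) x.
Proof. by rewrite /transport_fun /transport_real; case: ifP => // _; rewrite Defs.ReM /= mul0r subr0. Qed.

Lemma Im_transport_fun p q f x : Im (transport_fun p q f x) = transport_real p q (fun y => Im (f y)) x.
Proof. by rewrite /transport_fun /transport_real; case: ifP => // _; rewrite Defs.ImM /= mul0r addr0. Qed.

Lemma normc_transport_fun p q f x : okI p -> okI q ->
  normc (transport_fun p q f x) = transport_real p q (fun x => normc (f x)) x.
Proof.
move=> /and3P[_ p0 _] /and3P[_ q0 _].
rewrite /transport_fun /transport_real; case: ifP => _; last by rewrite normc0.
by rewrite normcM normc_real gtr0_norm// divr_gt0.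
Qed.

Lemma cint_transport_fun p q f : okI p -> okI q -> cint f -> cint (transport_fun p q f).
Proof.
move=> hp hq [f1 f2]; split.
  have [h _] := transport_real_int hp hq f1.
  by rewrite [X in _.-integrable _ X](_ : _ = EFin \o transport_real p q (fun y => Re (f y)))//;
    apply/funext => x; rewrite Re_transport_fun.
have [h _] := transport_real_int hp hq f2.
by rewrite [X in _.-integrable _ X](_ : _ = EFin \o transport_real p q (fun y => Im (f y)))//;
  apply/funext => x; rewrite Im_transport_fun.
Qed.

(* The part of [f] living on [p], carried to [q] by the increasing affine
   bijection. *)
Definition transport (p q : R * R) (f : L) : L := toL1 (transport_fun p q (repr f)).

(** Representatives agree only almost everywhere, and the affine map pulls the exceptional set back
    to a null set. *)
Lemma transport_toL1 p q f : okI p -> okI q -> cint f -> transport p q (toL1 f) = toL1 (transport_fun p q f).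
Proof.
move=> hp hq fi; apply: eq_toL1; [|exact: cint_transport_fun|].
  by apply: cint_transport_fun => //; exact: cint_repr.
have c0 : 0 < p.2 / q.2 by case/and3P: hp => _ ? _; case/and3P: hq => _ ? _; rewrite divr_gt0.
have := negligible_affine (p.1 - q.1 * (p.2 / q.2)) c0 (repr_toL1 fi).
apply: negligibleS => x /= /not_implyP[Ix].
rewrite /transport_fun; case: ifP => // xq h1 h2; apply: h1; congr (_ * _).
move: h2; rewrite (_ : p.2 / q.2 * x + (p.1 - q.1 * (p.2 / q.2)) = p.1 + (x - q.1) * (p.2 / q.2)); last by ring.
by apply; apply: (@inI_I p); rewrite ?inI_move.
Qed.

Lemma transport_D p q f g : okI p -> okI q -> transport p q (f + g) = transport p q f + transport p q g.
Proof.
move=> hp hq; rewrite -[f in LHS]toL1_repr -[g in LHS]toL1_repr -toL1D; [|exact: cint_repr..].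
rewrite transport_toL1//; last by apply: cintD; exact: cint_repr.
rewrite /transport -toL1D; [|by apply: cint_transport_fun => //; exact: cint_repr..].
by congr toL1; apply/funext => x; rewrite /transport_fun; case: ifP; rewrite ?addr0// mulrDr.
Qed.

Lemma transport_Z p q a f : okI p -> okI q -> transport p q (a *: f) = a *: transport p q f.
Proof.
move=> hp hq; rewrite -[f in LHS]toL1_repr -toL1Z; last exact: cint_repr.
rewrite transport_toL1//; last by apply: cintZ; exact: cint_repr.
rewrite /transport -toL1Z; last by apply: cint_transport_fun => //; exact: cint_repr.
by congr toL1; apply/funext => x; rewrite /transport_fun; case: ifP; rewrite ?mulr0// mulrCA.
Qed.

Lemma transport_comp p q r f : okI p -> okI q -> okI r -> transport q r (transport p q f) = transport p r f.
Proof.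
move=> hp hq hr; rewrite /transport -/(transport q r _) transport_toL1//; last by apply: cint_transport_fun => //; exact: cint_repr.
congr toL1; apply/funext => x; rewrite /transport_fun inI_move//; case: ifP => // xr; rewrite ?xr.
move: hq hr => /and3P[_ q0 _] /and3P[_ r0 _].
have /andP[q1 r1] : (q.2 != 0) && (r.2 != 0) by rewrite !gt_eqF.
rewrite [LHS]mulrA -rmorphM; congr (_%:C * repr f _); first by field; rewrite q1 r1.
by field; rewrite q1 r1.
Qed.

Definition disjI (p q : R * R) : Prop := forall x, inI p x -> inI q x -> False.

Lemma toL1_0 : toL1 (fun=> 0) = 0 :> L.
Proof.
have h : cint (fun=> 0) by split; exact: integrable0.
have := toL1Z 0 h; rewrite scale0r => <-.
by congr toL1; apply/funext => x; rewrite mulr0.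
Qed.

Lemma transport_disj p q q' r f : okI p -> okI q -> okI q' -> okI r -> disjI q q' ->
  transport q' r (transport p q f) = 0.
Proof.
move=> hp hq hq' hr qq; rewrite /transport -/(transport q' r _) transport_toL1//; last first.
  by apply: cint_transport_fun => //; exact: cint_repr.
rewrite -toL1_0; congr toL1; apply/funext => x; rewrite /transport_fun; case: ifP => // xr.
case: ifP => [h|_]; last by rewrite mulr0.
by case: (qq _ h); rewrite inI_move.
Qed.

Lemma nrm_transport p q f : okI p -> okI q -> nrm (transport p q f) = nrm (transport p p f).
Proof.
move=> hp hq.
rewrite /transport !nrm_toL1; [|by apply: cint_transport_fun => //; exact: cint_repr..].
have [_ h] := transport_real_int hp hq (cint_normc (cint_repr f)).
under eq_Rintegral do rewrite normc_transport_fun//.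
under [RHS]eq_Rintegral do rewrite normc_transport_fun//.
exact: h.
Qed.

Lemma Tot_transport p q f : okI p -> okI q -> Tot (transport p q f) = Tot (transport p p f).
Proof.
move=> hp hq.
rewrite /transport !Tot_toL1; [|by apply: cint_transport_fun => //; exact: cint_repr..].
have [i1 i2] := cint_repr f.
have [_ h1] := transport_real_int hp hq i1; have [_ h2] := transport_real_int hp hq i2.
rewrite /cintegral; congr (_ +i* _).
  under eq_Rintegral do rewrite Re_transport_fun.
  by under [RHS]eq_Rintegral do rewrite Re_transport_fun.
under eq_Rintegral do rewrite Im_transport_fun.
by under [RHS]eq_Rintegral do rewrite Im_transport_fun.
Qed.

Lemma transport_fun_id p f x : okI p -> transport_fun p p f x = if inI p x then f x else 0.
Proof.
move=> /and3P[_ p0 _]; rewrite /transport_fun divff ?gt_eqF// !mul1r mulr1; case: ifP => // _.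
by rewrite addrC subrK.
Qed.

Lemma Mul_transport p g f : okI p -> Linf g -> Mul g (transport p p f) = transport p p (Mul g f).
Proof.
move=> hp gi; rewrite /transport Mul_toL1//; last by apply: cint_transport_fun => //; exact: cint_repr.
rewrite -/(transport p p (Mul g f)) /Mul transport_toL1//; last by apply: cintM => //; exact: cint_repr.
congr toL1; apply/funext => x; rewrite !transport_fun_id//.
by case: ifP; rewrite ?mulr0.
Qed.

Lemma toL1_sum (S : Type) (s : seq S) (f : S -> TR -> R[i]) :
  (forall i, cint (f i)) ->
  cint (fun x => \sum_(i <- s) f i x) /\
  toL1 (fun x => \sum_(i <- s) f i x) = \sum_(i <- s) toL1 (f i).
Proof.
move=> fi; elim: s => [|i s [h1 h2]].
  rewrite big_nil -toL1_0 (_ : (fun=> _) = fun=> 0); last by apply/funext => x; rewrite big_nil.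
  by split => //; split; exact: integrable0.
rewrite (_ : (fun=> _) = fun x => f i x + \sum_(i <- s) f i x); last first.
  by apply/funext => x; rewrite big_cons.
by split; [exact: cintD|rewrite toL1D// h2 big_cons].
Qed.

Definition disjf (S : finType) (p : S -> R * R) :=
  forall s t, s != t -> disjI (p s) (p t).

Definition coverf (S : finType) (p : S -> R * R) :=
  forall x, 0 <= x < 1 -> exists s, inI (p s) x.

Lemma sum_disjf (V : zmodType) (S : finType) (p : S -> R * R) s x (v : S -> V) :
  disjf p -> inI (p s) x -> \sum_t (if inI (p t) x then v t else 0) = v s.
Proof.
move=> hp hs; rewrite (bigD1 s)//= hs big1 ?addr0// => t ts.
by case: ifP => // ht; case: (hp _ _ ts x ht hs).
Qed.

Lemma transport_cover (S : finType) (p : S -> R * R) f : (forall s, okI (p s)) -> disjf p -> coverf p ->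
  \sum_s transport (p s) (p s) f = f.
Proof.
move=> hp dp cp; rewrite -[RHS]toL1_repr /transport.
have [h1 <-] := toL1_sum (index_enum S) (fun s => cint_transport_fun (hp s) (hp s) (cint_repr f)).
apply: eq_toL1 => //; first exact: cint_repr.
(* The half-open intervals are only known to cover [0, 1); the remaining point 1 is a null set. *)
have : mu.-negligible [set (1 : TR)].
  by apply/negligibleP => //; exact: lebesgue_measure_set1.
apply: negligibleS => x /= /not_implyP[]; rewrite /I01 /= in_itv /= => /andP[x0 x1] h.
apply/eqP; rewrite eq_le x1 leNgt; apply/negP => x1'; apply: h.
have [s sx] : exists s, inI (p s) x by apply: cp; rewrite x0.
under eq_bigr do rewrite transport_fun_id//.
by rewrite (sum_disjf (fun=> repr f x) dp sx).
Qed.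

(** At each point at most one summand is nonzero. Only an inequality, since the intervals may leave
    part of [0, 1] uncovered. *)
Lemma nrm_disjf (S : finType) (p : S -> R * R) f : (forall s, okI (p s)) -> disjf p ->
  \sum_s nrm (transport (p s) (p s) f) <= nrm f.
Proof.
move=> hp dp.
have E s : nrm (transport (p s) (p s) f) = \int[mu]_(x in I) transport_real (p s) (p s) (fun x => normc (repr f x)) x.
  rewrite /transport nrm_toL1; last by apply: cint_transport_fun => //; exact: cint_repr.
  by under eq_Rintegral do rewrite normc_transport_fun//.
under eq_bigr do rewrite E.
have ni := cint_normc (cint_repr f).
have mi s := (transport_real_int (hp s) (hp s) ni).1.
pose F x := \sum_s transport_real (p s) (p s) (fun x => normc (repr f x)) x.
have key (s : seq S) : mu.-integrable I (EFin \o (fun x => \sum_(i <- s) transport_real (p i) (p i) (fun x => normc (repr f x)) x)) /\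
  \sum_(i <- s) \int[mu]_(x in I) transport_real (p i) (p i) (fun x => normc (repr f x)) x =
  \int[mu]_(x in I) \sum_(i <- s) transport_real (p i) (p i) (fun x => normc (repr f x)) x.
  elim: s => [|i s [h1 h2]].
    rewrite big_nil (_ : (fun=> _) = fun=> 0); last by apply/funext => x; rewrite big_nil.
    split; first exact: integrable0.
    by rewrite Rintegral_cst ?mul0r//; exact: mI.
  rewrite (_ : (fun=> _) = fun x => transport_real (p i) (p i) (fun x => normc (repr f x)) x + \sum_(i <- s) transport_real (p i) (p i) (fun x => normc (repr f x)) x); last first.
    by apply/funext => x; rewrite big_cons.
  rewrite big_cons h2 RintegralD//; last exact: mI.
  by split => //; have := integrableD mI (mi i) h1.
have [h1 ->] := key (index_enum S).
apply: le_Rintegral => //; first exact: mI.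
move=> x _.
have [[s sx]|nx] := pselect (exists s, inI (p s) x).
  rewrite (eq_bigr (fun s => if inI (p s) x then normc (repr f x) else 0)); last first.
    move=> t _; rewrite /transport_real; have /and3P[_ t0 _] := hp t.
    by rewrite divff ?gt_eqF// mul1r mulr1 addrC subrK.
  by rewrite (sum_disjf (fun=> normc (repr f x)) dp sx).
rewrite big1 ?normc_ge0// => s _; rewrite /transport_real; case: ifP => // h.
by case: nx; exists s.
Qed.

Definition itv_one (p : R * R) : L := toL1 (fun x => if inI p x then 1 else 0).

Lemma itv_one_int p : okI p -> mu.-integrable I (EFin \o (fun x : TR => if inI p x then 1%R else 0%R)) /\
  \int[mu]_(x in I) (if inI p x then 1%R else 0%R) = p.2.
Proof.
move=> hp; have /and3P[h1 h2 h3] := hp.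
pose P : set TR := [set x | inI p x].
have PE : P = `[p.1, p.1 + p.2[%classic by apply/seteqP; split => x /=; rewrite in_itv.
have mP : measurable P by rewrite PE; exact: measurable_itv.
have PI : P `<=` I by move=> x; exact: inI_I.
have FE : (fun x : TR => if inI p x then 1 else 0) = \1_P :> (TR -> R).
  apply/funext => x; rewrite indicE; case: ifPn => [h|/negP h]; [rewrite mem_set//|rewrite memNset//].
have muP : mu P = p.2%:E.
  rewrite PE lebesgue_measure_itv/= lte_fin ltrDl h2 -EFinB.
  by congr EFin; ring.
rewrite FE; split.
  apply/integrableP; split; first exact/measurable_EFinP/measurable_funTS/measurable_indic.
  rewrite (eq_integral (fun x => (\1_P x)%:E)); last first.
    by move=> x _; rewrite gee0_abs// lee_fin.
  by rewrite integral_indic//; [rewrite setIidl//; apply: (le_lt_trans (y := p.2%:E)); rewrite ?ltry// -muP|exact: mI].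
rewrite /Rintegral integral_indic//; last exact: mI.
by rewrite setIidl//; exact: (congr1 fine muP).
Qed.

Lemma cint_itv_one p : okI p -> cint (fun x => if inI p x then 1 else 0).
Proof.
move=> hp; have [h _] := itv_one_int hp; split.
  by apply: (@eq_integrable _ _ _ mu I mI _ _ _ h) => x _ /=; case: ifP.
have i0 : mu.-integrable I (fun=> 0%E) by exact: integrable0.
by apply: (@eq_integrable _ _ _ mu I mI _ _ _ i0) => x _ /=; case: ifP.
Qed.

Lemma nrm_itv_one p : okI p -> nrm (itv_one p) = p.2.
Proof.
move=> hp; rewrite /itv_one nrm_toL1; last exact: cint_itv_one.
have [_ <-] := itv_one_int hp; apply: eq_Rintegral => x _.
by case: ifP; rewrite ?normc0 ?normc1.
Qed.

Lemma Tot_itv_one p : okI p -> Tot (itv_one p) = p.2%:C.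
Proof.
move=> hp; rewrite /itv_one Tot_toL1; last exact: cint_itv_one.
have [_ h] := itv_one_int hp; rewrite /cintegral; congr (_ +i* _).
  by rewrite -h; apply: eq_Rintegral => x _; case: ifP.
rewrite (@eq_Rintegral _ _ _ _ _ (cst 0)); last by move=> x _; case: ifP.
by rewrite Rintegral_cst ?mul0r//; exact: mI.
Qed.

Lemma transport_itv_one p q r : okI p -> okI q -> okI r -> (forall x, inI p x -> inI r x) ->
  transport p q (itv_one r) = (p.2 / q.2)%:C *: itv_one q.
Proof.
move=> hp hq hr pr; rewrite /itv_one transport_toL1//; last exact: cint_itv_one.
rewrite -toL1Z; last exact: cint_itv_one.
congr toL1; apply/funext => x; rewrite /transport_fun; case: ifPn => [xq|_]; last by rewrite mulr0.
by rewrite pr// inI_move.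
Qed.

Lemma transport_itv_one0 p q r : okI p -> okI q -> okI r -> disjI p r -> transport p q (itv_one r) = 0.
Proof.
move=> hp hq hr pr; rewrite /itv_one transport_toL1//; last exact: cint_itv_one.
rewrite -toL1_0; congr toL1; apply/funext => x; rewrite /transport_fun; case: ifPn => [xq|_//].
case: ifP => h; last by rewrite mulr0.
by case: (pr _ _ h); rewrite inI_move.
Qed.

Lemma itv_one_split (S : finType) (P : pred S) (p : S -> R * R) q : okI q -> (forall s, okI (p s)) -> disjf p ->
  (forall s x, P s -> inI (p s) x -> inI q x) ->
  (forall x, inI q x -> exists2 s, P s & inI (p s) x) ->
  itv_one q = \sum_(s | P s) itv_one (p s).
Proof.
move=> hq hp dp pq qp; rewrite /itv_one.
have [h1 h2] := toL1_sum [seq s <- index_enum S | P s] (fun s => cint_itv_one (hp s)).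
rewrite -big_filter -h2; congr toL1; apply/funext => x; rewrite big_filter.
case: ifPn => [xq|xq].
  have [s Ps sx] := qp x xq.
  by rewrite big_mkcond (eq_bigr (fun s => if inI (p s) x then (if P s then 1 else 0) else 0));
    [rewrite (sum_disjf (fun s => if P s then 1 else 0) dp sx) Ps | move=> t _; case: ifP; case: ifP].
rewrite big1// => s Ps; case: ifP => // sx.
by rewrite (pq _ _ Ps sx) in xq.
Qed.

End L1_interval_operators.

(** * Completeness and density of dyadic step functions *)

Section fast_cauchy.
Context d (T : measurableType d) (R : realType).
Variables (mu : {measure set T -> \bar R}) (D : set T) (mD : measurable D).
Local Open Scope ereal_scope.

(** Riesz-Fischer: the sum [G] of the absolute increments has a finite integral, so the series of
    increments converges absolutely almost everywhere, and [|r 0| + G] dominates the sequence. *)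
Lemma fast_L1_cvg (r : nat -> T -> R) :
  (forall n, mu.-integrable D (EFin \o r n)) ->
  (forall n, \int[mu]_(x in D) `|(r n.+1 x - r n x)%:E| <= (1 / (2 ^ n.+1)%:R)%:E) ->
  exists2 f : T -> R, mu.-integrable D (EFin \o f) &
    \int[mu]_(x in D) `|(r n x - f x)%:E| @[n --> \oo] --> 0.
Proof.
move=> ri rd.
have mr n : measurable_fun D (r n) by have /integrableP[/measurable_EFinP] := ri n.
pose G x := \sum_(k <oo) `|(r k.+1 x - r k x)%:E|.
have mdk k : measurable_fun D (fun x => `|(r k.+1 x - r k x)%:E|).
  by apply: measurableT_comp => //; apply/measurable_EFinP; exact: measurable_funB.
have G0 x : 0 <= G x by apply: nneseries_ge0 => *; exact: abse_ge0.
have mG : measurable_fun D G.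
  by have := @ge0_emeasurable_sum _ _ _ D (fun k x => `|(r k.+1 x - r k x)%:E|) xpredT
    (fun _ _ _ _ => abse_ge0 _) (fun k _ => mdk k).
have iG : mu.-integrable D G.
  apply/integrableP; split => //.
  under eq_integral do rewrite gee0_abs//.
  rewrite integral_nneseries//.
  apply: (@le_lt_trans _ _ 1); last by rewrite ltry.
  apply: le_trans (@epsilon_trick0 R 1 xpredT ler01).
  by apply: lee_nneseries => // *; exact: integral_ge0.
have Gfin := integrable_ae mD iG.
have part x n : (\sum_(0 <= k < n) `|r k.+1 x - r k x|)%R%:E <= G x.
  by rewrite -sumEFin; apply: (nneseries_lim_ge (u_ := fun k => `|(r k.+1 x - r k x)%:E|)).
have rcv : {ae mu, forall x, D x -> cvgn (r ^~ x)}.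
  apply: filterS Gfin => x Gx Dx.
  have c1 : cvgn (series (fun k => `|r k.+1 x - r k x|%R)).
    apply: nondecreasing_is_cvgn.
      by apply: nondecreasing_series => *; exact: normr_ge0.
    exists (fine (G x)) => _ [n _ <-]; rewrite seriesEnat /=.
    by rewrite -lee_fin fineK ?part//; exact: Gx.
  have c2 := normed_cvg c1.
  rewrite (_ : r ^~ x = fun n => (r 0%N x + series (telescope (r ^~ x)) n)%R); last first.
    by apply/funext => n; exact: (eq_sum_telescope (r ^~ x)).
  by apply: is_cvgD => //; exact: is_cvg_cst.
(* The upper limit is measurable regardless of where the sequence converges. *)
pose fe x := limn_esup (fun n => (r n x)%:E).
have mfe : measurable_fun D fe.
  by apply: measurable_fun_limn_esup => n; exact/measurable_EFinP.
have fecv : {ae mu, forall x, D x -> (fun n => (r n x)%:E) @ \oo --> fe x}.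
  apply: filterS rcv => x rx Dx.
  have c : (fun n => (r n x)%:E) @ \oo --> (limn (r ^~ x))%:E.
    by apply: cvg_EFin; [exact: nearW|exact: rx].
  by rewrite /fe (cvg_limn_einf_sup c).2.
have ig : mu.-integrable D (fun x => `|(r 0%N x)%:E| + G x).
  by apply: integrableD => //; exact: integrable_abse (ri 0%N).
have fg : {ae mu, forall x n, D x -> `|(r n x)%:E| <= `|(r 0%N x)%:E| + G x}.
  apply: filterS Gfin => x Gx n Dx.
  have /= -> := eq_sum_telescope (r ^~ x) n.
  apply: (le_trans (y := (`|r 0%N x| + \sum_(0 <= k < n) `|r k.+1 x - r k x|)%R%:E)).
    rewrite lee_fin (le_trans (ler_normD _ _))// lerD2l.
    by rewrite seriesEnat /=; exact: ler_norm_sum.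
  by rewrite EFinD; apply: leeD.
have mre n : measurable_fun D (fun x => (r n x)%:E) by exact/measurable_EFinP.
have [ife cv0 _] := @dominated_convergence _ _ _ mu D mD (fun n x => (r n x)%:E)
  fe _ mre mfe fecv ig fg.
have fefin := integrable_ae mD ife.
have mf : measurable_fun D (EFin \o (fine \o fe)).
  by apply/measurable_EFinP; exact: measurableT_comp.
exists (fine \o fe).
  apply/integrableP; split => //.
  have /integrableP[_] := ife; apply: le_lt_trans.
  apply: ae_ge0_le_integral => //; [exact: measurableT_comp|exact: measurableT_comp|].
  by apply: filterS fefin => x h Dx; have /fineK <- := h Dx.
apply: cvg_trans cv0; apply: near_eq_cvg; apply: nearW => n /=.
apply: ae_eq_integral => //.
- apply: measurableT_comp => //; apply: emeasurable_funB => //.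
- apply/measurable_EFinP; apply: measurableT_comp => //; apply: measurable_funB => //; exact/measurable_EFinP.
- by apply: filterS fefin => x h Dx; have /fineK <- := h Dx.
Qed.

End fast_cauchy.

(** Heine's theorem through the covering form of compactness, the dyadic scale [k] being the
    parameter that runs along the filter. *)
Lemma dyadic_unif_continuous (R : realType) (f : R -> R) (e : R) : continuous f -> 0 < e ->
  \forall k \near \oo, forall x, 0 <= x <= 1 -> forall z, `|z - x| <= (2 ^+ k)^-1 -> `|f z - f x| < e.
Proof.
move=> cf e0.
have cpt := @segment_compact R 0 1.
move/compact_near_coveringP : cpt => /(_ nat \oo
  (fun k x => forall z, `|z - x| <= (2 ^+ k)^-1 -> `|f z - f x| < e)).
move=> h; have {h} : \forall k \near \oo, `[0, 1]%classic `<=`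
    (fun x : R => forall z, `|z - x| <= (2 ^+ k)^-1 -> `|f z - f x| < e).
  apply: h => x _.
  have /cvgrPdist_lt/(_ (e / 2)) := cf x.
  rewrite divr_gt0// => /(_ isT) /nbhs_ballP[del /= d0 hd].
  have k0 : \forall k \near \oo, (2 ^+ k)^-1 < del / 2.
    have h1 : `|2^-1 : R| < 1 by rewrite ger0_norm; lra.
    have := cvg_expr h1 => /cvgrPdist_lt/(_ (del / 2)).
    rewrite divr_gt0// => /(_ isT); apply: filterS => k.
    by rewrite sub0r normrN ger0_norm ?exprn_ge0// exprVn.
  exists (ball x (del / 2), [set k | (2 ^+ k)^-1 < del / 2]) => /=.
    by split => //; exact: nbhsx_ballx (divr_gt0 d0 _).
  move=> [y k] /= [xy hk] z zy.
  rewrite /ball /= in xy.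
  have h1 : `|x - z| < del.
    have -> : x - z = (x - y) - (z - y) by ring.
    by rewrite (le_lt_trans (ler_normB _ _))//; lra.
  have h2 : `|x - y| < del by lra.
  have := hd _ h1; have := hd _ h2 => k1 k2.
  have -> : f z - f y = (f x - f y) - (f x - f z) by ring.
  by rewrite (le_lt_trans (ler_normB _ _))//; lra.
apply: filterS => k hk x x01; apply: hk => /=; rewrite in_itv /=; exact: x01.
Qed.

Section L1_interval_density.
Variable R : realType.
Local Notation mu := (@lebesgue_measure R).
Local Notation TR := (measurableTypeR R).
Local Notation I := (@I01 R).
Local Notation mI := (@measurable_I01 R).
Local Notation L := (L1_01 R).
Local Notation cint := (cintegrable mu I).

Lemma nrm_toL1_le (f : TR -> R[i]) (g : TR -> R) : cint f -> mu.-integrable I (EFin \o g) ->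
  (forall x, I x -> normc (f x) <= g x) -> nrm (toL1 f) <= \int[mu]_(x in I) g x.
Proof.
move=> fi gi fg; rewrite nrm_toL1//; apply: le_Rintegral => //; [exact: mI|exact: cint_normc].
Qed.

(** A subsequence with summable gaps converges in real and imaginary parts by [fast_L1_cvg]; the
    Cauchy property carries the whole sequence along. *)
Lemma L1_complete (u : nat -> L) :
  (forall e, 0 < e -> exists n0, forall m n, (n0 <= m)%N -> (n0 <= n)%N -> nrm (u m - u n) < e) ->
  exists v, forall e, 0 < e -> exists n0, forall n, (n0 <= n)%N -> nrm (u n - v) < e.
Proof.
move=> cu.
have /choice[k kP] : forall j, exists k, forall m n, (k <= m)%N -> (k <= n)%N ->
    nrm (u m - u n) < 1 / (2 ^ j.+1)%:R.
  by move=> j; apply: cu; rewrite divr_gt0// ltr0n expn_gt0.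
(* [K] is increasing with [j <= K j], so that late terms of the subsequence are late in the
   sequence. *)
pose K := fix K j := if j is j'.+1 then maxn (K j').+1 (k j'.+1) else k 0%N.
have Kk j : (k j <= K j)%N by case: j => //= j; exact: leq_maxr.
have KS j : (K j <= K j.+1)%N by rewrite /=; apply: (leq_trans (leqnSn _)); exact: leq_maxl.
have jK j : (j <= K j)%N.
  by elim: j => //= j ih; apply: (leq_trans (n := (K j).+1)) => //; exact: leq_maxl.
pose w j := u (K j).
have wd j : nrm (w j.+1 - w j) <= 1 / (2 ^ j.+1)%:R.
  by apply/ltW/kP; [apply: leq_trans (KS j)|]; exact: Kk.
have wi j := cint_repr (w j).
have dcint j : cint (fun x => repr (w j.+1) x - repr (w j) x).
  have := cintD (wi j.+1) (cintZ (-1) (wi j)); apply: cint_eq => x _.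
  by rewrite mulN1r.
have dE j : toL1 (fun x => repr (w j.+1) x - repr (w j) x) = w j.+1 - w j.
  rewrite -[X in _ = X - _]toL1_repr -[X in _ = _ - X]toL1_repr -scaleN1r -toL1Z//.
  rewrite -toL1D//; last exact: cintZ.
  by congr toL1; apply/funext => x; rewrite mulN1r.
have fast (g : R[i] -> R) (gB : forall x y, g (x - y) = g x - g y)
    (gn : forall z, `|g z| <= normc z)
    (gi : forall f, cint f -> mu.-integrable I (EFin \o (fun x => g (f x)))) :
    exists2 f : TR -> R, mu.-integrable I (EFin \o f) &
      (\int[mu]_(x in I) `|(g (repr (w n) x) - f x)%:E| @[n --> \oo] --> 0)%E.
  apply: (@fast_L1_cvg _ _ _ mu I mI (fun n x => g (repr (w n) x))).
    by move=> n; exact: gi.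
  move=> n; apply: (le_trans (y := (nrm (w n.+1 - w n))%:E)); last by rewrite lee_fin.
  have i1 := integrable_norm (gi _ (dcint n)).
  have i2 := cint_normc (dcint n).
  rewrite -dE nrm_toL1// /Rintegral fineK; last exact: (integrable_fin_num mI i2).
  apply: ge0_le_integral => //; first exact: mI.
  - have := i1 => /integrableP[+ _]; apply: eq_measurable_fun => x _.
    by rewrite /= gB.
  - by case/integrableP: i2.
  - by move=> x _; rewrite lee_fin -gB.
have ReB (x y : R[i]) : Re (x - y) = Re x - Re y by case: x; case: y.
have ImB (x y : R[i]) : Im (x - y) = Im x - Im y by case: x; case: y.
have [f1 if1 c1] := fast (fun z => Re z) ReB (@Re_le_normc R) (fun f fi => fi.1).
have [f2 if2 c2] := fast (fun z => Im z) ImB (@Im_le_normc R) (fun f fi => fi.2).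
pose f x := f1 x +i* f2 x.
have fi : cint f by split.
exists (toL1 f) => e e0.
have e40 : 0 < e / 4 by rewrite divr_gt0.
have key (g : R[i] -> R) h : (\int[mu]_(x in I) `|(g (repr (w n) x) - h x)%:E| @[n --> \oo] --> 0)%E ->
    exists n0, forall n, (n0 <= n)%N -> (\int[mu]_(x in I) `|(g (repr (w n) x) - h x)%:E| < (e / 4)%:E)%E.
  move=> c; have /c : nbhs 0%E [set y | (y < (e / 4)%:E)%E].
    by apply: open_nbhs_nbhs; split; [exact: open_ereal_lt_ereal|rewrite /= lte_fin].
  by move=> [n0 _ hn]; exists n0 => n /hn.
have [n1 h1] := key _ _ c1; have [n2 h2] := key _ _ c2.
have [n3 h3] := cu _ e40.
exists n3 => n nn3.
pose j := maxn (maxn n1 n2) n3.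
have j1 : (n1 <= j)%N by rewrite /j; lia.
have j2 : (n2 <= j)%N by rewrite /j; lia.
have j3 : (n3 <= K j)%N by apply: (leq_trans _ (jK j)); rewrite /j; lia.
apply: (le_lt_trans (nrm_tri (w j) _ _)).
have {nn3 j3} := h3 _ _ nn3 j3; rewrite -/(w j) => h3j.
suff : nrm (w j - toL1 f) <= e / 2 by lra.
have {h1 h2} := (h1 _ j1, h2 _ j2); move=> [h1 h2].
have ci : cint (fun x => repr (w j) x - f x).
  have := cintD (wi j) (cintZ (-1) fi); apply: cint_eq => x _.
  by rewrite mulN1r.
have -> : w j - toL1 f = toL1 (fun x => repr (w j) x - f x).
  rewrite -[X in X - _ = _]toL1_repr -scaleN1r -toL1Z// -toL1D//; last exact: cintZ.
  by congr toL1; apply/funext => x; rewrite mulN1r.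
have [ci1 ci2] := ci.
have i1 := integrable_abse ci1; have i2 := integrable_abse ci2.
have i12 := integrableD mI i1 i2.
rewrite -lee_fin nrm_toL1// /Rintegral fineK; last first.
  exact: (integrable_fin_num mI (cint_normc ci)).
apply: (@le_trans _ _ (\int[mu]_(x in I) (`|(Re (repr (w j) x - f x))%:E| + `|(Im (repr (w j) x - f x))%:E|))%E).
  apply: ge0_le_integral => //; first exact: mI.
  - by move=> x _; rewrite lee_fin normc_ge0.
  - by have /integrableP[] := cint_normc ci.
  - by case/integrableP: i12.
  - by move=> x _; rewrite lee_fin normc_leRI.
rewrite integralD//; last exact: mI.
have -> : e / 2 = e / 4 + e / 4 by field.
rewrite EFinD leeD//.
  by rewrite (le_trans _ (ltW h1))//; under eq_integral do rewrite ReB.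
by rewrite (le_trans _ (ltW h2))//; under eq_integral do rewrite ImB.
Qed.

End L1_interval_density.

(** * Dyadic intervals and step functions *)

Section dyadic.
Variable R : realType.
Local Notation mu := (@lebesgue_measure R).
Local Notation TR := (measurableTypeR R).
Local Notation I := (@I01 R).
Local Notation mI := (@measurable_I01 R).
Local Notation L := (L1_01 R).
Local Notation cint := (cintegrable mu I).

Definition dyadic_itv (k i : nat) : R * R := (i%:R / 2 ^+ k, (2 ^+ k)^-1).

Lemma exp2_gt0 k : 0 < 2 ^+ k :> R.
Proof. by rewrite exprn_gt0. Qed.

Lemma inI_dyadic_itv k i (x : R) : inI (dyadic_itv k i) x = (i%:R <= 2 ^+ k * x < i.+1%:R).
Proof.
have k0 := exp2_gt0 k.
rewrite /inI /dyadic_itv /=.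
have -> : i%:R / 2 ^+ k + (2 ^+ k)^-1 = i.+1%:R / 2 ^+ k :> R.
  by rewrite -(natr1 i) mulrDl mul1r.
by rewrite ler_pdivrMr// ltr_pdivlMr// [x * _]mulrC.
Qed.

Lemma okI_dyadic_itv k i : (i < 2 ^ k)%N -> okI (dyadic_itv k i).
Proof.
move=> ik; have k0 := exp2_gt0 k; rewrite /okI /dyadic_itv /=; apply/and3P; split.
- by rewrite divr_ge0// ltW.
- by rewrite invr_gt0.
- rewrite -[X in _ / _ + X]mul1r -mulrDl ler_pdivrMr// mul1r natr1 -natrX ler_nat //.
Qed.

Lemma disjI_dyadic_itv k i j : i != j -> disjI (dyadic_itv k i) (dyadic_itv k j).
Proof.
move=> ij x; rewrite !inI_dyadic_itv => /andP[h1 h2] /andP[h3 h4].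
have := le_lt_trans h1 h4; have := le_lt_trans h3 h2; rewrite !ltr_nat !ltnS => h5 h6.
by move/eqP: ij; apply; apply/eqP; rewrite eqn_leq h5 h6.
Qed.

Lemma inI_dyadic_itv_ex k (x : R) : 0 <= x < 1 -> exists2 i, (i < 2 ^ k)%N & inI (dyadic_itv k i) x.
Proof.
move=> /andP[x0 x1]; have k0 := exp2_gt0 k.
have y0 : 0 <= 2 ^+ k * x by rewrite mulr_ge0// ltW.
exists (Num.truncn (2 ^+ k * x)); last by rewrite inI_dyadic_itv truncn_itv.
rewrite -(ltr_nat R); apply: (le_lt_trans (y := 2 ^+ k * x)).
  by have /andP[] := truncn_itv y0.
by rewrite natrX -[ltRHS]mulr1 ltr_pM2l.
Qed.

Definition dyadic k i : L := itv_one (dyadic_itv k i).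

Definition dyadic_itvs k (i : 'I_(2 ^ k)) := dyadic_itv k i.

Lemma okI_dyadic_itvs k i : okI (dyadic_itvs (k := k) i).
Proof. exact: okI_dyadic_itv. Qed.

Lemma disjf_dyadic_itvs k : disjf (dyadic_itvs (k := k)).
Proof. by move=> i j ij; apply: disjI_dyadic_itv. Qed.

Lemma coverf_dyadic_itvs k : coverf (dyadic_itvs (k := k)).
Proof. by move=> x x01; have [i ik xi] := inI_dyadic_itv_ex k x01; exists (Ordinal ik). Qed.

Lemma inI_dyadic_itv_refine k r i j (x : R) : (k <= r)%N -> inI (dyadic_itv r i) x ->
  inI (dyadic_itv k j) x = (i %/ 2 ^ (r - k) == j)%N.
Proof.
move=> kr; rewrite !inI_dyadic_itv => /andP[h1 h2].
have e0 : 0 < 2 ^+ (r - k) :> R by exact: exp2_gt0.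
have E : 2 ^+ r = 2 ^+ k * 2 ^+ (r - k) :> R by rewrite -exprD subnKC.
have d0 : (0 < 2 ^ (r - k))%N by rewrite expn_gt0.
rewrite -(ler_pM2r e0) -[X in _ && X](ltr_pM2r e0).
have -> : 2 ^+ k * x * 2 ^+ (r - k) = 2 ^+ r * x by rewrite E; ring.
move: h1 h2; set y := 2 ^+ r * x => h1 h2; rewrite -!natrX -!natrM.
apply/andP/eqP => [[h3 h4]|<-].
  have h5 := le_lt_trans h3 h2; have h6 := le_lt_trans h1 h4.
  move: h5 h6; rewrite !ltr_nat ltnS => h5 h6.
  by apply/eqP; rewrite eqn_leq -ltnS ltn_divLR// h6 leq_divRL//.
split.
  by apply: le_trans h1; rewrite ler_nat leq_trunc_div.
apply: (lt_le_trans h2); rewrite ler_nat; have := ltn_ceil i d0; lia.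
Qed.

Lemma dyadic_refine k r j : (k <= r)%N -> (j < 2 ^ k)%N ->
  dyadic k j = \sum_(i < 2 ^ r | (i %/ 2 ^ (r - k) == j)%N) dyadic r i.
Proof.
move=> kr jk; apply: (itv_one_split (p := dyadic_itvs (k := r))).
- exact: okI_dyadic_itv.
- exact: okI_dyadic_itvs.
- exact: disjf_dyadic_itvs.
- by move=> i x ij xi; rewrite (inI_dyadic_itv_refine _ kr xi).
- move=> x xj; have := inI_I (okI_dyadic_itv jk) xj; rewrite /I01 /= in_itv /= => /andP[x0 x1].
  have [|i xi] := @coverf_dyadic_itvs r x.
    rewrite x0 /=; case/and3P: (okI_dyadic_itv jk) => _ _; case/andP: xj => _; exact: lt_le_trans.
  by exists i => //; rewrite -(inI_dyadic_itv_refine j kr xi).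
Qed.

Lemma nrm_dyadic k i : (i < 2 ^ k)%N -> nrm (dyadic k i) = (2 ^+ k)^-1.
Proof. by move=> /okI_dyadic_itv/nrm_itv_one. Qed.

Lemma Tot_dyadic k i : (i < 2 ^ k)%N -> Tot (dyadic k i) = ((2 ^+ k)^-1)%:C.
Proof. by move=> /okI_dyadic_itv/Tot_itv_one. Qed.

(** Continuous functions are dense, and on [0, 1] they are uniformly close to their samples at left
    endpoints of dyadic cells. All large levels work, which lets several approximations share one
    level. *)
Lemma step_dense (f : L) (e : R) : 0 < e ->
  \forall k \near \oo, exists c : nat -> R[i], nrm (f - \sum_(i < 2 ^ k) c i *: dyadic k i) < e.
Proof.
have aux (x y z : R) : x < z / 6 -> y < z / 6 -> x + y < z / 3 by lra.
have aux2 (x y : R) : x < e / 3 -> y <= e / 3 -> 0 < e -> x + y < e by lra.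
(* Real and imaginary parts each get [e / 6], once for the continuous approximation and once for the
   sampling. *)
move=> e0; have e60 : 0 < e / 6 by rewrite divr_gt0.
have finI : (mu I < +oo)%E.
  by rewrite /I01 lebesgue_measure_itv /=; case: ifPn => // _; rewrite -EFinB ltry.
have [f1 f2] := cint_repr f.
have key (g : TR -> R) : mu.-integrable I (EFin \o g) -> exists phi : R -> R,
   [/\ continuous phi, mu.-integrable I (EFin \o phi) & \int[mu]_(x in I) `|g x - phi x| < e / 6].
  move=> gi; have [ph [h1 h2 h3]] := approximation_continuous_integrable mI finI gi.
  have /h3 : nbhs 0%E [set y | (y < (e / 6)%:E)%E].
    by apply: open_nbhs_nbhs; split; [exact: open_ereal_lt_ereal|rewrite /= lte_fin].
  move=> [n _ hn]; exists (ph n); split => //.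
  have := hn n (leqnn n) => /= h.
  rewrite -lte_fin /Rintegral fineK; first exact: h.
  have i1 := integrable_norm (integrableB mI gi (h2 n)).
  exact: (integrable_fin_num mI i1).
have [p1 [c1 i1 n1]] := key _ f1; have [p2 [c2 i2 n2]] := key _ f2.
have phi_int : cint (fun x => p1 x +i* p2 x) by split.
have fphi : nrm (f - toL1 (fun x => p1 x +i* p2 x)) < e / 3.
  have -> : f - toL1 (fun x => p1 x +i* p2 x) = toL1 (fun x => repr f x - (p1 x +i* p2 x)).
    rewrite -[X in X - _ = _]toL1_repr -scaleN1r -toL1Z// -toL1D//; last exact: cintZ.
    by congr toL1; apply/funext => x; rewrite mulN1r.
  have a1 := integrable_norm (integrableB mI f1 i1).
  have a2 := integrable_norm (integrableB mI f2 i2).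
  have a12 := integrableD mI a1 a2.
  apply: (@le_lt_trans _ _ (\int[mu]_(x in I) (`|Re (repr f x) - p1 x| + `|Im (repr f x) - p2 x|))).
    apply: nrm_toL1_le => //.
      have := cintD (cint_repr f) (cintZ (-1) phi_int); apply: cint_eq => x _.
      by rewrite mulN1r.
    by move=> x _; apply: (le_trans (normc_leRI _)); case: (repr f x).
  rewrite RintegralD//; last exact: mI.
  exact: aux.
have : \forall k \near \oo, (forall x, 0 <= x <= 1 -> forall z, `|z - x| <= (2 ^+ k)^-1 -> `|p1 z - p1 x| < e / 6) /\
   (forall x, 0 <= x <= 1 -> forall z, `|z - x| <= (2 ^+ k)^-1 -> `|p2 z - p2 x| < e / 6).
  have := dyadic_unif_continuous c1 e60; have := dyadic_unif_continuous c2 e60.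
  by apply: filterS2.
apply: filterS => k [u1 u2].
pose phi x := p1 x +i* p2 x.
pose c i := phi (dyadic_itv k i).1; exists c.
apply: (le_lt_trans (nrm_tri (toL1 phi) _ _)).
suff : nrm (toL1 phi - \sum_(i < 2 ^ k) c i *: dyadic k i) <= e / 3 by move=> h; exact: aux2.
rewrite -{1}(transport_cover (toL1 phi) (@okI_dyadic_itvs k) (@disjf_dyadic_itvs k) (@coverf_dyadic_itvs k)) -sumrB.
apply: (le_trans (nrm_sum _ _ _)).
have -> : e / 3 = \sum_(i < 2 ^ k) (e / 3 * (2 ^+ k)^-1).
  rewrite sumr_const card_ord -[RHS]mulr_natr natrX; have := exp2_gt0 k => k0.
  by field; rewrite gt_eqF.
apply: ler_sum => i _; have oki := okI_dyadic_itvs i.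
rewrite transport_toL1//.
have ci := cint_itv_one oki.
rewrite /dyadic /itv_one -toL1Z// -scaleN1r -toL1Z; last exact: cintZ.
rewrite -toL1D; [|exact: cint_transport_fun|by do 2 apply: cintZ].
have [ii ie] := itv_one_int oki.
rewrite -[(2 ^+ k)^-1]/((dyadic_itvs i).2) -ie.
rewrite -RintegralZl//; last exact: mI.
apply: nrm_toL1_le.
- by apply: cintD; [exact: cint_transport_fun|do 2 apply: cintZ].
- by have := integrableZl mI (e / 3) ii.
move=> x Ix; rewrite transport_fun_id//; case: ifPn => xi; last by rewrite !mulr0 addr0 normc0.
rewrite !mulr1 mulN1r /c /phi.
apply: (le_trans (normc_leRI _)) => /=.
have d : `|(dyadic_itv k i).1 - x| <= (2 ^+ k)^-1.
  move: xi; rewrite /dyadic_itvs /inI /dyadic_itv /= => /andP[h3 h4].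
  by rewrite distrC ger0_norm; lra.
have x01 : 0 <= x <= 1 by move: Ix; rewrite /I01 /= in_itv.
have := u1 _ x01 _ d; rewrite distrC => h1.
have := u2 _ x01 _ d; rewrite distrC => h2.
exact/ltW/aux.
Qed.

End dyadic.

(** * Strong limits of positive isometries *)

Section operator_limits.
Variable R : realType.
Local Notation L := (L1_01 R).

Lemma nrm_le0 (f : L) : (forall e, 0 < e -> nrm f <= e) -> f = 0.
Proof.
move=> h; apply: nrm_eq0; apply/eqP; rewrite eq_le nrm_ge0 andbT.
by apply/ler_addgt0Pr => e /h; rewrite add0r.
Qed.

(** Step functions being dense, the uniform bound by [B] transfers smallness from dyadic vectors to
    all of L^1. The filter is arbitrary because it runs over pairs of indices in the Baire argument
    and over stages in the weak limit. *)
Lemma seminorm_small (T : Type) (F : set_system T) (FF : Filter F) (P : T -> Prop)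
    (q : T -> L -> R) (B : R) :
  (\forall t \near F, P t) ->
  (forall t f g, P t -> q t (f + g) <= q t f + q t g) ->
  (forall t c f, P t -> q t (c *: f) <= normc c * q t f) ->
  (forall t f, P t -> q t f <= B * nrm f) ->
  (forall k i, (i < 2 ^ k)%N -> forall e, 0 < e -> \forall t \near F, q t (dyadic R k i) < e) ->
  forall f e, 0 < e -> \forall t \near F, q t f < e.
Proof.
move=> FP qD qZ qB qb f e e0.
wlog B0 : B qB / 0 < B.
  move=> h; apply: (h (Num.max B 1)); last by rewrite lt_max ltr01 orbT.
  move=> t g Pt; apply: (le_trans (qB t g Pt)).
  by rewrite ler_wpM2r ?nrm_ge0// le_max lexx.
have eB : 0 < e / 2 / B by rewrite !divr_gt0.
have [k [c fc]] := filter_ex (step_dense f eB).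
pose S := \sum_(i < 2 ^ k) normc (c i).
have S0 : 0 <= S by apply: sumr_ge0 => i _; exact: normc_ge0.
have eS : 0 < e / 2 / (S + 1) by rewrite !divr_gt0// ltr_wpDl.
have nb : \forall t \near F, forall i : 'I_(2 ^ k), q t (dyadic R k i) < e / 2 / (S + 1).
  by apply: filter_forall => i; apply: qb.
apply: filterS2 FP nb => t Pt qt.
have q0 : q t 0 <= 0 by have := qZ t 0 0 Pt; rewrite scale0r normc0 mul0r.
have qs : q t (\sum_(i < 2 ^ k) c i *: dyadic R k i) <= S * (e / 2 / (S + 1)).
  rewrite /S mulr_suml; elim/big_rec2: _ => [//|i y x _ h].
  apply: (le_trans (qD _ _ _ Pt)); apply: lerD => //.
  apply: (le_trans (qZ _ _ _ Pt)); rewrite ler_wpM2l ?normc_ge0//.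
  exact/ltW/qt.
rewrite -[f](subrK (\sum_(i < 2 ^ k) c i *: dyadic R k i)).
apply: (le_lt_trans (qD _ _ _ Pt)).
have h1 : q t (f - \sum_(i < 2 ^ k) c i *: dyadic R k i) < e / 2.
  by apply: (le_lt_trans (qB _ _ Pt)); rewrite mulrC -ltr_pdivlMr.
have h2 : S * (e / 2 / (S + 1)) <= e / 2.
  rewrite mulrA ler_pdivrMr ?ltr_wpDl//; nra.
by rewrite [e](splitr e); apply: ltr_leD => //; exact: le_trans qs h2.
Qed.

Definition contraction (A : L -> L) := linear A /\ forall f, nrm (A f) <= nrm f.

Lemma linD (A : L -> L) f g : linear A -> A (f + g) = A f + A g.
Proof. by move=> lA; have := lA 1 f g; rewrite !scale1r. Qed.

Lemma lin0 (A : L -> L) : linear A -> A 0 = 0.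
Proof. by move=> lA; have := linD 0 0 lA; rewrite addr0 => /eqP; rewrite -subr_eq0 opprD addrA subrr sub0r oppr_eq0 => /eqP. Qed.

Lemma linZ (A : L -> L) a f : linear A -> A (a *: f) = a *: A f.
Proof. by move=> lA; have := lA a f 0; rewrite (lin0 lA) !addr0. Qed.

Lemma linB (A : L -> L) f g : linear A -> A (f - g) = A f - A g.
Proof. by move=> lA; rewrite -scaleN1r (linD _ _ lA) (linZ _ _ lA) scaleN1r. Qed.

Lemma lin_sum (A : L -> L) (S : Type) (s : seq S) (P : pred S) (f : S -> L) : linear A ->
  A (\sum_(i <- s | P i) f i) = \sum_(i <- s | P i) A (f i).
Proof. by move=> lA; elim/big_rec2: _ => [|i y x _ <-]; rewrite ?(lin0 lA)// (linD _ _ lA). Qed.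

Lemma nrm_isoP (A : L -> L) : (forall f, `|A f| = `|f|) <-> forall f, nrm (A f) = nrm f.
Proof.
by split=> h f; [have /(congr1 (@complex.Re R)) := h f|rewrite !norm_nrm h].
Qed.

Lemma I1_linear A : I_1 R A -> linear A.
Proof. by case. Qed.

Lemma I1_nrm A : I_1 R A -> forall f, nrm (A f) = nrm f.
Proof. by case=> _ _ /nrm_isoP. Qed.

Lemma I1_contraction A : I_1 R A -> contraction A.
Proof. by move=> hA; split; [exact: I1_linear|move=> f; rewrite I1_nrm]. Qed.

Lemma iter_linear (A : L -> L) n : linear A -> linear (iter n A).
Proof. by move=> lA; elim: n => // n ih a f g /=; rewrite ih lA. Qed.

Lemma iter_contraction (A : L -> L) n : contraction A -> contraction (iter n A).
Proof.
move=> [lA cA]; split; first exact: iter_linear.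
by elim: n => // n ih f /=; apply: (le_trans (cA _)).
Qed.

Lemma diff_seminorm (A C : L -> L) : contraction A -> contraction C ->
  [/\ forall f g, nrm (A (f + g) - C (f + g)) <= nrm (A f - C f) + nrm (A g - C g),
      forall c f, nrm (A (c *: f) - C (c *: f)) <= normc c * nrm (A f - C f) &
      forall f, nrm (A f - C f) <= 2 * nrm f].
Proof.
move=> [lA cA] [lC cC]; split=> [f g|c f|f].
- by rewrite (linD _ _ lA) (linD _ _ lC) opprD addrACA nrm_D.
- by rewrite (linZ _ _ lA) (linZ _ _ lC) -scalerBr nrm_Z.
- by rewrite (le_trans (nrm_D _ _))// nrm_N mulr_natl mulr2n lerD.
Qed.

(** Basic neighbourhoods of [A] in the strong operator topology, tested on finite lists. *)
Definition near_op (F : seq L) (d : R) (A C : L -> L) :=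
  forall f, f \in F -> nrm (C f - A f) < d.

Definition dyadics k : seq L := [seq dyadic R k i | i <- iota 0 (2 ^ k)].

Lemma mem_dyadics k i : (i < 2 ^ k)%N -> dyadic R k i \in dyadics k.
Proof. by move=> ik; apply: map_f; rewrite mem_iota. Qed.

(** All three conditions are closed: linearity and isometry pass to pointwise limits, and so does
    positivity once [L1_nonnegP] turns it into an equation between norm and integral. *)
Lemma I1_limit (C : nat -> L -> L) (T : L -> L) : (forall n, I_1 R (C n)) ->
  (forall f e, 0 < e -> exists n0, forall n, (n0 <= n)%N -> nrm (C n f - T f) < e) ->
  I_1 R T.
Proof.
move=> IC CT.
have lT : linear T.
  move=> a f g; apply/eqP; rewrite -subr_eq0; apply/eqP; apply: nrm_le0 => e e0.
  have e30 : 0 < e / 3 by rewrite divr_gt0.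
  have ea : 0 < e / 3 / (normc a + 1) by rewrite divr_gt0// ltr_wpDl ?normc_ge0.
  have [n1 h1] := CT (a *: f + g) _ e30; have [n2 h2] := CT f _ ea; have [n3 h3] := CT g _ e30.
  pose n := maxn n1 (maxn n2 n3).
  have {}h1 : nrm (C n (a *: f + g) - T (a *: f + g)) < e / 3 by apply: h1; rewrite /n; lia.
  have {}h2 : nrm (C n f - T f) < e / 3 / (normc a + 1) by apply: h2; rewrite /n; lia.
  have {}h3 : nrm (C n g - T g) < e / 3 by apply: h3; rewrite /n; lia.
  have -> : T (a *: f + g) - (a *: T f + T g) =
    a *: (C n f - T f) + (C n g - T g) - (C n (a *: f + g) - T (a *: f + g)).
    have aux (x1 x2 y1 y2 t : L) : t - (x2 + y2) = (x1 - x2) + (y1 - y2) - (x1 + y1 - t).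
      by rewrite addrACA -opprD opprB [RHS]addrC subrKA.
    by rewrite (I1_linear (IC n)) scalerBr; exact: aux.
  apply: (le_trans (nrm_D _ _)); rewrite nrm_N.
  have := nrm_D (a *: (C n f - T f)) (C n g - T g); rewrite nrm_Z => h4.
  have h5 : normc a * nrm (C n f - T f) <= e / 3.
    have a0 : 0 < normc a + 1 by rewrite ltr_wpDl ?normc_ge0.
    apply: (@le_trans _ _ ((normc a + 1) * nrm (C n f - T f))).
      by rewrite ler_wpM2r ?nrm_ge0// lerDl.
    by rewrite mulrC -ler_pdivlMr// ltW.
  have aux (x1 x2 x3 x4 y : R) : x1 <= x2 + x3 -> x2 <= y / 3 -> x3 < y / 3 -> x4 < y / 3 -> x1 + x4 <= y by lra.
  exact: aux h4 h5 h3 h1.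
have nT f : nrm (T f) = nrm f.
  apply/eqP; rewrite -subr_eq0 -normr_le0; apply/ler_addgt0Pr => e e0.
  have [n0 /(_ _ (leqnn _)) h] := CT f e e0; rewrite add0r.
  apply: (le_trans _ (ltW h)); rewrite -(I1_nrm (IC n0) f) ler_norml.
  have := nrm_tri (C n0 f) (T f) 0; have := nrm_tri (T f) (C n0 f) 0.
  by rewrite !subr0 [nrm (T f - _)]nrm_B; lra.
split => //; last by apply/nrm_isoP.
move=> f f0; apply/L1_nonnegP; apply/eqP; rewrite -subr_eq0 -normr_le0.
apply/ler_addgt0Pr => e e0; rewrite add0r nT.
have [n0 /(_ _ (leqnn _)) h] := CT f e e0.
have [_ pC _] := IC n0; have /L1_nonnegP := pC f f0; rewrite (I1_nrm (IC n0)) => ->.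
rewrite -raddfB -TotB; apply: (le_trans (Re_Tot_le _)); exact: ltW.
Qed.

End operator_limits.

(** * Baire category by nested strong neighbourhoods *)

Section baire.
Variable R : realType.
Local Notation L := (L1_01 R).
Local Notation st := ((L -> L) * seq L * R)%type.

Let inv (s : st) := I_1 R s.1.1 /\ 0 < s.2.

(** A state holds an operator, a finite list of test vectors and a tolerance. A move spends less
    than half of the tolerance, the list receives the dyadic vectors of level [i] to force
    convergence, and the last clause secures [P i] on a whole closed neighbourhood. *)
Let nextp (P : nat -> (L -> L) -> Prop) (i : nat) (s s' : st) :=
  [/\ near_op s.1.2 (s.2 / 2) s.1.1 s'.1.1, s'.2 <= s.2 / 2,
      {subset s.1.2 <= s'.1.2}, {subset dyadics R i <= s'.1.2} &
      forall T, I_1 R T -> (forall f, f \in s'.1.2 -> nrm (T f - s'.1.1 f) <= s'.2) -> P i T].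

(** The last hypothesis says that each [P i] contains a dense open set. The nested closed
    neighbourhoods have a common point: the operators [C n] are Cauchy on dyadic vectors, hence on
    every vector, and L^1 is complete. *)
Lemma I1_baire (P : nat -> (L -> L) -> Prop) (A : L -> L) (F : seq L) (e : R) :
  I_1 R A -> 0 < e ->
  (forall i A F e, I_1 R A -> 0 < e -> exists C F' e',
    [/\ I_1 R C, near_op F e A C, 0 < e' &
        forall T, I_1 R T -> near_op F' e' C T -> P i T]) ->
  exists T, [/\ I_1 R T, near_op F e A T & forall i, P i T].
Proof.
move=> IA e0 dP.
have /choice[nxt nxtP] : forall p : nat * st, exists s' : st, inv p.2 -> inv s' /\ nextp P p.1 p.2 s'.
  move=> [i [[C G] d]] /=; have [[IC /= d0]|nI] := pselect (inv (C, G, d)); last by exists (C, G, d).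
  have d20 : 0 < d / 2 by rewrite divr_gt0.
  have [C' [F' [e' [IC' nC e'0 hP]]]] := dP i C G (d / 2) IC d20.
  (* [e' / 2] because the limit is only known to lie in the closed neighbourhood, while [P i] is
     granted on the open one of radius [e']. *)
  exists (C', G ++ F' ++ dyadics R i, Num.min (d / 2) (e' / 2)) => _.
  split; first by split => //=; rewrite lt_min d20 divr_gt0.
  split => //=; first by rewrite ge_min lexx.
  - by move=> f fG; rewrite mem_cat fG.
  - by move=> f fG; rewrite !mem_cat fG !orbT.
  - move=> T IT h; apply: hP => // f fF; apply: (le_lt_trans (h f _)).
      by rewrite !mem_cat fF orbT.
    by rewrite gt_min; apply/orP; right; rewrite ltr_pdivrMr// ltr_pMr// ltr1n.
(* Starting at [e / 2] makes the final estimate on [F] strict. *)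
pose s := fix s n := if n is n'.+1 then nxt (n', s n') else (A, F, e / 2).
have sI n : inv (s n).
  elim: n => [|n ih]; first by split => //=; rewrite divr_gt0.
  by case: (nxtP (n, s n) ih).
have sN n : nextp P n (s n) (s n.+1) by case: (nxtP (n, s n) (sI n)).
pose C n := (s n).1.1; pose G n := (s n).1.2; pose d n := (s n).2.
have IC n : I_1 R (C n) by case: (sI n).
have d0 n : 0 < d n by case: (sI n).
have Gmono m n : (m <= n)%N -> {subset G m <= G n}.
  elim: n => [|n ih]; first by rewrite leqn0 => /eqP ->.
  rewrite leq_eqVlt => /orP[/eqP ->//|]; rewrite ltnS => /ih h f /h fG.
  by case: (sN n) => _ _ + _ _; apply.
(* The bound [d m - d n], sharper than [d m], is what closes the induction: the move from stage [n]
   costs at most [d n - d n.+1]. *)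
have Cd m n f : (m <= n)%N -> f \in G m -> nrm (C n f - C m f) <= d m - d n.
  move=> mn fG; move: mn; elim: n => [|n ih].
    by rewrite leqn0 => /eqP ->; rewrite !subrr nrm_0.
  rewrite leq_eqVlt => /orP[/eqP ->|]; first by rewrite !subrr nrm_0.
  rewrite ltnS => mn; apply: (le_trans (nrm_tri (C n f) _ _)).
  have [h1 h2 _ _ _] := sN n; have := h1 f (Gmono _ _ mn _ fG).
  have := ih mn; rewrite -/(C n) -/(C n.+1).
  move: h2; rewrite -/(d n) -/(d n.+1) => h2 h3 h4.
  have aux (x y u v w : R) : x < v / 2 -> w <= v / 2 -> y <= u - v -> x + y <= u - w by lra.
  exact: aux h4 h2 h3.
have Cd' m n f : (m <= n)%N -> f \in G m -> nrm (C n f - C m f) <= d m.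
  by move=> mn fG; apply: (le_trans (Cd _ _ _ mn fG)); rewrite gerBl ltW.
have dlim e1 : 0 < e1 -> exists n0, forall n, (n0 <= n)%N -> d n < e1.
  move=> e10.
  have dn n : d n <= e * 2^-1 ^+ n.
    elim: n => [|n ih]; first by rewrite expr0 mulr1 /d /= ler_pdivrMr// ler_pMr// ler1n.
    have [_ h2 _ _ _] := sN n; apply: (le_trans h2).
    by rewrite exprSr mulrA ler_wpM2r// invr_ge0.
  have h1 : `|2^-1 : R| < 1 by rewrite ger0_norm; lra.
  have := cvg_expr h1 => /cvgrPdist_lt/(_ (e1 / e)).
  rewrite divr_gt0// => /(_ isT) [n0 _ h]; exists n0 => n /h /=.
  rewrite sub0r normrN ger0_norm ?exprn_ge0// => h3; apply: (le_lt_trans (dn n)).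
  by rewrite mulrC -ltr_pdivlMr.
have Ccauchy f e1 : 0 < e1 -> exists n0, forall m n, (n0 <= m)%N -> (n0 <= n)%N ->
    nrm (C m f - C n f) < e1.
  move=> e10.
  have : \forall p \near (\oo, \oo), nrm (C p.1 f - C p.2 f) < e1.
    have FF : Filter (filter_prod \oo \oo : set_system (nat * nat)) by exact: filter_prod_filter.
    apply: (@seminorm_small R (nat * nat)%type _ FF (fun=> True)
      (fun (p : nat * nat) (g : L) => nrm (C p.1 g - C p.2 g)) 2 _ _ _ _ _ f e1 e10).
    - exact: nearT.
    - by move=> p g h _; case: (diff_seminorm (I1_contraction (IC p.1)) (I1_contraction (IC p.2))).
    - by move=> p g h _; case: (diff_seminorm (I1_contraction (IC p.1)) (I1_contraction (IC p.2))).
    - by move=> p g _; case: (diff_seminorm (I1_contraction (IC p.1)) (I1_contraction (IC p.2))).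
    move=> k i ik e2 e20.
    have e220 : 0 < e2 / 2 by rewrite divr_gt0.
    have [n0 hn0] := dlim _ e220.
    pose n1 := maxn n0 k.+1.
    have bG : dyadic R k i \in G n1.
      apply: (Gmono k.+1); first exact: leq_maxr.
      by case: (sN k) => _ _ _ + _; apply; exact: mem_dyadics.
    exists ([set n | n1 <= n]%N, [set n | n1 <= n]%N) => /=; first by split; exists n1.
    move=> [m n] /= [m1 m2]; apply: (le_lt_trans (nrm_tri (C n1 (dyadic R k i)) _ _)).
    have := Cd' _ _ _ m1 bG; have := Cd' _ _ _ m2 bG; rewrite nrm_B.
    have := hn0 n1 (leq_maxl _ _).
    have aux (x y u v : R) : u < v / 2 -> x <= u -> y <= u -> y + x < v by lra.
    exact: aux.
  move=> [[U V] /= [[n1 _ h1] [n2 _ h2]] h]; exists (maxn n1 n2) => m n hm hn.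
  apply: (h (m, n)); split => /=; [apply: h1|apply: h2] => /=; lia.
have /choice[T Tlim] : forall f, exists v, forall e, 0 < e ->
    exists n0, forall n, (n0 <= n)%N -> nrm (C n f - v) < e.
  by move=> f; apply: L1_complete; exact: Ccauchy.
have IT := I1_limit IC Tlim.
have Tnear n f : f \in G n -> nrm (T f - C n f) <= d n.
  move=> fG; apply/ler_addgt0Pr => e1 e10.
  have [n0 h] := Tlim f _ e10.
  apply: (le_trans (nrm_tri (C (maxn n0 n) f) _ _)).
  have := h _ (leq_maxl n0 n); have := Cd' _ _ _ (leq_maxr n0 n) fG; rewrite [nrm (T f - _)]nrm_B.
  have aux (x y u v : R) : x <= u -> y < v -> y + x <= u + v by lra.
  exact: aux.
exists T; split => //.
  move=> f fF; apply: (le_lt_trans (Tnear 0%N f fF)).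
  by rewrite /d /= ltr_pdivrMr// ltr_pMr// ltr1n.
move=> i; case: (sN i) => _ _ _ _; apply => // f fG; exact: (Tnear i.+1).
Qed.

End baire.

(** * Towers *)

Section markov.
Variable R : realType.
Local Notation L := (L1_01 R).

(** Positivity in a form that is checked on norms and integrals and is stable under composition;
    together with an inverse of the same kind it gives membership in [U_1]. *)
Definition markov (A : L -> L) :=
  [/\ linear A, forall f, nrm (A f) <= nrm f & forall f, Tot (A f) = Tot f].

Lemma markov_id : markov id.
Proof. by split. Qed.

Lemma markov_comp A B : markov A -> markov B -> markov (A \o B).
Proof.
move=> [lA nA tA] [lB nB tB]; split=> [a f g|f|f] /=.
- by rewrite lB lA.
- exact: le_trans (nA _) (nB _).
- by rewrite tA tB.
Qed.

Lemma markov_iter A n : markov A -> markov (iter n A).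
Proof. by move=> mA; elim: n => [|n ih]; [exact: markov_id|exact: (markov_comp mA ih)]. Qed.

Lemma markov_positive A : markov A -> positive_operator A.
Proof.
move=> [lA nA tA] f /L1_nonnegP f0; apply/L1_nonnegP; apply/eqP; rewrite eq_le.
have h : Re (Tot (A f)) <= nrm (A f) by apply: le_trans (Re_Tot_le _); exact: ler_norm.
by rewrite h andbT tA -f0 nA.
Qed.

Lemma markov_inv_U1 A B : markov A -> markov B -> cancel A B -> cancel B A -> U_1 R A.
Proof.
move=> mA [_ nB _] AB BA; have [lA nA tA] := mA; split.
  split=> //; first exact: markov_positive.
  by apply/nrm_isoP => f; apply/eqP; rewrite eq_le nA -{1}(AB f) nB.
by move=> f _; exists (B f) => //; exact: BA.
Qed.

End markov.

Section transport_families.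
Variable R : realType.
Local Notation L := (L1_01 R).
Implicit Types (f : L).

Definition okf (S : finType) (p : S -> R * R) := forall s, okI (p s).

(** When [p] and [q] both partition [0, 1), this is the transfer operator of the piecewise affine
    bijection sending each [p s] onto [q s]. *)
Definition piecewise (S : finType) (p q : S -> R * R) f : L := \sum_s transport (p s) (q s) f.

Lemma piecewise_linear (S : finType) (p q : S -> R * R) : okf p -> okf q -> linear (piecewise p q).
Proof.
move=> op oq a f g; rewrite /piecewise scaler_sumr -big_split /=.
by apply: eq_bigr => s _; rewrite transport_D// transport_Z.
Qed.

Lemma transport_lin (p q : R * R) : okI p -> okI q -> linear (transport p q).
Proof. by move=> op oq a f g; rewrite transport_D// transport_Z. Qed.

Lemma piecewise_comp (S : finType) (p q r : S -> R * R) f : okf p -> okf q -> okf r ->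
  disjf q -> piecewise q r (piecewise p q f) = piecewise p r f.
Proof.
move=> op oq or dq; apply: eq_bigr => s _.
rewrite /piecewise (lin_sum _ _ _ (transport_lin (oq s) (or s))) (bigD1 s)//= transport_comp//.
by rewrite big1 ?addr0// => t ts; apply: transport_disj => //; exact: dq.
Qed.

Lemma piecewise_disj (S S' : finType) (p q : S -> R * R) (q' r : S' -> R * R) f :
  okf p -> okf q -> okf q' -> okf r -> (forall s t, disjI (q s) (q' t)) ->
  piecewise q' r (piecewise p q f) = 0.
Proof.
move=> op oq oq' or d; rewrite /piecewise big1// => t _.
rewrite (lin_sum _ _ _ (transport_lin (oq' t) (or t))) big1// => s _.
by apply: transport_disj => //; exact: d.
Qed.

Lemma nrm_piecewise (S : finType) (p q : S -> R * R) f : okf p -> okf q ->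
  nrm (piecewise p q f) <= \sum_s nrm (transport (p s) (p s) f).
Proof.
move=> op oq; apply: (le_trans (nrm_sum _ _ _)); apply: ler_sum => s _.
by rewrite nrm_transport.
Qed.

Lemma Tot_piecewise (S : finType) (p q : S -> R * R) f : okf p -> okf q ->
  Tot (piecewise p q f) = Tot (piecewise p p f).
Proof. by move=> op oq; rewrite !Tot_sum; apply: eq_bigr => s _; exact: Tot_transport. Qed.

Lemma piecewise_markov (S : finType) (p q : S -> R * R) : okf p -> okf q -> disjf p -> coverf p ->
  markov (piecewise p q).
Proof.
move=> op oq dp cp; split=> [|f|f]; first exact: piecewise_linear.
  by apply: (le_trans (nrm_piecewise _ op oq)); exact: nrm_disjf.
by rewrite Tot_piecewise// [in LHS]/piecewise transport_cover.
Qed.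

End transport_families.

Section tower.
Variables (R : realType) (S : finType) (J : finType).
Local Notation L := (L1_01 R).
(** L^1 is decomposed into copies of itself indexed by slots, with injections [e s] and projections
    [es s]. [sh k] climbs [k] floors, [pos] is the floor of a slot and [tg] the block containing it.
    The algebra of towers rests on these relations alone. *)
Variables (e es : S -> L -> L) (U V : L -> L) (sh : nat -> S -> S) (pos : S -> nat) (tg : S -> J).
Hypotheses (e_markov : forall s, markov (e s)) (es_linear : forall s, linear (es s))
  (es_N : forall f, \sum_s nrm (es s f) <= nrm f)
  (es_Tot : forall f, \sum_s Tot (es s f) = Tot f)
  (eK : forall s f, es s (e s f) = f)
  (e_disj : forall s t f, s != t -> es s (e t f) = 0)
  (e_cover : forall f, \sum_s e s (es s f) = f)
  (U_markov : markov U) (V_markov : markov V) (UK : cancel U V) (VK : cancel V U)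
  (sh0 : forall s, sh 0 s = s) (shD : forall k l s, sh k (sh l s) = sh (k + l) s)
  (tg_sh : forall k s, tg (sh k s) = tg s).

Let iterUK n : cancel (iter n U) (iter n V).
Proof. by elim: n => // n ih f; rewrite iterSr iterS UK ih. Qed.

Let iterVK n : cancel (iter n V) (iter n U).
Proof. by elim: n => // n ih f; rewrite iterSr iterS VK ih. Qed.

Let lU n : linear (iter n U).
Proof. by case: (markov_iter n U_markov). Qed.

Let lV n : linear (iter n V).
Proof. by case: (markov_iter n V_markov). Qed.

Let le s : linear (e s).
Proof. by case: (e_markov s). Qed.

(* In the coordinates [U^pos] on each slot, this is the permutation [sh k] of the
   slots. *)
Definition tower_op k f : L :=
  \sum_s e (sh k s) (iter (pos (sh k s)) U (iter (pos s) V (es s f))).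

Lemma es_tower_op k s f : es s (tower_op k f) =
  \sum_(t | sh k t == s) iter (pos s) U (iter (pos t) V (es t f)).
Proof.
rewrite /tower_op (lin_sum _ _ _ (@es_linear s)) [RHS]big_mkcond; apply: eq_bigr => t _.
case: eqVneq => [->|ts]; first by rewrite eK.
by rewrite e_disj// eq_sym.
Qed.

Lemma tower_op_linear k : linear (tower_op k).
Proof.
move=> a f g; rewrite /tower_op scaler_sumr -big_split /=; apply: eq_bigr => s _.
by rewrite es_linear lV lU le.
Qed.

(** At the intermediate slot the powers of [U] and [V] cancel, whatever its floor, so only the
    permutations compose. *)
Lemma tower_op_comp k l f : tower_op k (tower_op l f) = tower_op (k + l) f.
Proof.
rewrite /tower_op -/(tower_op l f).
under eq_bigr => s _ do
  rewrite es_tower_op (lin_sum _ _ _ (@lV _)) (lin_sum _ _ _ (@lU _)) (lin_sum _ _ _ (@le _)) big_mkcond.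
rewrite exchange_big /=; apply: eq_bigr => t _.
rewrite (bigD1 (sh l t))//= eqxx big1 ?addr0; last first.
  by move=> s; rewrite eq_sym => /negbTE ->.
by rewrite iterUK shD.
Qed.

Lemma tower_op0 f : tower_op 0 f = f.
Proof.
rewrite -[RHS]e_cover; apply: eq_bigr => s _.
by rewrite sh0 iterVK.
Qed.

Lemma iter_tower_op n f : iter n (tower_op 1) f = tower_op n f.
Proof. by elim: n f => [|n ih] f; [rewrite tower_op0|rewrite iterS ih tower_op_comp]. Qed.

Lemma tower_op_markov k : markov (tower_op k).
Proof.
split=> [|f|f]; first exact: tower_op_linear.
  apply: (le_trans (nrm_sum _ _ _)); apply: le_trans (es_N f).
  apply: ler_sum => s _; have [_ h _] := e_markov (sh k s); apply: (le_trans (h _)).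
  have [_ {}h _] := markov_iter (pos (sh k s)) U_markov; apply: (le_trans (h _)).
  by have [_ {}h _] := markov_iter (pos s) V_markov; apply: (le_trans (h _)).
rewrite Tot_sum -[RHS]es_Tot; apply: eq_bigr => s _.
have [_ _ ->] := e_markov (sh k s).
have [_ _ ->] := markov_iter (pos (sh k s)) U_markov.
by have [_ _ ->] := markov_iter (pos s) V_markov.
Qed.

Lemma tower_op_U1 H : (0 < H)%N -> (forall s, sh H s = s) -> U_1 R (tower_op 1).
Proof.
move=> H0 shH.
have tH f : tower_op H f = f.
  by rewrite -[RHS]tower_op0; apply: eq_bigr => s _; rewrite shH sh0.
apply: (@markov_inv_U1 _ _ (tower_op H.-1)); try exact: tower_op_markov.
  by move=> f; rewrite tower_op_comp addn1 prednK.
by move=> f; rewrite tower_op_comp add1n prednK.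
Qed.

(** Stands for multiplication by the indicator of the slots tagged [j]; these operators become the
    [chi_n]. *)
Definition block_part (j : J) f : L := \sum_(s | tg s == j) e s (es s f).

Lemma block_part_tower_op j k f : block_part j (tower_op k f) =
  \sum_(s | tg s == j) e (sh k s) (iter (pos (sh k s)) U (iter (pos s) V (es s f))).
Proof.
rewrite /block_part; under eq_bigr => s _ do rewrite es_tower_op (lin_sum _ _ _ (@le _)).
rewrite (exchange_big_dep (fun t => tg t == j))/=; last first.
  by move=> s t /eqP <- /eqP <-; rewrite tg_sh.
apply: eq_bigr => t tj; rewrite (big_pred1 (sh k t))// => s.
by rewrite /= [RHS]eq_sym; case: (eqVneq (sh k t) s) => [<-|_]; [rewrite tg_sh tj|rewrite andbF].
Qed.

(** The shift never leaves a block, so each block may trade [m] for its own exponent. *)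
Lemma tower_op_split (m : nat) (k : J -> nat) f : (forall s, sh m s = sh (k (tg s)) s) ->
  tower_op m f = \sum_j block_part j (tower_op (k j) f).
Proof.
move=> hm; under eq_bigr => j _ do rewrite block_part_tower_op.
rewrite /tower_op (partition_big tg xpredT)//=; apply: eq_bigr => j _.
by apply: eq_bigr => s /eqP sj; rewrite hm sj.
Qed.

Lemma block_part_linear j : linear (block_part j).
Proof.
move=> a f g; rewrite /block_part scaler_sumr -big_split /=; apply: eq_bigr => s _.
by rewrite es_linear le.
Qed.

Lemma nrm_block_part j f : nrm (block_part j f) <= nrm f.
Proof.
apply: (le_trans (nrm_sum _ _ _)); apply: le_trans (es_N f).
rewrite [leRHS](bigID (fun s => tg s == j))/=.
rewrite -[leLHS]addr0; apply: lerD; last by apply: sumr_ge0 => s _; exact: nrm_ge0.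
by apply: ler_sum => s _; have [_ h _] := e_markov s.
Qed.

Variable lam : S -> R.
Hypothesis lam_ge0 : forall s, 0 <= lam s.

(** Such an [f] looks the same in every slot, up to the share [lam s] of the mass; step functions on
    the cells are of this kind. *)
Definition slot_const f := forall s, es s f = (lam s)%:C *: f.

Lemma Tot_block_part j f : slot_const f -> Tot (block_part j f) = (\sum_(s | tg s == j) lam s)%:C * Tot f.
Proof.
move=> cf; rewrite /block_part Tot_sum rmorph_sum mulr_suml; apply: eq_bigr => s _.
by have [_ _ ->] := e_markov s; rewrite cf TotZ.
Qed.

(* Away from the top level of each tower, [tower_op 1] acts as [U]. *)
Lemma tower_op_approx f : slot_const f -> slot_const (U f) -> injective (sh 1) ->
  (forall s, lam (sh 1 s) = lam s) ->
  nrm (tower_op 1 f - U f) <= 2 * (\sum_(s | pos (sh 1 s) != (pos s).+1) lam s) * nrm f.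
Proof.
move=> cf cUf ish lsh.
(* The pieces of [U f] are indexed by the slot reached, to be compared term by term with those of
   [tower_op 1 f]. *)
rewrite -[U f in X in _ - X]e_cover (reindex_inj ish) /= -sumrB.
rewrite (bigID (fun s => pos (sh 1 s) != (pos s).+1)) /= [X in _ + X]big1 ?addr0; last first.
  move=> s; rewrite negbK => /eqP ->.
  rewrite cf cUf lsh (linZ _ _ (@lV _)) (linZ _ _ (@lU _)) iterS iterVK.
  by rewrite subrr.
apply: (le_trans (nrm_sum _ _ _)).
rewrite -mulrA mulr_suml mulr_sumr; apply: ler_sum => s _.
rewrite cf cUf lsh (linZ _ _ (@lV _)) (linZ _ _ (@lU _)) !(linZ _ _ (@le _)).
rewrite -scalerBr nrm_ZR ger0_norm// [2 * _]mulrC -mulrA; apply: ler_wpM2l => //.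
rewrite mulrC mulr_natl mulr2n; apply: (le_trans (nrm_D _ _)); rewrite nrm_N.
have [_ eN _] := e_markov (sh 1 s).
have [_ uN _] := markov_iter (pos (sh 1 s)) U_markov.
have [_ vN _] := markov_iter (pos s) V_markov.
have [_ u1N _] := U_markov.
by apply: lerD; apply: (le_trans (eN _)); rewrite ?u1N//; apply: (le_trans (uN _)).
Qed.

End tower.

(** * Subdivisions of half-open intervals *)

Section subintervals.
Variable R : realType.

(** [q] is read in the coordinate of [p] rescaled to [0, 1). *)
Definition subitv (p q : R * R) : R * R := (p.1 + q.1 * p.2, q.2 * p.2).

Lemma okI_subitv p q : okI p -> okI q -> okI (subitv p q).
Proof.
move=> /and3P[p1 p2 p3] /and3P[q1 q2 q3]; apply/and3P; split => /=.
- by rewrite addr_ge0// mulr_ge0// ltW.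
- by rewrite mulr_gt0.
- by apply: le_trans p3; rewrite -addrA -mulrDl lerD2l -[leRHS]mul1r ler_wpM2r// ltW.
Qed.

Lemma inI_subitv p q x : okI p -> inI (subitv p q) x = inI q ((x - p.1) / p.2).
Proof.
move=> /and3P[_ p0 _]; rewrite /inI /= ler_pdivlMr// ltr_pdivrMr// mulrDl.
by rewrite lerBrDl ltrBlDl addrA.
Qed.

Lemma inI_subitvW p q x : okI p -> okI q -> inI (subitv p q) x -> inI p x.
Proof.
move=> op /and3P[q1 q2 q3]; rewrite inI_subitv// => /andP[h1 h2].
have p0 : 0 < p.2 by case/and3P: op.
have h3 : 0 <= (x - p.1) / p.2 by exact: le_trans h1.
have h4 : (x - p.1) / p.2 < 1 by exact: lt_le_trans h2 q3.
rewrite /inI -subr_ge0 -(pmulr_lge0 _ (x := p.2^-1)) ?invr_gt0// h3 /=.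
by move: h4; rewrite ltr_pdivrMr// mul1r ltrBlDl.
Qed.

Lemma inI_unit (p : R * R) x : okI p -> inI p x -> 0 <= (x - p.1) / p.2 < 1.
Proof.
move=> /and3P[_ p0 _] /andP[h1 h2].
apply/andP; split; first by rewrite divr_ge0 ?subr_ge0// ltW.
by rewrite ltr_pdivrMr// mul1r ltrBlDl.
Qed.

Section families.
Variables (S T : finType) (p : S -> R * R) (P : S -> T -> R * R).
Hypotheses (op : okf p) (dp : disjf p) (cp : coverf p).
Hypotheses (oP : forall s, okf (P s)) (dP : forall s, disjf (P s)) (cP : forall s, coverf (P s)).

Definition subitvs (k : S * T) : R * R := subitv (p k.1) (P k.1 k.2).

Lemma okf_subitvs : okf subitvs.
Proof. by move=> [s t]; apply: okI_subitv; [exact: op|exact: oP]. Qed.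

Lemma disjf_subitvs : disjf subitvs.
Proof.
move=> [s t] [s' t'] st x; rewrite /subitvs /= => h1 h2.
have xs := inI_subitvW (op s) (oP s t) h1; have xs' := inI_subitvW (op s') (oP s' t') h2.
have [ss|ss] := eqVneq s s'; last exact: (dp ss xs xs').
subst s'; have tt' : t != t' by apply: contraNneq st => ->.
by rewrite !inI_subitv// in h1 h2; exact: (dP tt' h1 h2).
Qed.

Lemma coverf_subitvs : coverf subitvs.
Proof.
move=> x /cp[s xs]; have [t xt] := cP s (inI_unit (op s) xs).
by exists (s, t); rewrite /subitvs /= inI_subitv.
Qed.

End families.

(** Consecutive intervals in the order of the enumeration of [S], starting at the partial sums of
    [lam]. *)
Lemma partition_exists (S : finType) (lam : S -> R) :
  (forall s, 0 < lam s) -> \sum_s lam s = 1 ->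
  exists P : S -> R * R,
    [/\ okf P, disjf P, coverf P & forall s, (P s).2 = lam s].
Proof.
move=> l0 l1.
pose cum k := \sum_(t | (enum_rank t < k)%N) lam t.
have cumS s : cum (enum_rank s).+1 = cum (enum_rank s) + lam s.
  rewrite /cum (bigD1 s) ?ltnSn//= addrC; congr (_ + _); apply: eq_bigl => t.
  rewrite ltnS leq_eqVlt andb_orl.
  have [->|ts] := eqVneq t s; first by rewrite ltnn andbF.
  by rewrite !andbT (inj_eq val_inj) (inj_eq enum_rank_inj) (negbTE ts).
have cum_le k l : (k <= l)%N -> cum k <= cum l.
  move=> kl; rewrite /cum [leRHS](bigID (fun t => (enum_rank t < k)%N))/=.
  rewrite [X in _ <= X + _](eq_bigl (fun t : S => (enum_rank t < k)%N)); last first.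
    move=> t; rewrite andb_idl// => h; exact: leq_trans kl.
  by rewrite lerDl; apply: sumr_ge0 => t _; exact: ltW.
have cum0 : cum 0%N = 0 by rewrite /cum big_pred0.
have cum1 : cum #|S| = 1.
  by rewrite -l1 /cum; apply: eq_bigl => t; rewrite ltn_ord.
have cumle1 k : (k <= #|S|)%N -> cum k <= 1 by move=> /cum_le; rewrite cum1.
exists (fun s => (cum (enum_rank s), lam s)); split => //.
- move=> s; apply/and3P; split => //=; first by rewrite -cum0 cum_le.
  by rewrite -cumS cumle1.
- have dis s t x : (enum_rank s < enum_rank t)%N ->
      inI (cum (enum_rank s), lam s) x -> inI (cum (enum_rank t), lam t) x -> False.
    move=> st /andP[_ /= h1] /andP[/= h2 _].
    have := cum_le _ _ st; rewrite cumS => h3.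
    by have := lt_le_trans h1 (le_trans h3 h2); rewrite ltxx.
  move=> s t st x h1 h2.
  have : enum_rank s != enum_rank t :> nat by rewrite (inj_eq val_inj) (inj_eq enum_rank_inj).
  by rewrite neq_ltn => /orP[h|h]; [exact: (dis _ _ _ h h1 h2)|exact: (dis _ _ _ h h2 h1)].
- move=> x /andP[x0 x1].
  (* The interval containing [x] ends at the first partial sum exceeding [x]. *)
  have ex : exists k, (k <= #|S|)%N && (x < cum k) by exists #|S|; rewrite leqnn cum1.
  case: (ex_minnP ex) => [[|k] /andP[kS xk] kmin].
    by move: xk; rewrite cum0 ltNge x0.
  exists (enum_val (Ordinal kS)); apply/andP; rewrite enum_valK /=.
  have := cumS (enum_val (Ordinal kS)); rewrite enum_valK /= => <-; split => //.
  rewrite leNgt; apply/negP => h; have := kmin k; rewrite h (ltnW kS) => /(_ isT).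
  by rewrite ltnn.
Qed.

End subintervals.

(** * Cells cut into slots *)

Section slots.
Variables (R : realType) (K S : finType) (D : K -> R * R) (P : S -> R * R).
Local Notation L := (L1_01 R).
Local Notation mu := (@lebesgue_measure R).
Hypotheses (oD : okf D) (dD : disjf D) (cD : coverf D).
Hypotheses (oP : okf P) (dP : disjf P) (cP : coverf P).

(** Every cell is cut in the same proportions [P]. Then [slot_in s] squeezes each cell into its slot
    [s], while [slot_out s] stretches that slot back over the cell and discards the rest. *)
Definition slot s (k : K) := subitv (D k) (P s).
Definition slot_in s : L -> L := piecewise D (slot s).
Definition slot_out s : L -> L := piecewise (slot s) D.

Let subDP := subitvs D (fun=> P).
Let osubDP : okf subDP := okf_subitvs oD (fun=> oP).
Let dsubDP : disjf subDP := disjf_subitvs oD dD (fun=> oP) (fun=> dP).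
Let csubDP : coverf subDP := coverf_subitvs oD cD (fun=> cP).

Lemma ok_slot s : okf (slot s).
Proof. by move=> k; exact: (osubDP (k, s)). Qed.

Lemma disj_slot s t k l : (s != t) || (k != l) -> disjI (slot s k) (slot t l).
Proof.
move=> h; apply: (dsubDP (s := (k, s)) (t := (l, t))).
by rewrite xpair_eqE negb_and orbC.
Qed.

Lemma disjf_slot s : disjf (slot s).
Proof. by move=> k l kl; apply: disj_slot; rewrite kl orbT. Qed.

Lemma slot_sub s k x : inI (slot s k) x -> inI (D k) x.
Proof. exact: inI_subitvW. Qed.

Lemma slot_in_markov s : markov (slot_in s).
Proof. by apply: piecewise_markov => //; exact: ok_slot. Qed.

Lemma slot_out_linear s : linear (slot_out s).
Proof. by apply: piecewise_linear => //; exact: ok_slot. Qed.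

Lemma slot_out_nrm f : \sum_s nrm (slot_out s f) <= nrm f.
Proof.
apply: le_trans (nrm_disjf f osubDP dsubDP).
rewrite -(pair_big xpredT xpredT (fun k s => nrm (transport (subDP (k, s)) (subDP (k, s)) f)))/=.
rewrite exchange_big; apply: ler_sum => s _; apply: nrm_piecewise => //; exact: ok_slot.
Qed.

Lemma sum_slots f : \sum_s piecewise (slot s) (slot s) f = f.
Proof.
rewrite -[RHS](transport_cover f osubDP dsubDP csubDP).
rewrite -(pair_big xpredT xpredT (fun k s => transport (subDP (k, s)) (subDP (k, s)) f))/=.
by rewrite exchange_big.
Qed.

Lemma slot_out_Tot f : \sum_s Tot (slot_out s f) = Tot f.
Proof.
rewrite -[in RHS](sum_slots f) Tot_sum; apply: eq_bigr => s _.
by apply: Tot_piecewise => //; exact: ok_slot.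
Qed.

Lemma slot_inK s f : slot_out s (slot_in s f) = f.
Proof.
rewrite /slot_out /slot_in piecewise_comp//; [|exact: ok_slot|exact: disjf_slot].
exact: transport_cover.
Qed.

Lemma slot_out_in s t f : s != t -> slot_out s (slot_in t f) = 0.
Proof.
move=> st; apply: piecewise_disj => //; try exact: ok_slot.
by move=> k l; apply: disj_slot; rewrite eq_sym st.
Qed.

Lemma slot_in_out s f : slot_in s (slot_out s f) = piecewise (slot s) (slot s) f.
Proof. by rewrite /slot_out /slot_in piecewise_comp//; exact: ok_slot. Qed.

Lemma sum_slot_in_out f : \sum_s slot_in s (slot_out s f) = f.
Proof. by under eq_bigr do rewrite slot_in_out; exact: sum_slots. Qed.

(** The composite is the restriction to the slots of index [s], which commutes with multiplication
    by functions. *)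
Lemma Mul_slot_in_out s g f : Linfty_fun mu (@I01 R) g ->
  Mul g (slot_in s (slot_out s f)) = slot_in s (slot_out s (Mul g f)).
Proof.
move=> gi; rewrite !slot_in_out /piecewise.
elim/big_rec2: _ => [|k y x _ <-]; last by rewrite MulD// Mul_transport//; exact: ok_slot.
by have := MulZ 0 0 gi; rewrite !scale0r.
Qed.

Definition cellwise (f : L) := exists c : K -> R[i], f = \sum_k c k *: itv_one (D k).

(** Stretching a constant from a slot to its cell multiplies it by the ratio of lengths, and this
    ratio is the same in every cell. *)
Lemma cellwise_slot_out s f : cellwise f -> slot_out s f = ((P s).2)%:C *: f.
Proof.
move=> [c ->]; rewrite (lin_sum _ _ _ (slot_out_linear s)) scaler_sumr; apply: eq_bigr => k _.
rewrite (linZ _ _ (slot_out_linear s)) scalerA mulrC -scalerA; congr (_ *: _).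
rewrite /slot_out /piecewise (bigD1 k)//= big1 ?addr0; last first.
  move=> l lk; apply: transport_itv_one0 => //; first exact: ok_slot.
  by move=> x /slot_sub xl xk; exact: (dD lk xl xk).
rewrite transport_itv_one//; [|exact: ok_slot|exact: slot_sub].
have /and3P[_ k0 _] := oD k.
by rewrite /slot /= mulfK// gt_eqF.
Qed.

Lemma cellwise_lin a f g : cellwise f -> cellwise g -> cellwise (a *: f + g).
Proof.
move=> [c ->] [c' ->]; exists (fun k => a * c k + c' k).
rewrite scaler_sumr -big_split /=; apply: eq_bigr => k _.
by rewrite scalerA scalerDl.
Qed.

Lemma cellwise0 : cellwise 0.
Proof. by exists (fun=> 0); rewrite big1// => k _; rewrite scale0r. Qed.

Lemma cellwise_sum (I : Type) (r : seq I) (Q : pred I) (F : I -> L) :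
  (forall i, Q i -> cellwise (F i)) -> cellwise (\sum_(i <- r | Q i) F i).
Proof.
move=> h; elim/big_rec: _ => [|i x Qi cx]; first exact: cellwise0.
by rewrite -[F i]scale1r; apply: cellwise_lin => //; exact: h.
Qed.

Lemma cellwiseZ a f : cellwise f -> cellwise (a *: f).
Proof. by move=> cf; rewrite -[_ *: _]addr0; apply: cellwise_lin => //; exact: cellwise0. Qed.

Lemma cellwise_itv_one k : cellwise (itv_one (D k)).
Proof.
exists (fun l => (l == k)%:R); rewrite (bigD1 k)//= eqxx scale1r big1 ?addr0// => l /negbTE ->.
by rewrite scale0r.
Qed.

End slots.

(** * Cyclic shifts on towers of unequal heights *)

Section cyclic_shift.
Variables (p : nat) (h : 'I_p.+1 -> nat).
Hypothesis h0 : forall n, (0 < h n)%N.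

Definition floors := {n : 'I_p.+1 & 'I_(h n)}.

Definition shift (k : nat) (s : floors) : floors :=
  Tagged (fun n => 'I_(h n)) (Ordinal (ltn_pmod (tagged s + k) (h0 (tag s)))).

Definition floor (s : floors) : nat := tagged s.

Lemma shift_eq (n : 'I_p.+1) (i j : 'I_(h n)) : i = j :> nat ->
  Tagged (fun n => 'I_(h n)) i = Tagged (fun n => 'I_(h n)) j.
Proof. by move=> /val_inj ->. Qed.

Lemma shift_period k s : (h (tag s) %| k)%N -> shift k s = s.
Proof.
case: s => n i /= /dvdnP[c ->]; apply: shift_eq => /=.
by rewrite addnC modnMDl modn_small.
Qed.

Lemma shiftD k l s : shift k (shift l s) = shift (k + l) s.
Proof. by case: s => n i; apply: shift_eq => /=; rewrite modnDml -addnA [(l + k)%N]addnC. Qed.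

Lemma shift_mod k l s : (k = l %[mod h (tag s)])%N -> shift k s = shift l s.
Proof. by case: s => n i /= kl; apply: shift_eq => /=; rewrite -modnDmr kl modnDmr. Qed.

Lemma floor_shift1 s : floor (shift 1 s) != (floor s).+1 -> (floor s).+1 = h (tag s).
Proof.
rewrite /floor /=; have := ltn_ord (tagged s); rewrite addn1.
rewrite leq_eqVlt => /orP[/eqP//|hs]; first by rewrite modn_small ?eqxx.
Qed.

End cyclic_shift.

(** * Construction of the tower operator *)

Section core_tower.
Variable R : realType.
Local Notation L := (L1_01 R).
Local Notation mu := (@lebesgue_measure R).

(* The block of index [n] is made of towers of height [m - n], so that the
   [m]-th power of the constructed operator acts on it as the [n]-th one. *)
Lemma tower_exists (K : finType) (D : K -> R * R) (U V : L -> L)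
    (p m : nat) (a : 'I_p.+1 -> R) :
  okf D -> disjf D -> coverf D -> markov U -> markov V -> cancel U V -> cancel V U ->
  (p < m)%N -> (forall n, 0 < a n) -> \sum_n a n = 1 ->
  exists C : L -> L, exists chi : 'I_p.+1 -> L -> L,
  [/\ U_1 R C,
      forall f, iter m C f = \sum_n chi n (iter n C f),
      forall n, [/\ linear (chi n), forall f, nrm (chi n f) <= nrm f &
        forall g f, Linfty_fun mu (@I01 R) g -> Mul g (chi n f) = chi n (Mul g f)],
      forall n f, cellwise D f -> Tot (chi n f) = (a n)%:C * Tot f &
      forall f, cellwise D f -> cellwise D (U f) ->
        nrm (C f - U f) <= 2 / (m - p)%:R * nrm f].
Proof.
move=> oD dD cD mU mV UV VU pm a0 a1.
pose h (n : 'I_p.+1) := (m - n)%N.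
have hp (n : 'I_p.+1) : (m - p <= h n)%N by rewrite /h; have := ltn_ord n; lia.
have mp0 : (0 < m - p)%N by rewrite subn_gt0.
have h0 n : (0 < h n)%N by exact: leq_trans mp0 (hp n).
have hR (n : 'I_p.+1) : 0 < (h n)%:R :> R by rewrite ltr0n.
pose S := {n : 'I_p.+1 & 'I_(h n)}.
(* Equal lengths inside a tower, so that the shift preserves them; tower [n] has total [a n]. *)
pose lam (s : S) := a (tag s) / (h (tag s))%:R.
have lam0 s : 0 < lam s by rewrite divr_gt0.
have lam_tag n : \sum_(s : S | tag s == n) lam s = a n.
  rewrite (eq_bigl (fun s : S => (tag s == n) && true)); last by move=> s; rewrite andbT.
  rewrite -(sig_big_dep (fun i => i == n) (fun i (j : 'I_(h i)) => true) (fun i j => a i / (h i)%:R)).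
  by rewrite big_pred1_eq sumr_const card_ord -[LHS]mulr_natr mulfVK// gt_eqF.
have lam1 : \sum_s lam s = 1.
  rewrite (partition_big (@tag _ _) xpredT)//= -a1.
  by apply: eq_bigr => n _; rewrite -(lam_tag n).
have [P [oP dP cP lP]] := partition_exists lam0 lam1.
pose E := slot_in D P; pose Es := slot_out D P.
have M1 s : markov (E s) by exact: slot_in_markov.
have M2 s : linear (Es s) by exact: slot_out_linear.
have M3 f : \sum_s nrm (Es s f) <= nrm f by exact: slot_out_nrm.
have M4 f : \sum_s Tot (Es s f) = Tot f by exact: slot_out_Tot.
have M5 s f : Es s (E s f) = f by exact: slot_inK.
have M6 s t f : s != t -> Es s (E t f) = 0 by exact: slot_out_in.
have M7 f : \sum_s E s (Es s f) = f by exact: sum_slot_in_out.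
have sh0 s : shift h0 0 s = s by apply: shift_period; rewrite dvdn0.
have shD k l s : shift h0 k (shift h0 l s) = shift h0 (k + l) s by exact: shiftD.
have tsh k s : tag (shift h0 k s) = tag s by [].
pose C := tower_op E Es U V (shift h0) (@floor p h) 1.
have Cn n f : iter n C f = tower_op E Es U V (shift h0) (@floor p h) n f.
  by rewrite /C (iter_tower_op _ M1 M2 M5 M6 M7 mU mV UV VU sh0 shD).
exists C, (block_part E Es (@tag _ _)); split.
(* [m!] is a common multiple of all heights, hence a period of the shift. *)
- apply: (tower_op_U1 (H := m`!) _ M1 M2 M3 M4 M5 M6 M7 mU mV UV VU sh0 shD).
    exact: fact_gt0.
  move=> s; apply: shift_period; apply: dvdn_fact; rewrite h0 /h; lia.
- move=> f; rewrite Cn; under eq_bigr do rewrite Cn.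
  apply: (tower_op_split U V _ M1 M2 M5 M6 tsh) => s.
  (* [m = n + h n], so [m] and [n] agree modulo the height of tower [n]. *)
  apply: shift_mod; rewrite /h; have := ltn_ord (tag s) => hs.
  by rewrite -{1}(@subnK (tag s) m) ?modnDl//; lia.
- move=> n; split.
  + exact: (block_part_linear _ M1 M2).
  + by move=> f; exact: (nrm_block_part _ M1 M3).
  + move=> g f gi; rewrite /block_part.
    elim/big_rec2: _ => [|s y x _ <-].
      by have := MulZ 0 0 gi; rewrite !scale0r.
    by rewrite MulD//; congr (_ + _); exact: Mul_slot_in_out.
- move=> n f cf; rewrite (Tot_block_part (lam := lam) _ M1 _)//; last first.
    by move=> s; rewrite /Es cellwise_slot_out// lP.
  by rewrite lam_tag.
- move=> f cf cUf.
  have inj1 : injective (shift h0 1).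
    apply: (can_inj (g := shift h0 (m`!).-1)) => s.
    rewrite shD addn1 prednK ?fact_gt0//; apply: shift_period; apply: dvdn_fact.
    by rewrite h0 /h; lia.
  have sc g : cellwise D g -> slot_const Es lam g.
    by move=> cg s; rewrite /Es cellwise_slot_out// lP.
  apply: (le_trans (tower_op_approx _ M1 M7 mU mV VU (fun s => ltW (lam0 s)) (sc _ cf) (sc _ cUf) inj1 _)).
    by [].
  apply: ler_wpM2r; first exact: nrm_ge0.
  apply: ler_wpM2l => //.
  (* Only top floors break the climb. Their total length is the sum of the [a n / h n], at most
     [1 / (m - p)]. *)
  apply: (@le_trans _ _ (\sum_(s : S | (floor s).+1 == h (tag s)) lam s)).
    rewrite [leRHS](bigID (fun s => floor (shift h0 1 s) != (floor s).+1))/=.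
    rewrite [X in _ <= X + _](eq_bigl (fun s => floor (shift h0 1 s) != (floor s).+1)); last first.
      by move=> s; rewrite andb_idl// => /floor_shift1 ->.
    by rewrite lerDl; apply: sumr_ge0 => s _; exact: ltW.
  rewrite -(sig_big_dep xpredT (fun i (j : 'I_(h i)) => j.+1 == h i) (fun i j => a i / (h i)%:R)).
  have -> : (m - p)%:R^-1 = \sum_n a n * (m - p)%:R^-1 :> R.
    by rewrite -mulr_suml a1 mul1r.
  apply: ler_sum => n _.
  have hn : ((h n).-1 < h n)%N by rewrite prednK.
  rewrite (big_pred1 (Ordinal hn)); last first.
    by move=> j /=; rewrite -val_eqE /= -[RHS]eqSS (prednK (h0 n)).
  apply: ler_wpM2l; first exact: ltW.
  by rewrite lef_pV2 ?posrE ?hR ?ltr0n// ler_nat hp.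
Qed.

End core_tower.

(** * Piecewise affine approximation *)

Section positive_steps.
Variable R : realType.
Local Notation L := (L1_01 R).
Local Notation mu := (@lebesgue_measure R).
Local Notation mI := (@measurable_I01 R).

Lemma Im_Tot_nonneg (f : L) : L1_nonneg f -> Im (Tot f) = 0.
Proof.
move=> f0; have [_ /integrableP[/measurable_EFinP m2 _]] := cint_repr f.
rewrite /Tot /cintegral /= /Rintegral (@ae_eq_integral _ _ _ mu _ (cst 0%E)) ?integral0//.
- exact: mI.
- exact/measurable_EFinP.
- by apply: filterS f0 => x h Ix; move: (h Ix); case: (repr f x) => u v; rewrite lecE /= => /andP[/eqP ->].
Qed.

Lemma transport_nonneg p (f : L) : okI p -> L1_nonneg f -> L1_nonneg (transport p p f).
Proof.
move=> op f0; have h := repr_toL1 (cint_transport_fun op op (cint_repr f)).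
apply: filterS2 f0 h => x f0 h Ix; rewrite /transport h// transport_fun_id//.
by case: ifP => // _; exact: f0.
Qed.

Lemma Tot_nonneg (f : L) : L1_nonneg f -> Tot f = (nrm f)%:C.
Proof.
move=> f0; have := Im_Tot_nonneg f0; have /L1_nonnegP -> := f0.
by case: (Tot f) => u v /= ->.
Qed.

Lemma dyadic_nonneg k i : (i < 2 ^ k)%N -> L1_nonneg (dyadic R k i).
Proof. by move=> ik; apply/L1_nonnegP; rewrite nrm_dyadic// Tot_dyadic. Qed.

(** Heights are written as masses times [2 ^+ r], so that norms are bounded by l^1 distances between
    masses. *)
Lemma nrm_step r (c d : nat -> R) :
  nrm (\sum_(i < 2 ^ r) (c i * 2 ^+ r)%:C *: dyadic R r i - \sum_(i < 2 ^ r) (d i * 2 ^+ r)%:C *: dyadic R r i)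
  <= \sum_(i < 2 ^ r) `|c i - d i|.
Proof.
have r0 := exp2_gt0 R r.
rewrite -sumrB; apply: (le_trans (nrm_sum _ _ _)); apply: ler_sum => i _.
rewrite -scalerBl -rmorphB nrm_ZR nrm_dyadic// -mulrBl normrM (ger0_norm (ltW r0)).
by rewrite mulfK// lt0r_neq0.
Qed.

(** Averaging [g] over the cells keeps the masses and nearly fixes [g], which is close to a step
    function. Mixing in a little uniform mass then makes every weight strictly positive, so that the
    weights can serve as lengths of intervals. *)
Lemma positive_step_dense (g : L) (del : R) : L1_nonneg g -> 0 < nrm g -> 0 < del ->
  \forall r \near \oo, exists w : nat -> R,
    [/\ forall i, (i < 2 ^ r)%N -> 0 < w i, \sum_(i < 2 ^ r) w i = nrm g &
        nrm (\sum_(i < 2 ^ r) (w i * 2 ^+ r)%:C *: dyadic R r i - g) < del].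
Proof.
move=> g0 Ng d0; have d60 : 0 < del / 6 by rewrite divr_gt0.
apply: filterS (step_dense g d60) => r [c hc].
have r0 := exp2_gt0 R r; have r1 : (2 : R) ^+ r != 0 by rewrite gt_eqF.
have oD := @okI_dyadic_itvs R r; have dD := @disjf_dyadic_itvs R r; have cD := @coverf_dyadic_itvs R r.
pose m i := nrm (transport (dyadic_itv R r i) (dyadic_itv R r i) g).
have m0 i : 0 <= m i by exact: nrm_ge0.
have Tm (i : 'I_(2 ^ r)) : Tot (transport (dyadic_itv R r i) (dyadic_itv R r i) g) = (m i)%:C.
  by apply: Tot_nonneg; apply: transport_nonneg => //; exact: (oD i).
have sm : \sum_(i < 2 ^ r) m i = nrm g.
  apply/eqP; rewrite eq_le (nrm_disjf g oD dD) /=.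
  by rewrite -{1}(transport_cover g oD dD cD); exact: nrm_sum.
pose sg := \sum_(i < 2 ^ r) (m i * 2 ^+ r)%:C *: dyadic R r i.
(* On each cell the average differs from the step function by at most twice the error of [g] (by
   [normc_Tot_le]); adding that error itself gives the factor 3. *)
have h1 : nrm (sg - g) <= del / 2.
  pose S := \sum_(i < 2 ^ r) c i *: dyadic R r i.
  apply: (@le_trans _ _ (3 * nrm (g - S))); last by move: hc; rewrite -/S; lra.
  rewrite -[g in nrm (sg - g)](transport_cover g oD dD cD) /sg -sumrB; apply: (le_trans (nrm_sum _ _ _)).
  apply: (@le_trans _ _ (3 * \sum_(i < 2 ^ r) nrm (transport (dyadic_itvs R i) (dyadic_itvs R i) (g - S)))); last first.
    by rewrite ler_wpM2l// nrm_disjf.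
  rewrite mulr_sumr; apply: ler_sum => i _.
  have -> : transport (dyadic_itvs R i) (dyadic_itvs R i) (g - S) = transport (dyadic_itvs R i) (dyadic_itvs R i) g - c i *: dyadic R r i.
    have lM := transport_lin (oD i) (oD i).
    rewrite (linB _ _ lM) /S (lin_sum _ _ _ lM); congr (_ - _).
    rewrite (bigD1 i)//= (linZ _ _ lM) transport_itv_one//; last exact: (oD i).
    rewrite big1 ?addr0.
      have /and3P[_ i0 _] := oD i.
      by rewrite divff ?gt_eqF// scale1r.
    by move=> l li; rewrite (linZ _ _ lM) (transport_itv_one0 (oD i) (oD i) (oD l)) ?scaler0//; apply: dD; rewrite eq_sym.
  set Mg := transport _ _ g.
  have := nrm_tri (c i *: dyadic R r i) ((m i * 2 ^+ r)%:C *: dyadic R r i) Mg.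
  have := nrm_B (c i *: dyadic R r i) Mg.
  suff : nrm ((m i * 2 ^+ r)%:C *: dyadic R r i - c i *: dyadic R r i) <= 2 * nrm (Mg - c i *: dyadic R r i) by lra.
  rewrite -scalerBl nrm_Z nrm_dyadic//; apply: le_trans (normc_Tot_le _).
  rewrite TotB /Mg Tm TotZ Tot_dyadic// -[X in _ * X](ger0_norm (ltW (_ : 0 < (2 ^+ r)^-1))) ?invr_gt0//.
  by rewrite -normc_real -normcM mulrBl -rmorphM mulfK// -Tm -TotB -nrm_N.
(* [eta] is the proportion of uniform mass; the change costs at most [2 * eta * nrm g], hence at
   most [del / 4]. *)
pose eta := Num.min (1 / 2) (del / (8 * nrm g)).
have eta0 : 0 < eta by rewrite lt_min !divr_gt0// ?mulr_gt0.
have eta1 : eta <= 1 / 2 by rewrite ge_min lexx.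
have eta2 : eta * nrm g <= del / 8.
  by rewrite -ler_pdivlMr// -mulrA -invfM ge_min lexx orbT.
exists (fun i => (1 - eta) * m i + eta * (nrm g / 2 ^+ r)); split.
- move=> i _; apply: ltr_wpDl; first by rewrite mulr_ge0//; lra.
  by rewrite mulr_gt0// divr_gt0.
- rewrite big_split /= -mulr_sumr sm -mulr_sumr sumr_const card_ord -[X in _ + _ * X]mulr_natr natrX.
  by rewrite mulfVK// -mulrDl subrK mul1r.
apply: (le_lt_trans (nrm_tri sg _ _)).
suff : nrm (\sum_(i < 2 ^ r) (((1 - eta) * m i + eta * (nrm g / 2 ^+ r)) * 2 ^+ r)%:C *: dyadic R r i - sg) <= del / 4.
  by move: h1; lra.
apply: (le_trans (nrm_step r (fun i => (1 - eta) * m i + eta * (nrm g / 2 ^+ r)) m)).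
apply: (@le_trans _ _ (\sum_(i < 2 ^ r) (eta * m i + eta * (nrm g / 2 ^+ r)))).
  apply: ler_sum => i _.
  have -> : (1 - eta) * m i + eta * (nrm g / 2 ^+ r) - m i = eta * (nrm g / 2 ^+ r) - eta * m i by ring.
  have u0 : 0 <= eta * (nrm g / 2 ^+ r) by rewrite ltW// mulr_gt0// divr_gt0.
  have v0 : 0 <= eta * m i by rewrite mulr_ge0// ltW.
  apply: (le_trans (ler_normB _ _)); rewrite (ger0_norm u0) (ger0_norm v0).
  by rewrite addrC.
rewrite big_split /= -mulr_sumr sm sumr_const card_ord -[X in _ + X]mulr_natr natrX.
rewrite mulrA mulfVK//; lra.
Qed.

End positive_steps.

Section piecewise_affine_approximation.
Variable R : realType.
Local Notation L := (L1_01 R).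

Lemma nrm_dyadic_diff k i j : (i < 2 ^ k)%N -> (j < 2 ^ k)%N -> i != j ->
  2 * (2 ^+ k)^-1 <= nrm (dyadic R k i - dyadic R k j).
Proof.
move=> ik jk ij.
pose i' := Ordinal ik; pose j' := Ordinal jk.
have oD := @okI_dyadic_itvs R k; have dD := @disjf_dyadic_itvs R k.
apply: le_trans (nrm_disjf (dyadic R k i - dyadic R k j) oD dD).
have lM l := transport_lin (oD l) (oD l).
have Mi : transport (dyadic_itvs R i') (dyadic_itvs R i') (dyadic R k i - dyadic R k j) = dyadic R k i.
  rewrite (linB _ _ (lM _)) (transport_itv_one (oD i') (oD i') (oD i'))// (transport_itv_one0 (oD i') (oD i') (oD j')).
    have /and3P[_ i0 _] := oD i'.
    by rewrite divff ?gt_eqF// scale1r subr0.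
  exact: dD.
have Mj : transport (dyadic_itvs R j') (dyadic_itvs R j') (dyadic R k i - dyadic R k j) = - dyadic R k j.
  rewrite (linB _ _ (lM _)) (transport_itv_one (oD j') (oD j') (oD j'))// (transport_itv_one0 (oD j') (oD j') (oD i')).
    have /and3P[_ i0 _] := oD j'.
    by rewrite divff ?gt_eqF// scale1r sub0r.
  by apply: dD; rewrite eq_sym.
rewrite (bigD1 i')//= (bigD1 j')/=; last by rewrite eq_sym.
rewrite Mi Mj nrm_N !nrm_dyadic// addrA mulr_natl mulr2n lerDl.
by apply: sumr_ge0 => l _; exact: nrm_ge0.
Qed.

Lemma minr_normE (x y : R) : Num.min x y = (x + y - `|x - y|) / 2.
Proof.
by have [xy|yx] := lerP x y; field.
Qed.


Lemma mul_div_le_min (x y s : R) : 0 < x -> 0 < y -> x + y <= s -> x * y / s <= Num.min x y.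
Proof.
move=> x0 y0 xys; have s0 : 0 < s by lra.
by rewrite le_min !ler_pdivrMr//; apply/andP; split; nra.
Qed.

(* [w j i] is the mass of [A (dyadic k j)] on the [i]-th dyadic interval, which is
   cut proportionally to these masses.  The error is bounded by
   [sum_i min (w j i) (w j' i)], which is small for [j != j'] since [A] is isometric
   and hence preserves disjointness. *)
Lemma piecewise_affine_approx (A : L -> L) (k r0 : nat) (eps : R) : I_1 R A -> 0 < eps ->
  exists r : nat, exists D : 'I_(2 ^ r) * 'I_(2 ^ k) -> R * R,
  exists q : 'I_(2 ^ r) * 'I_(2 ^ k) -> R * R,
  [/\ (r0 <= r)%N, [/\ okf D, disjf D & coverf D], [/\ okf q, disjf q & coverf q],
      forall i : 'I_(2 ^ r), cellwise D (dyadic R r i) &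
      forall j : 'I_(2 ^ k), cellwise D (piecewise q D (dyadic R k j)) /\
        nrm (piecewise q D (dyadic R k j) - A (dyadic R k j)) < eps].
Proof.
move=> IA eps0; have k0 := exp2_gt0 R k.
(* Misplaced mass will cost [2 * 2 ^+ k * del], and the step approximation of [A (dyadic k j)] a
   further [del]: together [eps]. *)
pose del := eps / (2 * 2 ^+ k + 1).
have c0 : 0 < 2 * 2 ^+ k + 1 :> R by rewrite addr_gt0// mulr_gt0.
have del0 : 0 < del by rewrite divr_gt0.
have NA j : (j < 2 ^ k)%N -> nrm (A (dyadic R k j)) = (2 ^+ k)^-1 by move=> jk; rewrite (I1_nrm IA) nrm_dyadic.
have near_w : \forall r \near \oo, forall j : 'I_(2 ^ k), exists w : nat -> R,
    [/\ forall i, (i < 2 ^ r)%N -> 0 < w i, \sum_(i < 2 ^ r) w i = nrm (A (dyadic R k j)) &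
        nrm (\sum_(i < 2 ^ r) (w i * 2 ^+ r)%:C *: dyadic R r i - A (dyadic R k j)) < del].
  apply: filter_forall => j; apply: positive_step_dense => //.
    by case: IA => _ pA _; apply: pA; exact: dyadic_nonneg.
  by rewrite NA// invr_gt0.
have [r [hr rr0]] : exists r, (forall j : 'I_(2 ^ k), exists w : nat -> R,
    [/\ forall i, (i < 2 ^ r)%N -> 0 < w i, \sum_(i < 2 ^ r) w i = nrm (A (dyadic R k j)) &
        nrm (\sum_(i < 2 ^ r) (w i * 2 ^+ r)%:C *: dyadic R r i - A (dyadic R k j)) < del]) /\ (r0 <= r)%N.
  by have [n _ hn] := near_w; exists (maxn n r0); split; [apply: hn; exact: leq_maxl|exact: leq_maxr].
move: hr => /choice[w wP]; clear near_w.
have r0' := exp2_gt0 R r.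
have w0 j (i : 'I_(2 ^ r)) : 0 < w j i by have [h _ _] := wP j; exact: h.
have ws (j : 'I_(2 ^ k)) : \sum_(i < 2 ^ r) w j i = (2 ^+ k)^-1.
  by have [_ h _] := wP j; rewrite h NA.
pose s (j : 'I_(2 ^ k)) := \sum_(i < 2 ^ r) (w j i * 2 ^+ r)%:C *: dyadic R r i.
have sA (j : 'I_(2 ^ k)) : nrm (s j - A (dyadic R k j)) < del by have [_ _ h] := wP j.
(* The minimum is half of the sum minus the distance. The distance between the images of two dyadic
   vectors is still [2 / 2 ^+ k], and replacing them by [s j] and [s j'] loses at most [2 * del]. *)
have min_small (j j' : 'I_(2 ^ k)) : j != j' ->
    \sum_(i < 2 ^ r) Num.min (w j i) (w j' i) <= del.
  move=> jj'; under eq_bigr do rewrite minr_normE.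
  rewrite -mulr_suml sumrB big_split /= !ws ler_pdivrMr//.
  have h1 := nrm_dyadic_diff (ltn_ord j) (ltn_ord j') jj'.
  rewrite -(I1_nrm IA) (linB _ _ (I1_linear IA)) in h1.
  have h2 := nrm_tri (s j) (A (dyadic R k j)) (A (dyadic R k j')).
  have h3 := nrm_tri (s j') (s j) (A (dyadic R k j')).
  have h4 := nrm_step r (w j) (w j').
  have h5 := sA j; rewrite nrm_B in h5; have h6 := sA j'.
  have aux (u v x y z t c d : R) : 2 * c <= u -> u <= v + x -> x <= y + z -> y <= t ->
    v < d -> z < d -> c + c - t <= d * 2 by lra.
  exact: aux h1 h2 h3 h4 h5 h6.
pose W (i : 'I_(2 ^ r)) := \sum_j w j i.
have W0 i : 0 < W i.
  have z2 : (0 < 2 ^ k)%N by rewrite expn_gt0.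
  by rewrite /W (bigD1 (Ordinal z2))//= ltr_wpDr// sumr_ge0// => j _; exact: ltW.
have wW (j j' : 'I_(2 ^ k)) (i : 'I_(2 ^ r)) : j != j' -> w j i + w j' i <= W i.
  move=> jj'; rewrite /W (bigD1 j)//= (bigD1 j')/=; last by rewrite eq_sym.
  by rewrite addrA lerDl sumr_ge0// => l _; exact: ltW.
have Pex (j : 'I_(2 ^ k)) : exists P : 'I_(2 ^ r) -> R * R,
    [/\ okf P, disjf P, coverf P & forall i, (P i).2 = w j i * 2 ^+ k].
  apply: partition_exists => [i|]; first by rewrite mulr_gt0.
  by rewrite -mulr_suml ws mulVf// gt_eqF.
have Qex (i : 'I_(2 ^ r)) : exists Q : 'I_(2 ^ k) -> R * R,
    [/\ okf Q, disjf Q, coverf Q & forall j, (Q j).2 = w j i / W i].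
  apply: partition_exists => [j|]; first by rewrite divr_gt0.
  by rewrite -mulr_suml -/(W i) divff// gt_eqF.
move: Pex Qex => /choice[P hP] /choice[Q hQ].
have oDk := @okI_dyadic_itvs R k; have dDk := @disjf_dyadic_itvs R k; have cDk := @coverf_dyadic_itvs R k.
have oDr := @okI_dyadic_itvs R r; have dDr := @disjf_dyadic_itvs R r; have cDr := @coverf_dyadic_itvs R r.
have oP j : okf (P j) by case: (hP j).
have oQ i : okf (Q i) by case: (hQ i).
(* The piece [(i, j)] is the part of source interval [j] destined for target interval [i]: [q]
   places it in the source, with length [w j i], and [D] in the target, with the share [w j i / W i]
   of interval [i]. *)
pose D := subitvs (@dyadic_itvs R r) Q.
pose q (x : 'I_(2 ^ r) * 'I_(2 ^ k)) := subitvs (@dyadic_itvs R k) P (x.2, x.1).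
have oD : okf D by apply: okf_subitvs.
have dD : disjf D by apply: disjf_subitvs => // i; case: (hQ i).
have cD : coverf D by apply: coverf_subitvs => // i; case: (hQ i).
have oq : okf q by move=> x; exact: (okf_subitvs oDk oP).
have dq : disjf q.
  move=> [i j] [i' j'] h; apply: (disjf_subitvs oDk dDk oP).
    by move=> l; case: (hP l).
  by apply: contraNneq h => -[-> ->].
have cq : coverf q.
  have cP j : coverf (P j) by case: (hP j).
  have cDP : coverf (subitvs (@dyadic_itvs R k) P) by exact: coverf_subitvs.
  move=> x x01; have [[j i] h] := cDP x x01.
  by exists (i, j).
have lD (i : 'I_(2 ^ r)) (j : 'I_(2 ^ k)) : (D (i, j)).2 = w j i / W i * (2 ^+ r)^-1.
  by rewrite /D /subitvs /= /subitv /=; have [_ _ _ ->] := hQ i.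
have lq (i : 'I_(2 ^ r)) (j : 'I_(2 ^ k)) : (q (i, j)).2 = w j i.
  by rewrite /q /subitvs /= /subitv /=; have [_ _ _ ->] := hP j; rewrite mulfK// gt_eqF.
have bD (i : 'I_(2 ^ r)) : dyadic R r i = \sum_j itv_one (D (i, j)).
  rewrite /dyadic (@itv_one_split R _ (fun x : 'I_(2 ^ r) * 'I_(2 ^ k) => x.1 == i) D)//.
  - rewrite [LHS]big_mkcond /=.
    transitivity (\sum_i' \sum_j if i' == i then itv_one (D (i', j)) else 0).
      by rewrite pair_bigA /=; apply: eq_bigr => -[i' j].
    rewrite (bigD1 i)//= eqxx [X in _ + X]big1 ?addr0// => i' /negbTE ->.
    by rewrite big1.
  - exact: (oDr i).
  - by move=> [i' j] x /= /eqP ->; apply: inI_subitvW; [exact: (oDr i)|exact: oQ].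
  - move=> x xi; have x01 : 0 <= x < 1.
      have /and3P[h1 _ h3] := oDr i; have /andP[h2 h4] := xi.
      by rewrite (le_trans h1 h2) (lt_le_trans h4 h3).
    have [[i' j] h] := cD x x01; exists (i', j) => //=.
    apply/eqP; apply: contrapT => /eqP ii'.
    by apply: (dDr _ _ ii' x _ xi); exact: (inI_subitvW (oDr i') (oQ i' j) h).
(* The image of [dyadic k j] has height [W i * 2 ^+ r] on the pieces [D (i, j)] and vanishes
   elsewhere, whereas [s j] is spread evenly over each target interval. *)
have Ub (j : 'I_(2 ^ k)) : piecewise q D (dyadic R k j) =
    \sum_i \sum_j' ((if j' == j then W i else 0) * 2 ^+ r)%:C *: itv_one (D (i, j')).
  rewrite pair_bigA /=; apply: eq_bigr => -[i j'] _ /=.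
  case: eqVneq => [->|jj'].
    rewrite transport_itv_one//; last 2 first.
    - exact: (oDk j).
    - by move=> x; apply: inI_subitvW; [exact: (oDk j)|exact: oP].
    rewrite lD lq; congr (_%:C *: _).
    have w1 : w j i != 0 by rewrite gt_eqF.
    have W1 : W i != 0 by rewrite gt_eqF.
    have r1 : 2 ^+ r != 0 :> R by rewrite gt_eqF.
    by rewrite invfM invf_div invrK mulrA [w j i * _]mulrC mulfVK.
  rewrite mul0r scale0r transport_itv_one0//; first exact: (oDk j).
  move=> x h1 h2; apply: (dDk _ _ jj' x _ h2).
  exact: (inI_subitvW (oDk j') (oP j' i) h1).
have sE (j : 'I_(2 ^ k)) : s j = \sum_(i < 2 ^ r) \sum_(j' < 2 ^ k) (w j i * 2 ^+ r)%:C *: itv_one (D (i, j')).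
  by apply: eq_bigr => i _; rewrite bD scaler_sumr.
exists r, D, q; split => //.
  by move=> i; rewrite bD; apply: cellwise_sum => j _; exact: cellwise_itv_one.
move=> j; split.
  rewrite Ub; apply: cellwise_sum => i _; apply: cellwise_sum => j' _.
  by apply: cellwiseZ; exact: cellwise_itv_one.
apply: (le_lt_trans (nrm_tri (s j) _ _)).
suff h : nrm (piecewise q D (dyadic R k j) - s j) <= 2 * 2 ^+ k * del.
  have -> : eps = 2 * 2 ^+ k * del + del.
    by rewrite -[X in _ + X]mul1r -mulrDl /del mulrC mulfVK// gt_eqF.
  exact: ler_ltD.
rewrite Ub sE -sumrB; apply: (le_trans (nrm_sum _ _ _)).
apply: (@le_trans _ _ (\sum_(i < 2 ^ r) 2 * \sum_(j' < 2 ^ k | j' != j) Num.min (w j i) (w j' i))).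
  apply: ler_sum => i _; rewrite -sumrB; apply: (le_trans (nrm_sum _ _ _)).
  have tE j' : nrm (((if j' == j then W i else 0) * 2 ^+ r)%:C *: itv_one (D (i, j')) -
      (w j i * 2 ^+ r)%:C *: itv_one (D (i, j'))) =
      `|(if j' == j then W i else 0) - w j i| * (w j' i / W i).
    rewrite -scalerBl -rmorphB nrm_ZR nrm_itv_one// lD -mulrBl normrM (ger0_norm (ltW r0')).
    have r1 : 2 ^+ r != 0 :> R by rewrite gt_eqF.
    by rewrite -[LHS]mulrA; congr (_ * _); rewrite mulrC mulfVK.
  under eq_bigr do rewrite tE.
  (* Both functions have mass [w j i] on target interval [i], so the excess on piece [j] equals the
     deficit on the others; hence the factor 2. *)
  rewrite (bigD1 j)//= eqxx mulr_natl mulr2n.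
  have h1 : `|W i - w j i| * (w j i / W i) = \sum_(j' < 2 ^ k | j' != j) w j i * w j' i / W i.
    have -> : W i - w j i = \sum_(j' < 2 ^ k | j' != j) w j' i.
      by rewrite /W (bigD1 j)//= addrAC subrr add0r.
    rewrite ger0_norm; last by apply: sumr_ge0 => l _; exact: ltW.
    rewrite mulr_suml; apply: eq_bigr => j' _.
    by rewrite mulrA [w j' i * _]mulrC.
  have h2 : \sum_(j' < 2 ^ k | j' != j) w j i * w j' i / W i <= \sum_(j' < 2 ^ k | j' != j) Num.min (w j i) (w j' i).
    apply: ler_sum => j' jj'.
    have hW := wW j j' i; rewrite eq_sym jj' in hW; have {}hW := hW isT.
    exact: mul_div_le_min.
  rewrite h1; apply: lerD => //.
  rewrite (eq_bigr (fun j' => w j i * w j' i / W i))// => j' /negbTE ->.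
  by rewrite sub0r normrN ger0_norm ?ltW// mulrA.
rewrite -mulr_sumr exchange_big /= -mulrA; apply: ler_wpM2l => //.
apply: (@le_trans _ _ (\sum_(j' < 2 ^ k | j' != j) del)).
  by apply: ler_sum => j' jj'; apply: min_small; rewrite eq_sym.
apply: (@le_trans _ _ (\sum_(j' < 2 ^ k) del)).
  by rewrite [leRHS](bigID (fun j' => j' != j))/= lerDl sumr_ge0// => l _; exact: ltW.
by rewrite sumr_const card_ord -[leLHS]mulr_natr natrX mulrC.
Qed.

End piecewise_affine_approximation.

(** * Category argument *)

Section requirements.
Variable R : realType.
Local Notation L := (L1_01 R).
Local Notation mu := (@lebesgue_measure R).

(** Abstract substitute for multiplication by a function of modulus at most 1; commutation with
    bounded multiplications is the property used in the weak limit. *)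
Definition multiplier (chi : L -> L) := [/\ linear chi, forall f, nrm (chi f) <= nrm f &
  forall g f, Linfty_fun mu (@I01 R) g -> Mul g (chi f) = chi (Mul g f)].

(** Positive rational weights coded by lists of integers, hence countably many. The successors keep
    the weights positive, and the default 0 gives missing entries the numerator 1. *)
Definition weight (p : nat) (s : seq nat) (n : 'I_p.+1) : R :=
  (nth 0%N s n).+1%:R / \sum_(k < p.+1) (nth 0%N s k).+1%:R.

(* The conditions are satisfied with zero error by towers, and strict inequalities
   on finitely many vectors are stable in the strong topology.  The last one
   yields a dense range. *)
Definition requirement (p : nat) (s : seq nat) (J : nat) (T : L -> L) :=
  (exists m, exists chi : 'I_p.+1 -> L -> L,
    [/\ (J < m)%N, forall n, multiplier (chi n),
       forall k j, (k <= J)%N -> (j < 2 ^ k)%N ->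
         nrm (iter m T (dyadic R k j) - \sum_n chi n (iter n T (dyadic R k j))) < J.+1%:R^-1 &
       forall k j n, (k <= J)%N -> (j < 2 ^ k)%N ->
         Tot (chi n (dyadic R k j)) = (weight s n)%:C * Tot (dyadic R k j)]) /\
  forall k j, (k <= J)%N -> (j < 2 ^ k)%N -> exists x, nrm (T x - dyadic R k j) < J.+1%:R^-1.

Lemma weight_gt0 p s (n : 'I_p.+1) : 0 < weight s n.
Proof.
rewrite divr_gt0 ?ltr0n//; apply: (@lt_le_trans _ _ (nth 0%N s n).+1%:R); first by rewrite ltr0n.
by rewrite (bigD1 n)//= lerDl sumr_ge0.
Qed.

Lemma weight_sum p s : \sum_(n < p.+1) weight s n = 1.
Proof.
rewrite -mulr_suml divff// gt_eqF// big_ord_recl ltr_wpDr ?ltr0n//.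
by apply: sumr_ge0 => i _.
Qed.

Lemma steps_near (F : seq L) (e : R) : 0 < e -> exists k, exists c : L -> nat -> R[i],
  forall f, f \in F -> nrm (f - \sum_(i < 2 ^ k) c f i *: dyadic R k i) < e.
Proof.
move=> e0.
have : \forall k \near \oo, forall f, f \in F -> exists c : nat -> R[i],
    nrm (f - \sum_(i < 2 ^ k) c i *: dyadic R k i) < e.
  elim: F => [|f F ih]; first by apply: nearW.
  apply: filterS2 ih (step_dense f e0) => k h1 h2 g.
  by rewrite inE => /orP[/eqP ->//|]; exact: h1.
move=> [k _ /(_ _ (leqnn k)) hk]; exists k.
have /choice[c hc] : forall f, exists c : nat -> R[i], f \in F ->
    nrm (f - \sum_(i < 2 ^ k) c i *: dyadic R k i) < e.
  move=> f; have [fF|fF] := boolP (f \in F); last by exists (fun=> 0).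
  by have [c hc] := hk f fF; exists c.
by exists c.
Qed.

(** Step functions of a single level approximate all of [F], and contractions do not enlarge the
    error, so closeness on the dyadic vectors of that level suffices. *)
Lemma near_op_basis (A : L -> L) (F : seq L) (e : R) : contraction A -> 0 < e ->
  exists k, exists2 d, 0 < d & forall C, contraction C ->
    (forall j, (j < 2 ^ k)%N -> nrm (C (dyadic R k j) - A (dyadic R k j)) < d) -> near_op F e A C.
Proof.
move=> cA e0; have e40 : 0 < e / 4 by rewrite divr_gt0.
have [k [c hc]] := steps_near F e40.
pose B := \sum_(f <- F) \sum_(i < 2 ^ k) normc (c f i).
have B0 : 0 <= B by apply: sumr_ge0 => f _; apply: sumr_ge0 => i _; exact: normc_ge0.
exists k, (e / 4 / (B + 1)); first by rewrite divr_gt0// ltr_wpDl.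
move=> C cC hC f fF.
have [qD qZ q2] := diff_seminorm cC cA.
set d := e / 4 / (B + 1) in hC.
have Bd : B * d <= e / 4.
  have d0 : 0 <= d by rewrite /d divr_ge0 ?ltW// ltr_wpDl.
  have <- : (B + 1) * d = e / 4 by rewrite /d mulrC mulfVK// gt_eqF// ltr_wpDl.
  by rewrite ler_wpM2r// lerDl.
have q0 : nrm (C 0 - A 0) <= 0 by have := qZ 0 0; rewrite scale0r normc0 mul0r.
set S := \sum_(i < 2 ^ k) c f i *: dyadic R k i.
have qS : nrm (C S - A S) <= \sum_(i < 2 ^ k) normc (c f i) * d.
  rewrite /S; elim/big_rec2: _ => [//|i y x _ h].
  apply: (le_trans (qD _ _)); apply: lerD => //.
  apply: (le_trans (qZ _ _)); rewrite ler_wpM2l ?normc_ge0//.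
  exact/ltW/hC.
have qS' : nrm (C S - A S) <= e / 4.
  apply: (le_trans qS); apply: le_trans Bd; rewrite -mulr_suml ler_wpM2r//.
    by rewrite /d divr_ge0 ?ltW// ltr_wpDl.
  rewrite /B (perm_big _ (perm_to_rem fF)) big_cons lerDl.
  by apply: sumr_ge0 => g _; apply: sumr_ge0 => i _; exact: normc_ge0.
have := qD (f - S) S; rewrite subrK.
have := q2 (f - S); have := hc f fF; rewrite -/S.
have aux (x y z u v : R) : x < v / 4 -> y <= 2 * x -> u <= v / 4 -> z <= y + u -> 0 < v -> z < v by lra.
by move=> h1 h2 h3; exact: aux h1 h2 qS' h3 e0.
Qed.

(** Telescoping along the orbit of [C]: the vectors tested do not depend on [T], so they can be
    listed in advance. *)
Lemma iter_near (C T : L -> L) (f : L) (d : R) n : contraction T ->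
  (forall l, (l < n)%N -> nrm (T (iter l C f) - C (iter l C f)) <= d) ->
  nrm (iter n T f - iter n C f) <= n%:R * d.
Proof.
move=> [lT cT]; elim: n => [|n ih] h; first by rewrite subrr nrm_0 mul0r.
have {}ih := ih (fun l ln => h l (ltnW ln)).
apply: (le_trans (nrm_tri (T (iter n C f)) _ _)) => /=.
rewrite -(linB _ _ lT) -natr1 mulrDl mul1r; apply: lerD; last exact: h.
exact: le_trans (cT _) ih.
Qed.

Definition basis_upto J : seq L := flatten [seq dyadics R k | k <- iota 0 J.+1].

Lemma mem_basis_upto J k j : (k <= J)%N -> (j < 2 ^ k)%N -> dyadic R k j \in basis_upto J.
Proof.
move=> kJ jk; apply/flattenP; exists (dyadics R k); last exact: mem_dyadics.
by apply: map_f; rewrite mem_iota.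
Qed.

(** The tower operator over the piecewise affine map satisfies the conditions exactly; [F'] and [e']
    let them persist, with a small error, for all nearby isometries. *)
Lemma requirement_dense p s J (A : L -> L) (F : seq L) (e : R) : I_1 R A -> 0 < e ->
  exists C F' e', [/\ I_1 R C, near_op F e A C, 0 < e' &
    forall T, I_1 R T -> near_op F' e' C T -> requirement p s J T].
Proof.
move=> IA e0.
have [k [d d0 hd]] := near_op_basis F (I1_contraction IA) e0.
have d20 : 0 < d / 2 by rewrite divr_gt0.
(* Level at least [J], so that the dyadic vectors of the requirement are constant on the cells of
   [D]. *)
have [r [D [q [kr [oD dD cD] [oq dq cq] bD Ub]]]] := piecewise_affine_approx k (maxn k J) IA d20.
have UV : cancel (piecewise q D) (piecewise D q) by move=> f; rewrite piecewise_comp//; exact: transport_cover.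
have VU : cancel (piecewise D q) (piecewise q D) by move=> f; rewrite piecewise_comp//; exact: transport_cover.
have mU : markov (piecewise q D) by exact: piecewise_markov.
have mV : markov (piecewise D q) by exact: piecewise_markov.
(* Large enough for [2 / (m - p) < d / 2], and beyond [J] so that the exponents tend to infinity
   with the stage. *)
pose m := (p + J + (Num.truncn (4 / d)).+1)%N.
have pm : (p < m)%N by rewrite /m; lia.
have Jm : (J < m)%N by rewrite /m; lia.
have md : 2 / (m - p)%:R < d / 2.
  have mp0 : 0 < (m - p)%:R :> R by rewrite ltr0n subn_gt0.
  rewrite ltr_pdivrMr// mulrAC ltr_pdivlMr// -ltr_pdivrMl// mulrC -natrM.
  have h4 : 4 / d < (Num.truncn (4 / d)).+1%:R.
    have /truncn_itv/andP[_ //] : 0 <= 4 / d by rewrite divr_ge0// ltW.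
  by apply: (lt_le_trans h4); rewrite ler_nat /m; lia.
have cell_b l j : (l <= r)%N -> (j < 2 ^ l)%N -> cellwise D (dyadic R l j).
  move=> lr jl; rewrite (dyadic_refine R lr jl); apply: cellwise_sum => i _; exact: bD.
have kr' : (k <= r)%N by apply: leq_trans kr; exact: leq_maxl.
have Jr : (J <= r)%N by apply: leq_trans kr; exact: leq_maxr.
have [C [chi [UC Cm mchi chiT CU]]] :=
  tower_exists oD dD cD mU mV UV VU pm (@weight_gt0 p s) (weight_sum p s).
have IC : I_1 R C by case: UC.
have [lC cC] := I1_contraction IC.
have /choice[Ci CiK] : forall f, exists x, C x = f.
  by move=> f; case: UC => _ /(_ f Logic.I)[x _ <-]; exists x.
(* Iterates up to the [m]-th drift by at most [m * e'], and [p + 2] of them are compared. *)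
pose e' := J.+1%:R^-1 / ((p.+2 * m).+1)%:R : R.
have J0 : 0 < J.+1%:R^-1 :> R by rewrite invr_gt0 ltr0n.
have e'0 : 0 < e' by rewrite divr_gt0// ltr0n.
(* The orbits under [C] serve the iterates; the preimages under [C] become approximate preimages
   under [T]. *)
pose F' := [seq iter l C f | f <- basis_upto J, l <- iota 0 m] ++ [seq Ci f | f <- basis_upto J].
exists C, F', e'; split => //.
  apply: hd => // j jk; have [cUb hUb] := Ub (Ordinal jk).
  apply: (le_lt_trans (nrm_tri (piecewise q D (dyadic R k j)) _ _)).
  have h1 := CU _ (cell_b k j kr' jk) cUb.
  have h2 : 2 / (m - p)%:R * nrm (dyadic R k j) <= 2 / (m - p)%:R.
    rewrite ler_piMr ?divr_ge0// nrm_dyadic// invf_le1 ?exp2_gt0//.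
    by rewrite exprn_ege1// ler1n.
  have aux (x y z u v : R) : x <= y -> y <= z -> z < v / 2 -> u < v / 2 -> x + u < v by lra.
  exact: aux h1 h2 md hUb.
move=> T IT hT; have [lT cT] := I1_contraction IT.
have e'J : e' <= J.+1%:R^-1.
  by rewrite ler_pdivrMr ?ltr0n// ler_pMr// ler1n.
split; last first.
  move=> l j lJ jl; exists (Ci (dyadic R l j)); rewrite -{2}(CiK (dyadic R l j)).
  apply: (lt_le_trans (hT _ _) e'J); rewrite mem_cat; apply/orP; right.
  by apply: map_f; exact: mem_basis_upto.
exists m, chi; split => //.
  move=> l j lJ jl.
  have nb n : (n <= m)%N -> nrm (iter n T (dyadic R l j) - iter n C (dyadic R l j)) <= m%:R * e'.
    move=> nm; apply: (@le_trans _ _ (n%:R * e')).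
      apply: iter_near => // i im; apply/ltW/hT; rewrite mem_cat; apply/orP; left.
      apply: allpairs_f; first exact: mem_basis_upto.
      by rewrite mem_iota /= add0n (leq_trans im nm).
    by rewrite ler_wpM2r ?ler_nat// ltW.
  apply: (le_lt_trans (nrm_tri (iter m C (dyadic R l j)) _ _)).
  have h1 : nrm (iter m C (dyadic R l j) - \sum_n chi n (iter n T (dyadic R l j))) <= p.+1%:R * (m%:R * e').
    rewrite Cm -sumrB; apply: (le_trans (nrm_sum _ _ _)).
    have -> : p.+1%:R * (m%:R * e') = \sum_(n < p.+1) m%:R * e'.
      by rewrite sumr_const card_ord mulr_natl.
    apply: ler_sum => n _; have [lx Nx _] := mchi n.
    rewrite -(linB _ _ lx); apply: (le_trans (Nx _)); rewrite nrm_B; apply: nb.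
    by apply: ltnW; apply: leq_trans pm; exact: ltn_ord.
  apply: (@le_lt_trans _ _ (m%:R * e' + p.+1%:R * (m%:R * e'))).
    by apply: lerD => //; exact: nb.
  have -> : m%:R * e' + p.+1%:R * (m%:R * e') = (p.+2 * m)%:R * e'.
    by rewrite natrM -(natr1 p.+1); ring.
  rewrite /e' mulrCA gtr_pMr// ltr_pdivrMr ?ltr0n// mul1r ltr_nat//.
by move=> l j n lJ jl; apply: chiT; apply: cell_b => //; exact: leq_trans Jr.
Qed.

End requirements.

(** * Surjectivity and weak limits *)

Section weak_limits.
Variable R : realType.
Local Notation L := (L1_01 R).
Local Notation mu := (@lebesgue_measure R).

Lemma near_invS (e : R) : 0 < e -> \forall J \near \oo, J.+1%:R^-1 < e.
Proof.
move=> e0; have := @cvg_harmonic R => /cvgrPdist_lt/(_ e e0).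
by apply: filterS => J; rewrite /harmonic /= sub0r normrN ger0_norm// invr_ge0.
Qed.

(** The dyadic vectors span a dense subspace, and the range of an isometry is closed by
    completeness. *)
Lemma dense_range_surj (T : L -> L) : I_1 R T ->
  (forall k j, (j < 2 ^ k)%N -> forall e, 0 < e -> exists x, nrm (T x - dyadic R k j) < e) ->
  forall f, exists x, T x = f.
Proof.
move=> IT hb; have lT := I1_linear IT.
pose app f := forall e, 0 < e -> exists x, nrm (T x - f) < e.
have appD f g : app f -> app g -> app (f + g).
  move=> hf hg e e0; have e20 : 0 < e / 2 by rewrite divr_gt0.
  have [x hx] := hf _ e20; have [y hy] := hg _ e20; exists (x + y).
  rewrite (linD _ _ lT) opprD addrACA [e]splitr.
  by apply: (le_lt_trans (nrm_D _ _)); exact: ltrD.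
have appZ c f : app f -> app (c *: f).
  move=> hf e e0; have c0 : 0 < normc c + 1 by rewrite ltr_wpDl ?normc_ge0.
  have ec : 0 < e / (normc c + 1) by rewrite divr_gt0.
  have [x hx] := hf _ ec; exists (c *: x).
  rewrite (linZ _ _ lT) -scalerBr nrm_Z.
  apply: (@le_lt_trans _ _ ((normc c + 1) * nrm (T x - f))).
    by rewrite ler_wpM2r ?nrm_ge0// lerDl.
  by rewrite mulrC -ltr_pdivlMr.
have app0 : app 0 by move=> e e0; exists 0; rewrite (lin0 lT) subrr nrm_0.
have appT f : app f.
  move=> e e0; have e20 : 0 < e / 2 by rewrite divr_gt0.
  have [k [c fc]] := filter_ex (step_dense f e20).
  set S := \sum_(i < 2 ^ k) _ in fc.
  have appS : app S.
    by rewrite /S; elim/big_rec: _ => [//|i g _ hg]; apply: appD => //; apply: appZ; exact: hb.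
  have [x hx] := appS _ e20; exists x.
  apply: (le_lt_trans (nrm_tri S _ _)); rewrite [nrm (S - f)]nrm_B [e]splitr.
  exact: ltrD.
move=> f.
have /choice[x hx] : forall n, exists x, nrm (T x - f) < n.+1%:R^-1.
  by move=> n; apply: appT; rewrite invr_gt0 ltr0n.
have [v hv] : exists v, forall e, 0 < e -> exists n0, forall n, (n0 <= n)%N -> nrm (x n - v) < e.
  apply: L1_complete => e e0; have e20 : 0 < e / 2 by rewrite divr_gt0.
  have [n0 _ hn] := near_invS e20; exists n0 => m n mn nn.
  rewrite -(I1_nrm IT) (linB _ _ lT); apply: (le_lt_trans (nrm_tri f _ _)).
  rewrite [nrm (f - _)]nrm_B [e]splitr.
  by apply: ltrD; [exact: lt_trans (hx m) (hn _ mn)|exact: lt_trans (hx n) (hn _ nn)].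
exists v; apply/eqP; rewrite -subr_eq0; apply/eqP; apply: nrm_le0 => e e0.
have e20 : 0 < e / 2 by rewrite divr_gt0.
have [n0 _ hn] := near_invS e20; have [n1 h1] := hv _ e20.
pose n := maxn n0 n1.
apply: (le_trans (nrm_tri (T (x n)) _ _)); rewrite [e]splitr; apply: lerD.
  by rewrite -(linB _ _ lT) (I1_nrm IT) nrm_B; apply/ltW/h1; exact: leq_maxr.
by apply/ltW; apply: lt_trans (hx n) (hn _ _); exact: leq_maxl.
Qed.

(** The integer parts of the [Q * a n], each plus one, sum to between [Q] and [Q + p + 1];
    normalising them leaves an error of at most [(p + 1) / Q]. *)
Lemma weight_dense (p : nat) (a : 'I_p.+1 -> R) (e : R) :
  (forall n, 0 <= a n <= 1) -> \sum_n a n = 1 -> 0 < e ->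
  exists s : seq nat, forall n, `|weight R s n - a n| <= e.
Proof.
move=> a01 a1 e0.
have [Q0 Q1] : exists Q : nat, p.+1%:R / e <= Q.+1%:R.
  have pe : 0 <= p.+1%:R / e by rewrite divr_ge0// ltW.
  exists (Num.truncn (p.+1%:R / e)).
  by have /andP[_ /ltW] := truncn_itv pe.
pose Q : R := Q0.+1%:R; have Qp : 0 < Q by rewrite ltr0n.
have pQ : p.+1%:R / Q <= e by rewrite ler_pdivrMr// mulrC -ler_pdivrMr.
pose s := mkseq (fun i => Num.truncn (Q * a (inord i))) p.+1.
have sE (n : 'I_p.+1) : nth 0%N s n = Num.truncn (Q * a n) by rewrite nth_mkseq// inord_val.
have a0 n : 0 <= a n by case/andP: (a01 n).
have s1 (n : 'I_p.+1) : Q * a n <= (nth 0%N s n).+1%:R <= Q * a n + 1.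
  have /truncn_itv/andP[h1 h2] : 0 <= Q * a n by rewrite mulr_ge0// ltW.
  by rewrite sE (ltW h2) -natr1 lerD2r.
pose S : R := \sum_(k < p.+1) (nth 0%N s k).+1%:R.
have S1 : Q <= S.
  rewrite -[Q]mulr1 -a1 mulr_sumr; apply: ler_sum => n _; by case/andP: (s1 n).
have S2 : S <= Q + p.+1%:R.
  have -> : Q + p.+1%:R = \sum_(n < p.+1) (Q * a n + 1).
    by rewrite big_split /= -mulr_sumr a1 mulr1 sumr_const card_ord.
  by apply: ler_sum => n _; case/andP: (s1 n).
have S0 : 0 < S by exact: lt_le_trans S1.
exists s => n; have /andP[h1 h2] := s1 n; have /andP[u0 u1] := a01 n.
rewrite /weight -/S; set y := (nth 0%N s n).+1%:R in h1 h2 *.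
have p1 : (1 : R) <= p.+1%:R by rewrite ler1n.
apply: le_trans pQ.
have -> : y / S - a n = (y - a n * S) / S by field; rewrite gt_eqF.
rewrite normrM [`|S^-1|]gtr0_norm ?invr_gt0// ler_pdivrMr//.
have h3 : `|y - a n * S| <= p.+1%:R.
  rewrite ler_norml; apply/andP; split; nra.
apply: (le_trans h3); rewrite -mulrA -ler_pdivrMl ?ltr0n// mulVf ?pnatr_eq0//.
by rewrite mulrC ler_pdivlMr// mul1r.
Qed.

Lemma contraction_continuous (A : L -> L) : contraction A -> continuous A.
Proof.
move=> [lA cA] f.
apply/(@cvgrPdist_lt _ _ _ (nbhs f) (nbhs_filter f)) => e e0.
near=> g.
rewrite -(linB _ _ lA); apply: (@le_lt_trans _ _ `|f - g|); first by rewrite !norm_nrm lecR.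
by near: g; exact: cvgr_dist_lt.
Unshelve. all: by end_near.
Qed.

Lemma convex_comb_contraction (p : nat) (a : 'I_p.+1 -> R) (T : L -> L) : contraction T ->
  (forall n, 0 <= a n) -> \sum_n a n = 1 ->
  contraction (fun f => \sum_(n < p.+1) (a n)%:C *: iter n T f).
Proof.
move=> cT a0 a1; split=> [c f g|f].
  rewrite scaler_sumr -big_split /=; apply: eq_bigr => n _.
  have [lTn _] := iter_contraction n cT.
  by rewrite lTn scalerDr !scalerA mulrC.
apply: (le_trans (nrm_sum _ _ _)); rewrite -[nrm f]mul1r -a1 mulr_suml.
apply: ler_sum => n _; rewrite nrm_ZR ger0_norm//; apply: ler_wpM2l => //.
by have [_ h] := iter_contraction n cT.
Qed.

(** Up to a small error, the integral of [g] against [T^m f] is the sum of the integrals of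
    [chi_n (g T^n f)], as [chi_n] commutes with multiplication by [g]; each of these tends to [a_n]
    times the integral of [g T^n f]. *)
Lemma requirement_weak_limit (T : L -> L) (p : nat) (a : 'I_p.+1 -> R) : I_1 R T ->
  (forall s J, requirement p s J T) ->
  (forall n, 0 <= a n <= 1) -> \sum_n a n = 1 ->
  weak_limit_semigroup T (fun f => \sum_(n < p.+1) (a n)%:C *: iter n T f).
Proof.
move=> IT hT a01 a1; have cT := I1_contraction IT; have [lT nT] := cT.
have a0 n : 0 <= a n by case/andP: (a01 n).
split.
  have cS := convex_comb_contraction cT a0 a1.
  by split; [case: cS|exact: contraction_continuous].
(* The weights of the requirement are traded for [a], with an error vanishing as [J] grows. *)
have /choice[m /choice[chi hmc]] : forall J : nat, exists m, exists chi : 'I_p.+1 -> L -> L,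
    [/\ (J < m)%N, forall n, multiplier (chi n),
       forall k j, (k <= J)%N -> (j < 2 ^ k)%N ->
         nrm (iter m T (dyadic R k j) - \sum_n chi n (iter n T (dyadic R k j))) < J.+1%:R^-1 &
       forall k j n, (k <= J)%N -> (j < 2 ^ k)%N ->
         normc (Tot (chi n (dyadic R k j)) - (a n)%:C * Tot (dyadic R k j)) <= J.+1%:R^-1].
  move=> J; have J0 : 0 < J.+1%:R^-1 :> R by rewrite invr_gt0 ltr0n.
  have [s hs] := weight_dense a01 a1 J0.
  have [[m [chi [h1 h2 h3 h4]]] _] := hT s J; exists m, chi; split => // k j n kJ jk.
  rewrite h4// -mulrBl -rmorphB normcM normc_real Tot_dyadic// normc_real.
  apply: le_trans (hs n); rewrite ler_piMr// ger0_norm ?invr_ge0 ?(ltW (exp2_gt0 _ _))//.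
  by rewrite invf_le1 ?exp2_gt0// exprn_ege1// ler1n.
have mJ J : (J < m J)%N by case: (hmc J).
have mchi J n : multiplier (chi J n) by case: (hmc J).
have c1 f e : 0 < e -> \forall J \near \oo,
    nrm (iter (m J) T f - \sum_n chi J n (iter n T f)) < e.
  apply: (@seminorm_small R nat \oo _ (fun=> True)
    (fun J f => nrm (iter (m J) T f - \sum_n chi J n (iter n T f))) (1 + p.+1%:R)).
  - exact: nearT.
  - move=> J g h _; have lTm := iter_linear (m J) lT.
    rewrite (linD _ _ lTm).
    have -> : \sum_n chi J n (iter n T (g + h)) =
        \sum_n chi J n (iter n T g) + \sum_n chi J n (iter n T h).
      rewrite -big_split /=; apply: eq_bigr => n _; have [lx _ _] := mchi J n.
      by rewrite (linD _ _ (iter_linear n lT)) (linD _ _ lx).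
    by rewrite opprD addrACA nrm_D.
  - move=> J c g _; have lTm := iter_linear (m J) lT.
    rewrite (linZ _ _ lTm).
    have -> : \sum_n chi J n (iter n T (c *: g)) = c *: \sum_n chi J n (iter n T g).
      rewrite scaler_sumr; apply: eq_bigr => n _; have [lx _ _] := mchi J n.
      by rewrite (linZ _ _ (iter_linear n lT)) (linZ _ _ lx).
    by rewrite -scalerBr nrm_Z.
  - move=> J g _; apply: (le_trans (nrm_D _ _)); rewrite nrm_N mulrDl mul1r; apply: lerD.
      by have [_ h] := iter_contraction (m J) cT.
    apply: (le_trans (nrm_sum _ _ _)).
    have -> : p.+1%:R * nrm g = \sum_(n < p.+1) nrm g by rewrite sumr_const card_ord mulr_natl.
    apply: ler_sum => n _; have [_ h _] := mchi J n; apply: (le_trans (h _)).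
    by have [_ {}h] := iter_contraction n cT.
  - move=> k i ik e0 e00; have hk := nbhs_infty_ge k.
    apply: filterS2 hk (near_invS e00) => J kJ; apply: lt_trans.
    by have [_ _ h _] := hmc J; exact: h.
have c2 n u e : 0 < e -> \forall J \near \oo,
    normc (Tot (chi J n u) - (a n)%:C * Tot u) < e.
  apply: (@seminorm_small R nat \oo _ (fun=> True)
    (fun J u => normc (Tot (chi J n u) - (a n)%:C * Tot u)) 4).
  - exact: nearT.
  - move=> J g h _; have [lx _ _] := mchi J n.
    by rewrite (linD _ _ lx) !TotD mulrDr opprD addrACA normc_leD.
  - move=> J c g _; have [lx _ _] := mchi J n.
    by rewrite (linZ _ _ lx) !TotZ mulrCA -mulrBr normcM.
  - move=> J g _; have [_ Nx _] := mchi J n.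
    apply: (le_trans (normc_leD _ _)).
    have -> : normc (- ((a n)%:C * Tot g)) = a n * normc (Tot g).
      have nN (z : R[i]) : normc (- z) = normc z by case: z => z1 z2 /=; rewrite !sqrrN.
      by rewrite nN normcM normc_real ger0_norm.
    have := normc_Tot_le (chi J n g); have := normc_Tot_le g; have := Nx g.
    have := normc_ge0 (Tot g); have /andP[_] := a01 n; have := nrm_ge0 g; move: (a0 n).
    clear; move: (a n) (normc _) (normc _) (nrm _) (nrm _) => x y z u v; nra.
  - move=> k i ik e0 e00; have hk := nbhs_infty_ge k.
    apply: filterS2 hk (near_invS e00) => J kJ; apply: le_lt_trans.
    by have [_ _ _ h] := hmc J; exact: h.
(* Each exponent becomes the next stage; as [J < m J], the exponents increase strictly. *)
pose Jk := fix Jk k := if k is k'.+1 then m (Jk k') else 0%N.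
have Jge k : (k <= Jk k)%N by elim: k => //= k ih; exact: leq_ltn_trans ih (mJ _).
exists (fun k => m (Jk k)).
  by apply: homo_ltn => [x y z|k]; [exact: ltn_trans|exact: (mJ (m (Jk k)))].
move=> f g gi; apply/cvgrPdist_lt => e e0.
have [r r0 ->] : exists2 r : R, 0 < r & e = r%:C.
  move: e0; case: e => r i; rewrite ltcE /= => /andP[/eqP -> r0].
  by exists r.
have [B B0 hB] := nrm_Mul gi.
have rB : 0 < r / (4 * (B + 1)) by rewrite divr_gt0// mulr_gt0// ltr_wpDl.
have rp : 0 < r / (4 * p.+1%:R) by rewrite divr_gt0// mulr_gt0// ltr0n.
have hn1 := c1 f _ rB.
have hn2 : \forall J \near \oo, forall n : 'I_p.+1,
    normc (Tot (chi J n (Mul g (iter n T f))) - (a n)%:C * Tot (Mul g (iter n T f))) < r / (4 * p.+1%:R).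
  by apply: filter_forall => n; exact: c2.
have [n0 _ hn0] := filterI hn1 hn2.
exists n0 => // k /= n0k; have [h1 h2] := hn0 (Jk k) (leq_trans n0k (Jge k)).
set J := Jk k in h1 h2 *.
rewrite !pairingE// distrC -Defs.normcE ltcR.
have MulD' u v : Mul g (u - v) = Mul g u - Mul g v.
  by rewrite -scaleN1r MulD// MulZ// scaleN1r.
have Msum (I : Type) (s : seq I) (F : I -> L) : Mul g (\sum_(i <- s) F i) = \sum_(i <- s) Mul g (F i).
  elim/big_rec2: _ => [|i y x _ <-]; last by rewrite MulD.
  by have := MulZ 0 0 gi; rewrite !scale0r.
pose X := \sum_n chi J n (iter n T f).
(* The first term is small in norm by [c1], the second by the equidistribution [c2]. *)
have -> : Tot (Mul g (iter (m J) T f)) - Tot (Mul g (\sum_(n < p.+1) (a n)%:C *: iter n T f)) =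
    Tot (Mul g (iter (m J) T f - X)) +
    \sum_n (Tot (chi J n (Mul g (iter n T f))) - (a n)%:C * Tot (Mul g (iter n T f))).
  rewrite MulD' TotB sumrB -addrA; congr (_ + _).
  have -> : Tot (Mul g X) = \sum_n Tot (chi J n (Mul g (iter n T f))).
    rewrite Msum Tot_sum; apply: eq_bigr => n _.
    by have [_ _ ->] := mchi J n.
  rewrite addKr Msum Tot_sum; congr (- _); apply: eq_bigr => n _.
  by rewrite MulZ// TotZ.
apply: (le_lt_trans (normc_leD _ _)).
have k1 : normc (Tot (Mul g (iter (m J) T f - X))) <= r / 2.
  apply: (le_trans (normc_Tot_le _)).
  have := hB (iter (m J) T f - X); move: h1; rewrite -/X.
  rewrite ltr_pdivlMr ?mulr_gt0 ?ltr_wpDl//.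
  have := nrm_ge0 (iter (m J) T f - X).
  clear -B0; move: (nrm _) (nrm _) => x y; nra.
have k2 : normc (\sum_n (Tot (chi J n (Mul g (iter n T f))) - (a n)%:C * Tot (Mul g (iter n T f)))) <= r / 4.
  have ns (I : Type) (s : seq I) (F : I -> R[i]) : normc (\sum_(i <- s) F i) <= \sum_(i <- s) normc (F i).
    elim/big_rec2: _ => [|i y x _ h]; first by rewrite normc0.
    by apply: (le_trans (normc_leD _ _)); rewrite lerD2l.
  apply: (le_trans (ns _ _ _)).
  have -> : r / 4 = \sum_(n < p.+1) r / (4 * p.+1%:R).
    rewrite sumr_const card_ord -[RHS]mulr_natr.
    have : p.+1%:R != 0 :> R by rewrite pnatr_eq0.
    by move: p.+1%:R => P P0; field.
  by apply: ler_sum => n _; exact/ltW/h2.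
have aux (x y : R) : x <= r / 2 -> y <= r / 4 -> 0 < r -> x + y < r by lra.
exact: aux.
Qed.

End weak_limits.

(** * Basic neighbourhoods of the strong operator topology *)

Section strong_topology.
Variable R : realType.
Local Notation L := (L1_01 R).

Definition sot_basic (A : L -> L) : set_system (L -> L) :=
  [set U | exists F e, 0 < e /\ forall C, near_op F e A C -> U C].

Lemma sot_basic_filter A : Filter (sot_basic A).
Proof.
split.
- by exists [::], 1.
- move=> U V [F [e [e0 hU]]] [F' [e' [e'0 hV]]].
  exists (F ++ F'), (Num.min e e'); split; first by rewrite lt_min e0.
  move=> C hC; split; [apply: hU|apply: hV] => f fF.
    by have := hC f; rewrite mem_cat fF lt_min => /(_ isT) /andP[].
  by have := hC f; rewrite mem_cat fF orbT lt_min => /(_ isT) /andP[].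
- by move=> U V UV [F [e [e0 h]]]; exists F, e; split => // C /h /UV.
Qed.

(** The filter of basic neighbourhoods converges pointwise to [A], hence refines the neighbourhood
    filter of the product topology. *)
Lemma sot_nbhs (A : {ptws L -> L}) (O : set {ptws L -> L}) : open O -> O A ->
  exists F e, 0 < e /\ forall C, near_op F e A C -> O C.
Proof.
move=> oO OA.
have FF := sot_basic_filter A.
have : {ptws, sot_basic A --> (A : L -> L)}.
  apply/(pointwise_cvgP _ FF) => f.
  apply/(@cvgrPdist_lt _ _ _ (sot_basic A) FF) => e e0.
  have [r r0 ->] : exists2 r : R, 0 < r & e = r%:C.
    move: e0; case: e => r i; rewrite ltcE /= => /andP[/eqP -> r0].
    by exists r.
  exists [:: f], r; split => // C hC.
  have := hC f; rewrite mem_head => /(_ isT).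
  by rewrite nrm_B norm_nrm ltcR.
move=> /(_ O); apply.
by apply: open_nbhs_nbhs.
Qed.

End strong_topology.


(** * Density in both spaces of isometries *)

Unset Implicit Arguments.
Set Strict Implicit.

Theorem proposition8p22 (R : realType) :
  let G : set {ptws L1_01 R -> L1_01 R} :=
    [set A | U_1 R A /\
      forall (N : nat) (a : 'I_N.+1 -> R),
        (forall n, 0 <= a n <= 1) -> \sum_(n < N.+1) a n = 1 ->
        weak_limit_semigroup A
          (fun f => \sum_(n < N.+1) (a n)%:C *: iter n A f)] in
  dense (set_val @^-1` G : set (I_1 R)) /\
  dense (set_val @^-1` G : set (U_1 R)).
Proof.
move=> G.
(* [T] lies in [U_1] even for a non-invertible [A], and the open sets of both subspaces are traces
   of open sets [O], so this settles both densities. *)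
have main (A : {ptws L1_01 R -> L1_01 R}) (O : set {ptws L1_01 R -> L1_01 R}) :
    open O -> O A -> I_1 R A -> exists T, O T /\ G T.
  move=> oO OA IA; have [F [e [e0 hO]]] := sot_nbhs oO OA.
  (* The triples [(p, s, J)] are countable; indices that code no triple impose no condition. *)
  pose P (i : nat) (T : L1_01 R -> L1_01 R) :=
    if unpickle i is Some x then requirement x.1.1 x.1.2 x.2 T else True.
  have [|T [IT AT PT]] := I1_baire (P := P) F IA e0.
    move=> i A' F' e' IA' e'0; rewrite /P; case: unpickle => [[[p s] J]|].
      exact: requirement_dense.
    exists A', F', e'; split => // f _; by rewrite subrr nrm_0.
  have hT p s J : requirement p s J T.
    by have := PT (pickle (p, s, J)); rewrite /P pickleK.
  exists T; split; first exact: hO.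
  split; last by move=> p a a01 a1; exact: requirement_weak_limit.
  split => // f _; have [|x Tx] := dense_range_surj IT _ f; last by exists x.
  move=> k j jk e1 e10; have hk := nbhs_infty_ge k.
  have [J [kJ Je]] := filter_ex (filterI hk (near_invS e10)).
  (* Any weights would do for the dense range; the trivial choice [p = 0] is taken. *)
  have [_ h] := hT 0%N [::] J; have [x hx] := h k j kJ jk.
  by exists x; exact: lt_trans hx Je.
split.
  move=> O [x Ox] [V oV VO]; have IA : I_1 R (set_val x) by exact: set_valP.
  have Vx : V (set_val x) by move: Ox; rewrite -VO.
  have [T [VT GT]] := main _ _ oV Vx IA.
  have IT : I_1 R T by case: GT => -[].
  exists (SigSub (mem_set IT)); split; last exact: GT.
  by rewrite -VO.
move=> O [x Ox] [V oV VO]; have IA : I_1 R (set_val x) by case: (set_valP x).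
have Vx : V (set_val x) by move: Ox; rewrite -VO.
have [T [VT GT]] := main _ _ oV Vx IA.
have UT : U_1 R T by case: GT.
exists (SigSub (mem_set UT)); split; last exact: GT.
by rewrite -VO.
Qed.
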